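(* Let $\varphi,\alpha$ satisfy Assumption A and let $\mathcal E$ satisfy Assumption B, as spelled out in the context. Let $u\in\mathcal V_1$ and $\eta\in\mathcal V^*$ be such that $u\in D(\mathcal B)$ and $\eta\in\mathcal B(u)$. Then the function $t\mapsto\mathcal E(u(t))$ is absolutely continuous on $[0,T]$ and the following chain-rule formula holds: $$\int_s^t\langle\eta(\tau),\partial_tu(\tau)\rangle\,d\tau=\mathcal E(u(t))-\mathcal E(u(s))\qquad\text{for all }0\le s\le t\le T.$$
   Context: Let $\Omega\subset\mathbb R^N$ be an open set of finite measure, $T>0$, $Q:=\Omega\times(0,T)$. Assumption A. $\varphi:\Omega\times\mathbb R\to[0,+\infty)$ and $\alpha:\Omega\times\mathbb R\to\mathbb R$ are such that for a.e. $x\in\Omega$ and every $r\in\mathbb R$ the subdifferential $\partial\varphi(x,r):=\{\xi\in\mathbb R:\varphi(x,r')-\varphi(x,r)\ge\xi(r'-r)\ \forall r'\in\mathbb R\}$ is single-valued and equals $\alpha(x,r)$. Let $\varphi^*(x,r):=\sup_{s\in\mathbb R}\{rs-\varphi(x,s)\}$. It is assumed that: (a) for a.e. $x\in\Omega$, $\varphi(x,\cdot)$ is strictly convex, lower semicontinuous and even, and $\partial\varphi(x,0)=0$; (b) (i) for all $r\in\mathbb R$, $\varphi(\cdot,r)$ is measurable in $\Omega$; (ii) $\varphi(\cdot,1),\varphi^*(\cdot,1)\in L^1(\Omega)$; (c) there is a constant $K\ge2$ such that $\varphi(x,2r)\le K\varphi(x,r)$ and $\varphi^*(x,2r)\le K\varphi^*(x,r)$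 for all $r\ge0$ and a.e. $x\in\Omega$. Spaces. For measurable $v:\Omega\to\mathbb R$ put $\varrho_{\varphi,\Omega}(v):=\int_\Omega\varphi(x,|v(x)|)\,dx$. The Musielak-Orlicz space $V=L^\varphi(\Omega)$ is the set of measurable $v$ with $\varrho_{\varphi,\Omega}(\lambda v)<+\infty$ for some $\lambda>0$, with norm $\|v\|_V:=\inf\{\lambda>0:\varrho_{\varphi,\Omega}(v/\lambda)\le1\}$. Likewise $\mathcal V=L^\varphi(Q)$ is defined from $\varrho_{\varphi,Q}(v):=\iint_Q\varphi(x,|v(x,t)|)\,dx\,dt$. The duals $V^*$ and $\mathcal V^*$ are identified with $L^{\varphi^*}(\Omega)$ and $L^{\varphi^*}(Q)$ through $\langle\xi,v\rangle=\int_\Omega\xi v\,dx$ and $\langle\!\langle\xi,v\rangle\!\rangle=\iint_Q\xi v\,dx\,dt$. For a function $v$ on $Q$, $v(t):=v(\cdot,t)$. Functions in $\mathcal V$ are regarded also as elements of $L^1(0,T;V)$ (continuous embedding), and $\mathcal V_1:=\{v\in W^{1,1}(0,T;V):v_t\in\mathcal V\}$ (so elements of $\mathcal V_1$ are identified with their representatives in $C^0([0,T];V)$). Assumption B. $\mathcal E:V\to[0,+\infty]$, with effective domain $D(\mathcal E):=\{u\in V:\mathcal E(u)<+\infty\}$, satisfies: (a) $\mathcal E$ is convex, lower semicontinuous and $D(\mathcal E)\ne\emptyset$; (b) there is a Banach space $X$ compactly embedded into $V$ with $D(\mathcal E)\subset X$, and a non-decreasing function $\mathcal Q:[0,+\infty)\to[0,+\infty)$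 such that, for all $c\ge0$, $\|u\|_X\le\mathcal Q(c)$ whenever $u\in V$ and $\mathcal E(u)+\varrho_{\varphi,\Omega}(u)\le c$. Operator $\mathcal B$. For $u\in\mathcal V$ put $\mathbb E(u):=\int_0^T\mathcal E(u(t))\,dt$ if $t\mapsto\mathcal E(u(t))\in L^1(0,T)$ and $\mathbb E(u):=+\infty$ otherwise. $\mathcal B:=\partial_Q\mathbb E:\mathcal V\to2^{\mathcal V^*}$, i.e. $\eta\in\mathcal B(u)$ iff $\mathbb E(v)\ge\mathbb E(u)+\langle\!\langle\eta,v-u\rangle\!\rangle$ for all $v\in\mathcal V$; $D(\mathcal B):=\{u\in\mathcal V:\mathcal B(u)\ne\emptyset\}$. *)

(* Defs.v *)
From HB Require Import structures.
From mathcomp Require Import all_boot all_order all_algebra.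
From mathcomp Require Import all_classical all_reals all_analysis.
From mathcomp Require Import measurable_realfun.

Set Implicit Arguments.
Unset Strict Implicit.
Unset Printing Implicit Defensive.

Import Order.TTheory GRing.Theory Num.Theory.
Import numFieldNormedType.Exports.

Local Open Scope classical_set_scope.
Local Open Scope ring_scope.

Section lebesgue_tuple.
Context {R : realType}.

Definition tcons n (p : measurableTypeR R * n.-tuple R) : n.+1.-tuple R :=
  [the n.+1.-tuple R of p.1 :: p.2].

Definition tuncons n (x : n.+1.-tuple R) : measurableTypeR R * n.-tuple R :=
  (thead x, [tuple of behead x]).

Lemma measurable_tcons n : measurable_fun setT (@tcons n).
Proof. exact: measurable_cons. Qed.

Lemma measurable_tuncons n : measurable_fun setT (@tuncons n).
Proof.
apply/measurable_fun_pairP; split; first exact: measurable_tnth.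
exact: measurable_behead.
Qed.

Lemma tconsK n : cancel (@tcons n) (@tuncons n).
Proof.
by case=> a x; rewrite /tuncons theadE; congr (_, _); exact: val_inj.
Qed.

Section cons.
Variables (n : nat) (m : {sigma_finite_measure set (n.-tuple R) -> \bar R}).

Definition lebesgue_cons : set (n.+1.-tuple R) -> \bar R :=
  pushforward (lebesgue_measure \x m)%E (@tcons n).

Let lebesgue_cons0 : lebesgue_cons set0 = 0%E.
Proof. by rewrite /lebesgue_cons /pushforward preimage_set0 measure0. Qed.

Let lebesgue_cons_ge0 A : (0 <= lebesgue_cons A)%E.
Proof. by rewrite /lebesgue_cons /pushforward; exact: measure_ge0. Qed.

Let lebesgue_cons_sigma_additive : semi_sigma_additive lebesgue_cons.
Proof.
move=> F mF tF mUF; rewrite /lebesgue_cons /pushforward preimage_bigcup.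
apply: measure_semi_sigma_additive.
- by move=> k; rewrite -[X in measurable X]setTI; exact: measurable_tcons.
- apply/trivIsetP => /= i j _ _ ij; rewrite -preimage_setI.
  by move/trivIsetP : tF => /(_ _ _ _ _ ij) ->//; rewrite preimage_set0.
- by rewrite -preimage_bigcup -[X in measurable X]setTI;
    exact: measurable_tcons.
Qed.

HB.instance Definition _ := isMeasure.Build _ _ _
  lebesgue_cons lebesgue_cons0 lebesgue_cons_ge0 lebesgue_cons_sigma_additive.

Let lebesgue_cons_sigma_finite : sigma_finite setT lebesgue_cons.
Proof.
have /sigma_finiteP[F [FT ndF Foo]] := sigma_finiteT (@lebesgue_measure R).
have /sigma_finiteP[G [GT ndG Goo]] := sigma_finiteT m.
exists (fun k => @tuncons n @^-1` (F k `*` G k)).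
  apply/esym; rewrite -subTset => x _.
  have [i _ Fi] : (\bigcup_i F i) (tuncons x).1 by rewrite -FT.
  have [j _ Gj] : (\bigcup_i G i) (tuncons x).2 by rewrite -GT.
  exists (maxn i j) => //; split.
    by move: (tuncons x).1 Fi; exact/subsetPset/ndF/leq_maxl.
  by move: (tuncons x).2 Gj; exact/subsetPset/ndG/leq_maxr.
move=> k; have [mF FFoo] := Foo k; have [mG GGoo] := Goo k.
have mFG : measurable (F k `*` G k) by exact: measurableX.
split.
  by rewrite -[X in measurable X]setTI; exact: measurable_tuncons.
rewrite /lebesgue_cons /pushforward -comp_preimage.
rewrite (_ : @tuncons n \o @tcons n = id); last first.
  by apply/funext => p /=; exact: tconsK.
by rewrite preimage_id product_measure1E// lte_mul_pinfty// ge0_fin_numE.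
Qed.

HB.instance Definition _ := @Measure_isSigmaFinite.Build _ _ _
  lebesgue_cons lebesgue_cons_sigma_finite.

End cons.

(* The Lebesgue measure on R^n = n.-tuple R, with its product (= Borel)
   sigma-algebra: the image of lebesgue_measure \x (Lebesgue measure on
   R^(n-1)) by (a, x) |-> a :: x. *)
Fixpoint lebesgue_tuple n : {sigma_finite_measure set (n.-tuple R) -> \bar R} :=
  match n with
  | 0 => \d_([tuple] : 0.-tuple R)
  | k.+1 => lebesgue_cons (lebesgue_tuple k)
  end.

End lebesgue_tuple.
Arguments lebesgue_tuple R n : clear implicits.

Section ae_measurable.
Context d (T : measurableType d) {R : realType}.
Variable mu : {measure set T -> \bar R}.

(* The library measures live on Borel sigma-algebras.  Being a.e. equal to a
   Borel function is measurability for the completed (Lebesgue)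
   sigma-algebra; the library integral, a difference of suprema of integrals
   of simple functions, has the expected value on such functions. *)
Definition ae_measurable d' (T' : measurableType d') (D : set T)
    (f : T -> T') : Prop :=
  exists2 g : T -> T', measurable_fun D g & f = g %[ae mu in D].

Definition ae_integrable (D : set T) (f : T -> \bar R) : Prop :=
  ae_measurable D f /\ (\int[mu]_(x in D) `|f x| < +oo)%E.

End ae_measurable.

Section convex_analysis.
Context {R : realType}.
Implicit Type f : R -> R.

Definition subdiff f (r : R) : set R :=
  [set xi | forall r', xi * (r' - r) <= f r' - f r].

Definition conjugate f (r : R) : \bar R :=
  ereal_sup [set (r * s - f s)%:E | s in setT].

Definition strictly_convex f : Prop := forall r s t : R,
  r != s -> 0 < t < 1 -> f (t * r + (1 - t) * s) < t * f r + (1 - t) * f s.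

End convex_analysis.

(* Elements of the Musielak-Orlicz spaces are represented by functions on the
   whole type; only their values on D matter, up to a.e. equality.  The
   generating function takes values in \bar R so as to cover conjugates. *)
Section musielak_orlicz.
Context d (T : measurableType d) {R : realType}.
Variables (mu : {measure set T -> \bar R}) (D : set T) (Phi : T -> R -> \bar R).
Implicit Type v : T -> R.

Definition modular v : \bar R := (\int[mu]_(x in D) Phi x `|v x|%R)%E.

Definition Lphi : set (T -> R) :=
  [set v | ae_measurable mu D v /\
           exists2 l : R, 0 < l & (modular (fun x => l * v x)%R < +oo)%E].

Definition luxemburg v : R :=
  inf [set l : R | 0 < l /\ (modular (fun x => v x / l)%R <= 1)%E].

End musielak_orlicz.

(* Functions of t with values in a space V of vectors of E with norm N, where
   vectors at distance 0 are identified.  Outside of V, N is meaningless. *)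
Section bochner.
Context {R : realType} {E : lmodType R}.
Variables (V : set E) (N : E -> R).
Local Notation leb := (@lebesgue_measure R).
Implicit Types (J : set R) (f g u : R -> E).

Record stepfun := Stepfun {
  stepn : nat;
  stepset : 'I_stepn -> set R;
  stepval : 'I_stepn -> E }.

Definition is_stepfun (s : stepfun) : Prop :=
  forall i, measurable (@stepset s i) /\ V (@stepval s i).

Definition step_eval (s : stepfun) (t : R) : E :=
  \sum_i \1_(@stepset s i) t *: @stepval s i.

Definition step_int J (s : stepfun) : E :=
  \sum_i fine (leb (J `&` @stepset s i)) *: @stepval s i.

Definition strongly_measurable J f : Prop :=
  exists s : nat -> stepfun, (forall k, is_stepfun (s k)) /\
    {ae leb, forall t, J t -> N (step_eval (s k) t - f t) @[k --> \oo] --> 0}.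

Definition bochner_L1 J f : Prop :=
  [/\ {ae leb, forall t, J t -> V (f t)}, strongly_measurable J f
    & (\int[leb]_(t in J) (N (f t))%:E < +oo)%E].

(* w is (a representative of) the Bochner integral of f over J; J must have
   finite measure *)
Definition bochner_integral J f (w : E) : Prop :=
  [/\ bochner_L1 J f, V w & exists s : nat -> stepfun,
    [/\ forall k, is_stepfun (s k),
        (\int[leb]_(t in J) (N (step_eval (s k) t - f t)%R)%:E)%E
          @[k --> \oo] --> 0%E
      & N (step_int J (s k) - w) @[k --> \oo] --> 0]].

Definition test_function (T : R) (psi : R -> R) : Prop :=
  (forall k t, derivable (derive1n k psi) t 1) /\
  exists a b : R, [/\ 0 < a, b < T & forall t, psi t != 0 -> a <= t <= b].

Definition weak_derivative (T : R) u g : Prop :=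
  forall psi, test_function T psi ->
    exists2 w : E, bochner_integral `]0, T[ (fun t => derive1 psi t *: u t) w
                 & bochner_integral `]0, T[ (fun t => psi t *: g t) (- w).

(* u belongs to W^{1,1}(0,T;V) and u_t = g *)
Definition W11 (T : R) u g : Prop :=
  [/\ bochner_L1 `]0, T[ u, bochner_L1 `]0, T[ g & weak_derivative T u g].

(* u belongs to C^0([0,T];V) *)
Definition C0 (T : R) u : Prop :=
  (forall t, 0 <= t <= T -> V (u t)) /\
  forall t, 0 <= t <= T -> forall e, 0 < e -> exists2 delta, 0 < delta &
    forall s, 0 <= s <= T -> `|s - t| < delta -> N (u s - u t) < e.

End bochner.

Definition absolutely_continuous {R : realType} (a b : R) (f : R -> R) : Prop :=
  forall e, 0 < e -> exists2 delta, 0 < delta &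
    forall n (l r : 'I_n -> R),
      (forall i, [/\ a <= l i, l i <= r i & r i <= b]) ->
      (forall i j, i != j -> r i <= l j \/ r j <= l i) ->
      \sum_i (r i - l i) < delta ->
      \sum_i `|f (r i) - f (l i)| < e.

Definition open_tuple {R : realType} n (A : set (n.-tuple R)) : Prop :=
  open [set v : 'rV[R]_n | A [tuple v ord0 i | i < n]].

Section setting.
Context {R : realType} (n : nat) (Omega : set (n.-tuple R)).
Local Notation RN := (n.-tuple R).
Local Notation lebN := (lebesgue_tuple R n).
Local Notation leb := (@lebesgue_measure R).

Definition lebQ : {measure set (RN * measurableTypeR R) -> \bar R} := (lebN \x leb)%E.

Definition cylinder (T : R) : set (RN * R) := Omega `*` [set` `]0, T[%R].

Definition slice (v : RN * R -> R) (t : R) : RN -> R := fun x => v (x, t).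

Section phi.
Variable phi : RN -> R -> R.

Definition Ephi (x : RN) (r : R) : \bar R := (phi x r)%:E.
Definition phistar (x : RN) : R -> \bar R := conjugate (phi x).

Record assumptionA (alpha : RN -> R -> R) : Prop := AssumptionA {
  A_ge0 : forall x, Omega x -> forall r, 0 <= phi x r;
  A_subdiff : {ae lebN, forall x, Omega x ->
    forall r, subdiff (phi x) r = [set alpha x r]};
  A_convex : {ae lebN, forall x, Omega x ->
    [/\ strictly_convex (phi x), lower_semicontinuous (Ephi x),
        (forall r, phi x (- r) = phi x r) & subdiff (phi x) 0 = [set 0]]};
  A_measurable : forall r, ae_measurable lebN Omega (phi ^~ r);
  A_integrable : ae_integrable lebN Omega (Ephi ^~ 1) /\
                 ae_integrable lebN Omega (phistar ^~ 1);
  A_delta2 : exists2 K : R, 2 <= K & {ae lebN, forall x, Omega x ->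
    forall r, 0 <= r -> phi x (2 * r) <= K * phi x r /\
                        (phistar x (2 * r)%R <= K%:E * phistar x r)%E} }.

Definition rhoOmega : (RN -> R) -> \bar R := modular lebN Omega Ephi.
Definition spaceV : set (RN -> R) := Lphi lebN Omega Ephi.
Definition normV : (RN -> R) -> R := luxemburg lebN Omega Ephi.

Definition PhiQ (p : RN * R) : R -> \bar R := Ephi p.1.
Definition PhistarQ (p : RN * R) : R -> \bar R := phistar p.1.

Definition calV (T : R) : set (RN * R -> R) := Lphi lebQ (cylinder T) PhiQ.
Definition calVstar (T : R) : set (RN * R -> R) :=
  Lphi lebQ (cylinder T) PhistarQ.

(* v belongs to calV_1 and v_t = g *)
Definition calV1 (T : R) (v g : RN * R -> R) : Prop :=
  W11 spaceV normV T (slice v) (slice g) /\ calV T g.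

(* vbar is the representative of v in C^0([0,T];V) *)
Definition C0_representative (T : R) (v : RN * R -> R) (vbar : R -> RN -> R) :
    Prop :=
  C0 spaceV normV T vbar /\
  {ae leb, forall t, 0 < t < T -> vbar t = slice v t %[ae lebN in Omega]}.

(* <xi, v>, for xi in V^* = L^{phi^*}(Omega) *)
Definition pairing (xi v : RN -> R) : \bar R :=
  (\int[lebN]_(x in Omega) (xi x * v x)%:E)%E.

Definition pairingQ (T : R) (xi v : RN * R -> R) : \bar R :=
  (\int[lebQ]_(p in cylinder T) (xi p * v p)%:E)%E.

Section functional.
Variable E : (RN -> R) -> \bar R.

Definition domE : set (RN -> R) := [set u | spaceV u /\ (E u < +oo)%E].

(* A compact embedding of X into V.  The values of iota are representatives
   of elements of V. *)
Record compactly_embedded (X : completeNormedModType R) (iota : X -> RN -> R) :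
    Prop := CompactlyEmbedded {
  emb_V : forall x, spaceV (iota x);
  emb_linear : forall (a : R) (x y : X),
    iota (a *: x + y) = a *: iota x + iota y %[ae lebN in Omega];
  emb_inj : forall x, iota x = 0 %[ae lebN in Omega] -> x = 0;
  emb_bounded : exists C : R, forall x, normV (iota x) <= C * `|x|;
  emb_compact : forall x : nat -> X, (exists C : R, forall k, `|x k| <= C) ->
    exists (j : nat -> nat) (v : RN -> R),
      [/\ forall k l, (k < l)%N -> (j k < j l)%N, spaceV v
        & normV (iota (x (j k)) - v) @[k --> \oo] --> 0] }.

Record assumptionB : Prop := AssumptionB {
  (* E is a function on classes of functions *)
  B_ae : forall u v, spaceV u -> spaceV v ->
    u = v %[ae lebN in Omega] -> E u = E v;
  B_ge0 : forall u, spaceV u -> (0 <= E u)%E;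
  B_convex : forall u v (t : R), spaceV u -> spaceV v -> 0 < t < 1 ->
    (E (t *: u + (1 - t) *: v)%R <= t%:E * E u + (1 - t)%:E * E v)%E;
  B_lsc : forall u (a : R), spaceV u -> (a%:E < E u)%E ->
    exists2 delta, 0 < delta &
      forall v, spaceV v -> normV (v - u) < delta -> (a%:E < E v)%E;
  B_proper : domE !=set0;
  B_compact : exists (X : completeNormedModType R) (iota : X -> RN -> R),
    [/\ compactly_embedded iota,
        (forall u, domE u -> exists x, iota x = u %[ae lebN in Omega])
      & exists Q : R -> R,
        [/\ forall c, 0 <= c -> 0 <= Q c,
            forall c c', 0 <= c -> c <= c' -> Q c <= Q c'
          & forall c, 0 <= c -> forall u, spaceV u ->
              (E u + rhoOmega u <= c%:E)%E ->
              forall x, iota x = u %[ae lebN in Omega] -> `|x| <= Q c]] }.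

Definition calE (T : R) (u : RN * R -> R) : \bar R :=
  if `[< ae_integrable leb `]0, T[ (fun t => E (slice u t)) >]
  then (\int[leb]_(t in `]0%R, T[) E (slice u t))%E else +oo%E.

Definition opB (T : R) (u : RN * R -> R) : set (RN * R -> R) :=
  [set eta | calVstar T eta /\ forall v, calV T v ->
     (calE T u + pairingQ T eta (v - u)%R <= calE T v)%E].

Definition domB (T : R) : set (RN * R -> R) :=
  [set u | calV T u /\ opB T u !=set0].

End functional.
End phi.
End setting.

(* Main.v *)
(* Let u0(x, t) = ubar 0 x + int_0^t v(x, s) ds, where v is a Borel version of
   u_t; it is a version of ubar(t) for every t in [0, T], by testing the weak
   derivative with smooth bumps that increase to the indicator of an interval.

   Write e(t) = E(ubar(t)), which is lower semicontinuous, and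
   H(t) = <eta(t), u_t(t)>.  In the subdifferential inequality for eta, compare
   u with the function that differs from it only for t in an interval ]a, b[.
   Replacing u by the constant ubar(t0) with t0 in [a, b] bounds the mean of e
   over ]a, b[ by e(t0) + o(1).  Replacing u by its translate u(. + h), dividing
   by |h| and letting h tend to 0 from either side bounds the growth of e from
   both sides by the integral of H; Young's inequality dominates the difference
   quotients, so that Fatou's lemma applies.  With lower semicontinuity these
   inequalities give e(b) - e(a) = int_a^b H. *)
Require Import Defs.
From HB Require Import structures.
From mathcomp Require Import all_boot all_order all_algebra.
From mathcomp Require Import all_classical all_reals all_analysis.
From mathcomp Require Import measurable_realfun.
From mathcomp Require Import lra ring.

Set Implicit Arguments.
Unset Strict Implicit.
Unset Printing Implicit Defensive.

Import Order.TTheory GRing.Theory Num.Theory.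
Import numFieldNormedType.Exports.

Local Open Scope classical_set_scope.
Local Open Scope ring_scope.

(** * Integration *)

(** The quotients [(primX v (x, t + h) - primX v (x, t)) / h] have no evident integrable majorant
    independent of [h]. Young's inequality at two different times, [|eta (x, t) * v (x, s)| <= z (x,
    t) + w (x, s)], gives one that moves with [h]: [z] plus the quotient of the primitive of [w].
    The integral of that quotient over the whole line does not depend on [h], so adding it makes the
    integrands nonnegative at the same cost before and after Fatou's lemma.

    Vector-valued calculus is avoided: integration over a measurable set [A] is a bounded functional
    on [V], because the conjugate of [phi x] at 1 is integrable, and it reduces the weak derivative
    to real functions of time.

    Each translate gives one inequality between [e a] and [e b]: lower semicontinuity bounds a mean
    of [e] at one end from below, the constant competitor bounds one at the other end from above,
    and a finite value at one time spreads to the others. At 0 and [T] one translate leaves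
    [[0, T]]; the constant competitor and the interior identity stand in for it. *)

Section unmeasurable_integrals.
Context d (T : measurableType d) {R : realType}.
Variable mu : {measure set T -> \bar R}.
Local Open Scope ereal_scope.
Implicit Types (D : set T) (f g : T -> \bar R).

Import HBNNSimple.

(* As the integral of a nonnegative function is a supremum over the simple
   functions below it, no measurability is needed here. *)
Lemma ge0_le_integral_unmeasurable D f g :
  (forall x, D x -> 0 <= f x) -> (forall x, D x -> f x <= g x) ->
  \int[mu]_(x in D) f x <= \int[mu]_(x in D) g x.
Proof.
move=> f0 fg; rewrite integral_mkcond [leRHS]integral_mkcond.
rewrite !ge0_integralTE.
- apply: ge_ereal_sup => _ [h hf <-]; apply: ereal_sup_ubound; exists h => //.
  move=> x; apply: (le_trans (hf x)); rewrite !patchE.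
  by case: ifPn => // /set_mem; exact: fg.
- move=> x; rewrite patchE; case: ifPn => // /set_mem Dx.
  by rewrite (le_trans (f0 _ Dx))// fg.
- by move=> x; rewrite patchE; case: ifPn => // /set_mem /f0.
Qed.

(** A simple function below [f] is measurable, so it can be cut off on the exceptional null set
    without changing its integral; what remains lies below [g]. *)
Lemma ge0_ae_le_integral_unmeasurable D f g :
  (forall x, D x -> 0 <= f x) -> (forall x, D x -> 0 <= g x) ->
  {ae mu, forall x, D x -> f x <= g x} ->
  \int[mu]_(x in D) f x <= \int[mu]_(x in D) g x.
Proof.
move=> f0 g0 [N [mN N0 fgN]]; rewrite integral_mkcond.
rewrite ge0_integralTE; last first.
  by move=> x; rewrite patchE; case: ifPn => // /set_mem /f0.
apply: ge_ereal_sup => _ [h hf <-].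
rewrite -integralT_nnsfun (ge0_negligible_integral mN)//; last 2 first.
- exact/measurable_EFinP.
- by move=> x _; rewrite lee_fin.
rewrite integral_mkcond [leRHS]integral_mkcond.
apply: ge0_le_integral_unmeasurable => x _; rewrite !patchE.
  by case: ifPn => //; rewrite lee_fin.
case: ifPn => [|_]; last by case: ifPn => // /set_mem /g0.
rewrite inE => -[_ xN]; apply: (le_trans (hf x)); rewrite patchE.
case: ifPn => // /set_mem Dx; apply: contrapT => fgx; apply/xN/fgN => /=.
by move=> /(_ Dx).
Qed.

Lemma ae_eq_integral_unmeasurable D f g :
  f = g %[ae mu in D] -> \int[mu]_(x in D) f x = \int[mu]_(x in D) g x.
Proof.
move=> fg; rewrite integralE [RHS]integralE; congr (_ - _); apply/eqP;
    rewrite eq_le !ge0_ae_le_integral_unmeasurable//;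
    by apply: filterS fg => x fg /fg E; rewrite ?funeposE ?funenegE E.
Qed.

End unmeasurable_integrals.

Section shift.
Context {R : realType}.
Local Notation leb := (@lebesgue_measure R).
Local Open Scope ereal_scope.

Section map.
Variable h : R.

Let shift (t : measurableTypeR R) : measurableTypeR R := (t + h)%R.

Let mshift : measurable_fun setT shift.
Proof. exact: measurable_funD. Qed.

Let shift_mixin := isMeasurableFun.Build _ _ _ _ _ mshift.
Let shift_pack : {mfun _ >-> _} := HB.pack shift shift_mixin.

Lemma lebesgue_measure_addr (A : set R) : measurable A ->
  leb ((fun t => (t + h)%R) @^-1` A) = leb A.
Proof.
move=> mA.
suff -> : leb A = pushforward leb shift_pack A by [].
apply: lebesgue_measure_unique => //= _ [[a b]] _ <-.
rewrite /pushforward (_ : _ @^-1` _ = `](a - h)%R, (b - h)%R]%classic); last first.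
  by apply/seteqP; split => x /=; rewrite /shift !in_itv/= => /andP[? ?];
    apply/andP; split; lra.
rewrite !lebesgue_measure_itv/= !lte_fin.
by rewrite ltrD2r; case: ifP => // _; rewrite -!EFinB; congr EFin; ring.
Qed.

Lemma ge0_integral_addr (D : set R) (f : R -> \bar R) :
  measurable D -> measurable_fun D f -> (forall t, D t -> 0 <= f t) ->
  \int[leb]_(t in (fun t => (t + h)%R) @^-1` D) f (t + h)%R =
  \int[leb]_(t in D) f t.
Proof.
move=> mD mf f0.
transitivity (\int[pushforward leb shift_pack]_(t in D) f t).
  rewrite ge0_integral_pushforward//.
  by move=> y /set_mem /f0.
apply: eq_measure_integral => A mA _; exact: lebesgue_measure_addr.
Qed.

End map.

End shift.

(** * Primitives and their difference quotients *)

Section primitive.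
Context {R : realType}.
Local Notation leb := (@lebesgue_measure R).

(** With base point [-oo], increments make sense at all real times and translation produces no
    boundary terms, so that [integral_prim_incr] is an equality. *)
Definition prim (f : R -> R) (t : R) : R := \int[leb]_(s in `]-oo, t]) f s.

Section integrable.
Variables (f : R -> R) (intf : leb.-integrable setT (EFin \o f)).

Lemma prim_sub (s t : R) : s <= t ->
  prim f t - prim f s = \int[leb]_(r in `]s, t]) f r.
Proof.
move=> st; rewrite /prim Rintegral_itvB//; exact: integrableS intf.
Qed.

Lemma prim_diff_quotient (h : nat -> R) :
  (forall n, h n != 0) -> h n @[n --> \oo] --> 0 ->
  {ae leb, forall t, (prim f (t + h n) - prim f t) / h n @[n --> \oo] --> f t}.
Proof.
move=> h0 hc; have := @FTC1Ny R f _ _.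
have intfS (D : set R) : measurable D -> leb.-integrable D (EFin \o f).
  by move=> mD; apply: integrableS intf.
have loc : locally_integrable setT f.
  by apply: open_integrable_locally => //; exact: openT.
move=> /(_ (fun y => intfS _ (measurable_itv _)) loc).
apply: filterS; first exact: (ae_filter_ringOfSetsType leb).
move=> t [df <-].
have hh : h n @[n --> \oo] --> 0^'.
  move=> /= A [e /= e0 eA]; move/cvgrPdist_lt : hc => /(_ e e0).
  apply: filterS => n /= hn; apply: eA => //=.
have /(cvg_comp _ _ hh) := df; rewrite derive1E /derive.
rewrite (_ : _ \o h = (fun n => (prim f (t + h n) - prim f t) / h n)) //.
by apply/funext => n /=; rewrite [in LHS]/GRing.scale/= mulr1 (addrC t) mulrC.
Qed.

End integrable.

End primitive.

(** Moving the upper bound into the integrand, as the indicator of [s <= t], turns the primitive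
    into a partial integral of a jointly measurable function with parameter [(x, t)]. *)
Lemma measurable_prim_pair d (X : measurableType d) {R : realType} (mR := measurableTypeR R)
    (f : X * mR -> R) : measurable_fun setT f ->
  measurable_fun setT (fun p : X * mR => prim (fun s => f (p.1, s)) p.2).
Proof.
move=> mf.
pose S := [set q : (X * mR) * mR | q.2 <= q.1.2].
have mS : measurable S.
  rewrite (_ : S = (fun q => q.2 - q.1.2) @^-1` `]-oo, 0%R]); last first.
    by apply/seteqP; split => q; rewrite /S/= in_itv/= subr_le0.
  rewrite -[X in measurable X]setTI.
  suff : measurable_fun setT (fun q : (X * mR) * mR => q.2 - q.1.2) by exact.
  apply: measurable_funB => //.
  by apply: (measurableT_comp measurable_snd); exact: measurable_fst.
pose g := (fun q : (X * mR) * mR => (f (q.1.1, q.2))%:E) \_ S.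
have mg : measurable_fun setT g.
  apply/measurable_restrict => //; apply: measurable_funTS; apply/measurable_EFinP.
  apply: (measurableT_comp mf); apply: measurable_fun_pair => //.
  by apply: (measurableT_comp measurable_fst); exact: measurable_fst.
rewrite (_ : (fun p => _) = fun p =>
   fine (\int[lebesgue_measure]_s g (p, s))%E); last first.
  apply/funext => -[x t]; rewrite /prim /Rintegral integral_mkcond; congr fine.
apply: measurableT_comp => //.
rewrite (_ : (fun p => _) = fun p =>
   (\int[lebesgue_measure]_s (g^\+ (p, s)) - \int[lebesgue_measure]_s (g^\- (p, s)))%E).
  apply: emeasurable_funB.
    apply: (measurable_fun_fubini_tonelli_F (g^\+)%E) => //.
    exact: measurable_funepos.
  apply: (measurable_fun_fubini_tonelli_F (g^\-)%E) => //.
  exact: measurable_funeneg.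
by apply/funext => p; rewrite [LHS]integralE; congr (_ - _)%E; apply: eq_integral => s _; rewrite ?funeposE ?funenegE.
Qed.

Section prim_estimates.
Context {R : realType}.
Local Notation leb := (@lebesgue_measure R).
Variables (w : R -> R) (intw : leb.-integrable setT (EFin \o w)).

Let intwS (D : set R) : measurable D -> leb.-integrable D (EFin \o w).
Proof. by move=> mD; apply: integrableS intw. Qed.

Lemma EFin_prim_sub (s t : R) : s <= t ->
  (prim w t - prim w s)%:E = (\int[leb]_(r in `]s, t]) (w r)%:E)%E.
Proof.
move=> st; rewrite prim_sub// /Rintegral fineK//.
by apply: integrable_fin_num => //; exact: intwS.
Qed.

Hypothesis w0 : forall s, 0 <= w s.

Lemma prim_le (s t : R) : s <= t -> prim w s <= prim w t.
Proof. by move=> st; rewrite -subr_ge0 prim_sub// Rintegral_ge0. Qed.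

Local Open Scope ereal_scope.

(** Tonelli on the strip [t < s <= t + h]: each [s] is counted for a set of [t] of length [h]. *)
Let integral_prim_incr_ge0 (h : R) : (0 <= h)%R ->
  \int[leb]_t (prim w (t + h) - prim w t)%:E = h%:E * \int[leb]_t (w t)%:E.
Proof.
move=> h0.
pose S := [set p : measurableTypeR R * measurableTypeR R | (p.1 < p.2 <= p.1 + h)%R].
have mS : measurable S.
  rewrite (_ : S = [set p | (0 < p.2 - p.1)%R] `&` [set p | (p.2 - p.1 <= h)%R]).
    have mB : measurable_fun setT (fun p : measurableTypeR R * measurableTypeR R => (p.2 - p.1)%R).
      by apply: measurable_funB.
    apply: measurableI.
      have -> : [set p | (0 < p.2 - p.1)%R] = (fun p : measurableTypeR R * measurableTypeR R => (p.2 - p.1)%R) @^-1` `]0%R, +oo[.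
        by apply/seteqP; split => p /=; rewrite in_itv/= andbT.
      by rewrite -[X in measurable X]setTI; exact: mB.
    have -> : [set p | (p.2 - p.1 <= h)%R] = (fun p : measurableTypeR R * measurableTypeR R => (p.2 - p.1)%R) @^-1` `]-oo, h].
      by apply/seteqP; split => p /=; rewrite in_itv/=.
    by rewrite -[X in measurable X]setTI; exact: mB.
  apply/seteqP; split => p; rewrite /S/=.
    by move=> /andP[? ?]; split; lra.
  by move=> [? ?]; apply/andP; split; lra.
pose g := (fun p : measurableTypeR R * measurableTypeR R => (w p.2)%:E) \_ S.
have mw : measurable_fun setT w by case/integrableP: intw => /measurable_EFinP.
have mg : measurable_fun setT g.
  apply/measurable_restrict => //; apply: measurable_funTS; apply/measurable_EFinP.
  exact: (measurableT_comp mw).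
have g0 p : 0 <= g p by rewrite /g patchE; case: ifP => // _; rewrite lee_fin.
transitivity (\int[leb]_t \int[leb]_s g (t, s)).
  apply: eq_integral => t _; rewrite EFin_prim_sub ?lerDl// integral_mkcond.
  apply: eq_integral => s _; rewrite /g !patchE.
  by congr (if _ then _ else _); apply/idP/idP; rewrite !inE/= in_itv.
rewrite fubini_tonelli// -ge0_integralZl//; last 2 first.
- exact/measurable_EFinP.
- by move=> s _; rewrite lee_fin.
apply: eq_integral => s _.
transitivity (\int[leb]_(t in `[(s - h)%R, s[) (w s)%:E).
  rewrite [RHS]integral_mkcond; apply: eq_integral => t _; rewrite /g !patchE.
  congr (if _ then _ else _); apply/idP/idP; rewrite !inE/= in_itv/= /S/= => /andP[? ?];
    apply/andP; split; lra.
rewrite integral_cst//= lebesgue_measure_itv/= lte_fin.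
rewrite muleC; case: ltP => sh.
  by congr (_ * _); rewrite -EFinB; congr EFin; ring.
by have -> : h = 0%R by lra.
Qed.

(** Divided by [|h|], the increments keep exactly the mass of [w]. This is what allows them to serve
    as a majorant that varies with [h] in [liminf_pairing_incr]. *)
Lemma integral_prim_incr (h : R) :
  \int[leb]_t `|prim w (t + h) - prim w t|%:E = `|h|%:E * \int[leb]_t (w t)%:E.
Proof.
have [h0|h0] := leP 0%R h.
  rewrite ger0_norm// -integral_prim_incr_ge0//; apply: eq_integral => t _.
  by rewrite ger0_norm// subr_ge0 prim_le// lerDl.
rewrite ltr0_norm// -integral_prim_incr_ge0 ?oppr_ge0 1?ltW//.
rewrite -[RHS](@ge0_integral_addr R h setT (fun t => (prim w (t - h) - prim w t)%:E))//.
- rewrite preimage_setT; apply: eq_integral => t _; rewrite addrK distrC ger0_norm//.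
  by rewrite subr_ge0 prim_le// gerDl ltW.
- apply/measurable_EFinP; apply: measurable_funB.
    by apply: nondecreasing_measurable => // s t st; apply: prim_le; rewrite lerD2r.
  by apply: nondecreasing_measurable => // s t st; exact: prim_le.
- by move=> t _; rewrite lee_fin subr_ge0 prim_le// lerDl oppr_ge0 ltW.
Qed.

End prim_estimates.

Lemma ge0_integral_strip d (X : measurableType d) {R : realType}
    (m : {sigma_finite_measure set X -> \bar R}) (mR := measurableTypeR R)
    (f : X * mR -> \bar R) (I : set mR) :
  measurable I -> measurable_fun setT f -> (forall p, 0 <= f p)%E ->
  (\int[m \x lebesgue_measure]_(p in setT `*` I) f p =
   \int[m]_x \int[lebesgue_measure]_(t in I) f (x, t))%E.
Proof.
move=> mI mf f0; rewrite integral_mkcond fubini_tonelli1.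
- apply: eq_integral => x _; rewrite /fubini_F [RHS]integral_mkcond.
  apply: eq_integral => t _; rewrite !patchE.
  by congr (if _ then _ else _); apply/idP/idP; rewrite !inE/= => // -[].
- apply/measurable_restrict => //; first exact: measurableX.
  exact: measurable_funTS.
- by move=> p; rewrite patchE; case: ifP.
Qed.

(** The two-time Young bound integrated over the second time, the first being frozen: [c] and [a]
    will be [eta (x, t)] and [z (x, t)]. *)
Lemma prim_sub_bound {R : realType} (v w : R -> R) (c a s t : R) :
  lebesgue_measure.-integrable setT (EFin \o v) ->
  lebesgue_measure.-integrable setT (EFin \o w) ->
  (forall r, `|c * v r| <= a + w r) -> (forall r, 0 <= w r) ->
  `|c * (prim v t - prim v s)| <= `|t - s| * a + `|prim w t - prim w s|.
Proof.
move=> iv iw cv w0.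
wlog st : s t / s <= t => [H|].
  have [/H//|/ltW/H vw] := leP s t.
  by rewrite -(opprB (prim v s)) mulrN normrN (distrC t) (distrC (prim w t)).
rewrite (ger0_norm (x := t - s)); last by rewrite subr_ge0.
rewrite (ger0_norm (x := prim w t - _)); last by rewrite subr_ge0; exact: prim_le.
have iS (f : R -> R) : lebesgue_measure.-integrable setT (EFin \o f) ->
    lebesgue_measure.-integrable `]s, t] (EFin \o f).
  by move=> fi; apply: integrableS fi.
have icst : lebesgue_measure.-integrable `]s, t] (EFin \o cst a).
  apply/integrableP; split; first exact/measurable_EFinP.
  have /= -> := integral_cst (@lebesgue_measure R)
    (measurable_itv `]s, t]) (`|a|%:E)%E.
  by rewrite lebesgue_measure_itv/=; case: ifP => _; rewrite -?EFinB -EFinM ltry.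
rewrite !prim_sub// -RintegralZl//; last exact: iS.
have icv : lebesgue_measure.-integrable `]s, t] (EFin \o (fun r => c * v r)).
  rewrite (_ : _ \o _ = (fun r => c%:E * (v r)%:E)%E)//.
  by apply: integrableZl => //; exact: iS.
apply: le_trans (le_normr_Rintegral _ icv) _ => //.
rewrite (_ : (t - s) * a = \int[lebesgue_measure]_(r in `]s, t]) cst a r); last first.
  rewrite Rintegral_cst//= lebesgue_measure_itv/= lte_fin mulrC.
  case: ltP => //= ts; have -> : t = s by apply/eqP; rewrite eq_le ts.
  by rewrite subrr.
rewrite -RintegralD//; last exact: iS.
apply: le_Rintegral => //.
- exact: integrable_norm.
- rewrite (_ : _ \o _ = (fun r => (cst a r)%:E + (w r)%:E)%E)//.
  by apply: integrableD => //; exact: iS.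
Qed.

Section product_prim.
Context d (X : measurableType d) {R : realType} (mR := measurableTypeR R).
Variable m : {sigma_finite_measure set X -> \bar R}.
Local Notation leb := (@lebesgue_measure R).
Local Notation M := (m \x leb)%E.

Definition primX (f : X * mR -> R) (p : X * mR) : R :=
  prim (fun s => f (p.1, s)) p.2.

Lemma measurable_primX f : measurable_fun setT f -> measurable_fun setT (primX f).
Proof. exact: measurable_prim_pair. Qed.

Variables v eta z w : X * mR -> R.
Hypothesis mv : measurable_fun setT v.
Hypothesis meta : measurable_fun setT eta.
Hypothesis iz : M.-integrable setT (EFin \o z).
Hypothesis iw : M.-integrable setT (EFin \o w).
Hypothesis z0 : forall p, 0 <= z p.
Hypothesis w0 : forall p, 0 <= w p.
Hypothesis ivx : forall x, leb.-integrable setT (fun s => (v (x, s))%:E).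
Hypothesis iwx : forall x, leb.-integrable setT (fun s => (w (x, s))%:E).
Hypothesis young : forall x t s, `|eta (x, t) * v (x, s)| <= z (x, t) + w (x, s).

Let mz : measurable_fun setT z.
Proof. by case/integrableP : iz => /measurable_EFinP. Qed.

Let mw : measurable_fun setT w.
Proof. by case/integrableP : iw => /measurable_EFinP. Qed.

Lemma primX_sub_bound x s t :
  `|eta (x, t) * (primX v (x, s) - primX v (x, t))| <=
  `|s - t| * z (x, t) + `|primX w (x, s) - primX w (x, t)|.
Proof. by apply: prim_sub_bound => //; [exact: ivx|exact: iwx]. Qed.

Lemma measurable_translate (h : R) :
  measurable_fun setT (fun p : X * mR => (p.1, p.2 + h) : X * mR).
Proof.
by apply: measurable_fun_pair => //; exact: measurable_funD.
Qed.

(** The right side is [b - a] times an integral over a slab that shrinks with [b - a], hence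
    [o(b - a)]: this is the error made in comparing [u] with a constant. *)
Lemma integral_primX_bound (I : set mR) (a b t0 : R) :
  I = `]a, b[%classic -> a <= t0 <= b ->
  (\int[M]_(p in setT `*` I) `|eta p * (primX v (p.1, t0) - primX v p)|%:E <=
   (b - a)%:E * \int[M]_(p in setT `*` I) (z p + w p)%:E)%E.
Proof.
move=> IE /andP[at0 t0b].
have ab : 0 <= b - a by lra.
have mI : measurable I by rewrite IE; exact: measurable_itv.
have mXI : measurable ([set: X] `*` I) by exact: measurableX.
(* An upper bound for the increments of [primX w] inside [I]. It does not depend on [t], so its
   integral over [I] produces the second factor [b - a]. *)
pose g (p : X * mR) : R := \int[leb]_(s in I) w (p.1, s).
have gE x t : (g (x, t))%:E = (\int[leb]_(s in I) (w (x, s))%:E)%E.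
  rewrite /g /Rintegral fineK//; apply: integrable_fin_num => //.
  exact: integrableS (iwx x).
apply: (@le_trans _ _ (\int[M]_(p in setT `*` I) ((b - a) * z p + g p)%:E)%E).
  apply: ge0_le_integral_unmeasurable => [p _|[x t] [_ /= It]]; rewrite lee_fin//.
  apply: (le_trans (primX_sub_bound x t0 t)); apply: lerD.
    apply: ler_wpM2r => //; move: It; rewrite IE /= in_itv/= => /andP[? ?].
    by rewrite ler_norml; apply/andP; split; lra.
  rewrite -lee_fin gE; move: It; rewrite IE/= in_itv/= => /andP[at_ tb].
  have mwx : measurable_fun setT (fun s : mR => w (x, s)) by exact: measurableT_comp.
  rewrite -(@integral_itv_bndoo _ a b _ true false); last first.
    by apply/measurable_EFinP; exact: measurable_funTS.
  have [tt0|t0t] := leP t t0.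
    rewrite ger0_norm ?subr_ge0 ?prim_le//; last exact: iwx.
    rewrite EFin_prim_sub//; last exact: iwx.
    apply: ge0_subset_integral => //=.
    - by apply/measurable_EFinP; exact: measurable_funTS.
    - by move=> s _; rewrite lee_fin.
    - by move=> s /=; rewrite !in_itv/= => /andP[? ?]; apply/andP; split; lra.
  rewrite distrC ger0_norm ?subr_ge0 ?prim_le ?(ltW t0t)//; last exact: iwx.
  rewrite EFin_prim_sub ?(ltW t0t)//; last exact: iwx.
  apply: ge0_subset_integral => //=.
  - by apply/measurable_EFinP; exact: measurable_funTS.
  - by move=> s _; rewrite lee_fin.
  - by move=> s /=; rewrite !in_itv/= => /andP[? ?]; apply/andP; split; lra.
have mwr : measurable_fun setT ((EFin \o w) \_ ([set: X] `*` I)).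
  apply/measurable_restrict => //; exact/measurable_funTS/measurable_EFinP.
have mg : measurable_fun setT (fun x => \int[leb]_(s in I) (w (x, s))%:E)%E.
  rewrite (_ : (fun _ => _) = fubini_F leb ((EFin \o w) \_ ([set: X] `*` I))).
    apply: measurable_fun_fubini_tonelli_F => //.
    by move=> p; rewrite patchE; case: ifP => //= _; rewrite lee_fin.
  apply/funext => x; rewrite integral_mkcond; apply: eq_integral => s _.
  rewrite !patchE; congr (if _ then _ else _).
  by apply/idP/idP; rewrite !inE/= => // -[].
have mg' : measurable_fun setT g.
  rewrite (_ : g = (fun x => fine (\int[leb]_(s in I) (w (x, s))%:E)%E) \o fst)//.
  by apply: measurableT_comp => //; apply: measurableT_comp.
under eq_integral do rewrite EFinD EFinM.
rewrite ge0_integralD//; last 4 first.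
- by move=> p _; rewrite -EFinM lee_fin mulr_ge0.
- by apply/measurable_EFinP/measurable_funTS; exact: measurable_funM.
- by move=> p _; rewrite lee_fin /g Rintegral_ge0.
- exact/measurable_EFinP/measurable_funTS.
under [in leRHS]eq_integral do rewrite EFinD.
rewrite ge0_integralD//; last 4 first.
- by move=> p _; rewrite lee_fin.
- exact/measurable_EFinP/measurable_funTS.
- by move=> p _; rewrite lee_fin.
- exact/measurable_EFinP/measurable_funTS.
rewrite ge0_muleDr; last 2 first.
- by apply: integral_ge0 => p _; rewrite lee_fin.
- by apply: integral_ge0 => p _; rewrite lee_fin.
rewrite ge0_integralZl_EFin//; last 2 first.
- by move=> p _; rewrite lee_fin.
- exact/measurable_EFinP/measurable_funTS.
apply: leeD2l.
have strip (f : X * mR -> R) : measurable_fun setT f -> (forall p, 0 <= f p) ->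
    (\int[M]_(p in setT `*` I) (f p)%:E = \int[m]_x \int[leb]_(t in I) (f (x, t))%:E)%E.
  move=> mf f0; apply: (@ge0_integral_strip _ _ _ m (EFin \o f)) => //.
  exact/measurable_EFinP.
rewrite !strip//; last by move=> p; exact: Rintegral_ge0.
rewrite -ge0_integralZl_EFin//; last first.
  by move=> x _; apply: integral_ge0 => s _; rewrite lee_fin.
rewrite le_eqVlt; apply/orP; left; apply/eqP.
apply: eq_integral => x _; under eq_integral do rewrite gE.
rewrite integral_cst// muleC; congr (_ * _)%E.
rewrite IE /= lebesgue_measure_itv/= lte_fin; case: ltP => // ba.
by have -> : b - a = 0 by lra.
Qed.

End product_prim.

Lemma limn_einf_gt {R : realType} (u : nat -> \bar R) (l e : R) :
  (l%:E <= limn_einf u)%E -> 0 < e ->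
  exists N, forall n, (N <= n)%N -> ((l - e)%:E < u n)%E.
Proof.
move=> lu e0.
have : ((l - e)%:E < ereal_sup (range (einfs u)))%E.
  rewrite -(cvg_lim _ (@cvg_einfs_sup _ u))//= -limn_einf_lim.
  by apply: lt_le_trans lu; rewrite lte_fin ltrBlDr ltrDl.
move=> /ereal_sup_gt[_ [N _ <-] leN]; exists N => n Nn.
by apply: (lt_le_trans leN); apply: ereal_inf_lbound; exists n.
Qed.

Section diff_quotient.
Context d (X : measurableType d) {R : realType} (mR := measurableTypeR R).
Variable m : {sigma_finite_measure set X -> \bar R}.
Local Notation leb := (@lebesgue_measure R).
Local Notation M := (m \x leb)%E.
Variables v eta z w : X * mR -> R.
Hypothesis mv : measurable_fun setT v.
Hypothesis meta : measurable_fun setT eta.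
Hypothesis iz : M.-integrable setT (EFin \o z).
Hypothesis iw : M.-integrable setT (EFin \o w).
Hypothesis z0 : forall p, 0 <= z p.
Hypothesis w0 : forall p, 0 <= w p.
Hypothesis ivx : forall x, leb.-integrable setT (fun s => (v (x, s))%:E).
Hypothesis iwx : forall x, leb.-integrable setT (fun s => (w (x, s))%:E).
Hypothesis young : forall x t s, `|eta (x, t) * v (x, s)| <= z (x, t) + w (x, s).

Let mz : measurable_fun setT z.
Proof. by case/integrableP : iz => /measurable_EFinP. Qed.

Let mw : measurable_fun setT w.
Proof. by case/integrableP : iw => /measurable_EFinP. Qed.

Definition incr (f : X * mR -> R) (h : R) (p : X * mR) : R :=
  primX f (p.1, p.2 + h) - primX f p.

Lemma measurable_incr f h : measurable_fun setT f -> measurable_fun setT (incr f h).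
Proof.
move=> mf; apply: measurable_funB; last exact: measurable_primX.
by apply: measurableT_comp (measurable_translate h) => //; exact: measurable_primX.
Qed.

Lemma integrable_incr (h : R) : M.-integrable setT (EFin \o incr w h).
Proof.
apply/integrableP; split; first by apply/measurable_EFinP; exact: measurable_incr.
rewrite fubini_tonelli1//; last first.
  apply: measurableT_comp => //; apply/measurable_EFinP; exact: measurable_incr.
rewrite (_ : (\int[m]_x _)%E = (`|h|%:E * \int[M]_p (w p)%:E)%E).
  case/integrableP : iw => _.
  rewrite (eq_integral (EFin \o w)) => [iwoo|p _]; last by rewrite /= ger0_norm.
  by rewrite lte_mul_pinfty ?lee_fin// integral_ge0 // => p _; rewrite lee_fin.
rewrite fubini_tonelli1//; last exact/measurable_EFinP.
rewrite -ge0_integralZl_EFin//; last 2 first.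
- by move=> x _; apply: integral_ge0 => s _; rewrite lee_fin.
- by apply: measurable_fun_fubini_tonelli_F => //; exact/measurable_EFinP.
apply: eq_integral => x _; rewrite /fubini_F.
by rewrite -(integral_prim_incr (iwx x)).
Qed.

Lemma integrable_pairing : M.-integrable setT (fun p => (eta p * v p)%:E).
Proof.
have : M.-integrable setT (fun p => (z p)%:E + (w p)%:E)%E by exact: integrableD.
apply: le_integrable => //; first by apply/measurable_EFinP; exact: measurable_funM.
move=> [x t] _ /=; rewrite lee_fin (le_trans (young x t t))//.
by rewrite ler_norm.
Qed.

Lemma integrable_pairing_incr (h : R) :
  M.-integrable setT (fun p => (eta p * incr v h p)%:E).
Proof.
have : M.-integrable setT (fun p => `|h|%:E * (z p)%:E + `|(incr w h p)%:E|)%E.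
  apply: integrableD => //; first exact: integrableZl.
  by apply: integrable_abse; exact: integrable_incr.
apply: le_integrable => //.
  by apply/measurable_EFinP; apply: measurable_funM => //; exact: measurable_incr.
move=> [x t] _ /=; rewrite lee_fin /incr/=.
have := primX_sub_bound w0 ivx iwx young x (t + h) t.
by rewrite addrAC subrr add0r => /le_trans; apply; rewrite ler_norm.
Qed.

(** The steps may have either sign, for both translates. Fatou's lemma yields a lower bound only;
    with negative steps the bound wanted later comes from applying this to [- eta]. *)
Lemma liminf_pairing_incr (I : set mR) (h : nat -> R) (e : R) :
  measurable I -> (forall n, h n != 0) -> h n @[n --> \oo] --> 0 -> 0 < e ->
  exists N, forall n, (N <= n)%N ->
    \int[M]_(p in setT `*` I) (eta p * v p) - e <
    (h n)^-1 * \int[M]_(p in setT `*` I) (eta p * incr v (h n) p).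
Proof.
move=> mI h0 hc e0.
pose A := [set: X] `*` I; have mA : measurable A by exact: measurableX.
(* Nonnegative by [primX_sub_bound]. The term in [w] is not cut off by [\1_A], since the mass
   identity [integral_prim_incr] holds over the whole line. *)
pose q n p : \bar R :=
  ((((h n)^-1 * (eta p * incr v (h n) p) + z p) * \1_A p)%:E +
   ((h n)^-1 * incr w (h n) p)%:E)%E.
pose L p : \bar R := (((eta p * v p + z p) * \1_A p)%:E + (w p)%:E)%E.
have mind : measurable_fun setT (\1_A : X * mR -> R) by exact: measurable_indic.
have mincr f n : measurable_fun setT f -> measurable_fun setT (incr f (h n)).
  exact: measurable_incr.
have mq n : measurable_fun setT (q n).
  apply: emeasurable_funD; apply/measurable_EFinP.
    apply: measurable_funM => //; apply: measurable_funD => //.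
    by apply: measurable_funM => //; apply: measurable_funM => //; exact: mincr.
  by apply: measurable_funM => //; exact: mincr.
(* The primitive of [w] is monotone, so its difference quotient is nonnegative for either sign of
   the step. *)
have incrw n p : (h n)^-1 * incr w (h n) p = `|h n|^-1 * `|incr w (h n) p|.
  case: p => x t; rewrite /incr/primX/=.
  have [hp|hp] := ltP 0 (h n).
    by rewrite (gtr0_norm hp) ger0_norm// subr_ge0 prim_le ?lerDl ?(ltW hp)//; exact: iwx.
  rewrite (ler0_norm hp) ler0_norm ?mulrNN ?invrN ?mulrNN//.
  by rewrite subr_le0 prim_le ?gerDl//; exact: iwx.
have q0 n p : setT p -> (0 <= q n p)%E.
  move=> _; rewrite /q -EFinD lee_fin indicE.
  have w_ge0 : 0 <= (h n)^-1 * incr w (h n) p by rewrite incrw mulr_ge0.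
  case: (p \in A); last by rewrite mulr0 add0r.
  rewrite mulr1 incrw.
  suff : `|(h n)^-1 * (eta p * incr v (h n) p)| <= z p + `|h n|^-1 * `|incr w (h n) p|.
    by rewrite ler_norml => /andP[+ _]; lra.
  rewrite normrM normfV -[z p](@mulKf _ `|h n|) ?normr_eq0// -mulrDr.
  apply: ler_wpM2l => //; rewrite /incr; case: p {w_ge0} => x t/=.
  have := primX_sub_bound w0 ivx iwx young x (t + h n) t.
  by rewrite addrAC subrr add0r.
have L0 p : (0 <= L p)%E.
  rewrite /L -EFinD lee_fin indicE; case: (p \in A); last by rewrite mulr0 add0r.
  rewrite mulr1; case: p => x t; have := young x t t; rewrite ler_norml => /andP[]; lra.
have mL : measurable_fun setT L.
  apply: emeasurable_funD; apply/measurable_EFinP => //.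
  by apply: measurable_funM => //; apply: measurable_funD => //; exact: measurable_funM.
have iA f : M.-integrable setT (EFin \o f) ->
    M.-integrable A (EFin \o f) by move=> fi; apply: integrableS fi.
have iind f : M.-integrable setT (EFin \o f) ->
    M.-integrable setT (fun p => (f p * \1_A p)%:E) /\
    (\int[M]_p (f p * \1_A p)%:E = \int[M]_(p in A) (f p)%:E)%E.
  move=> fi; have E : (fun p => (f p * \1_A p)%:E) = (EFin \o f) \_ A.
    by apply/funext => p; rewrite patchE indicE; case: ifP => _ /=; rewrite ?mulr1 ?mulr0.
  rewrite E -integral_mkcond; split => //.
  by rewrite -integrable_mkcond//; exact: iA.
pose Z : R := \int[M]_(p in A) z p.
pose W : R := \int[M]_p w p.
pose C : R := Z + W.
pose B : R := \int[M]_(p in A) (eta p * v p).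
pose Bn n : R := (h n)^-1 * \int[M]_(p in A) (eta p * incr v (h n) p).
have Rint (f : X * mR -> R) (D : set (X * mR)) : M.-integrable D (EFin \o f) -> measurable D ->
    (\int[M]_(p in D) (f p)%:E)%E = (\int[M]_(p in D) f p)%:E.
  by move=> fi mD; rewrite /Rintegral fineK//; exact: integrable_fin_num.
have iD (f g : X * mR -> R) : M.-integrable setT (EFin \o f) ->
    M.-integrable setT (EFin \o g) ->
    M.-integrable setT (EFin \o (fun p => f p + g p)).
  by move=> fi gi; exact: (integrableD measurableT fi gi).
have iZ (c : R) (f : X * mR -> R) : M.-integrable setT (EFin \o f) ->
    M.-integrable setT (fun p => (c * f p)%:E).
  by move=> fi; exact: (integrableZl measurableT c fi).
have intL : (\int[M]_p L p = (B + C)%:E)%E.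
  have ip : M.-integrable setT (EFin \o (fun p => eta p * v p + z p)).
    by apply: iD => //; exact: integrable_pairing.
  have [i1 e1] := iind _ ip.
  have -> : B + C = (B + Z) + W by rewrite /C addrA.
  rewrite integralD// e1 !EFinD -!Rint//; last 2 first.
  - exact: iA.
  - by apply: iA; exact: integrable_pairing.
  congr (_ + _)%E; rewrite -integralD//; last 2 first.
  - by apply: iA; exact: integrable_pairing.
  - exact: iA.
have intq n : (\int[M]_p q n p <= (Bn n + C)%:E)%E.
  have i0 : M.-integrable setT (fun p => ((h n)^-1 * (eta p * incr v (h n) p))%:E).
    by apply: iZ; exact: integrable_pairing_incr.
  have ip : M.-integrable setT
      (EFin \o (fun p => (h n)^-1 * (eta p * incr v (h n) p) + z p)).
    by apply: iD => //; exact: i0.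
  have [i1 e1] := iind _ ip.
  have i2 : M.-integrable setT (fun p => ((h n)^-1 * incr w (h n) p)%:E).
    by apply: iZ; exact: integrable_incr.
  have -> : Bn n + C = (Bn n + Z) + W by rewrite /C addrA.
  rewrite integralD// e1 !EFinD -!Rint//; last exact: iA.
  apply: leeD.
    rewrite integralD_EFin//; last 2 first.
    - exact: iA i0.
    - exact: iA.
    apply: leeD => //; rewrite /Bn EFinM; under eq_integral do rewrite /= EFinM.
    rewrite integralZl//; last first.
      by apply: iA; exact: integrable_pairing_incr.
    rewrite Rint//; apply: iA; exact: integrable_pairing_incr.
  rewrite (eq_integral (fun p => (`|h n|^-1)%:E * (`|incr w (h n) p|)%:E)%E); last first.
    by move=> p _; rewrite incrw EFinM.
  rewrite ge0_integralZl_EFin//; last first.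
    apply/measurable_EFinP; apply: measurableT_comp => //; exact: mincr.
  rewrite fubini_tonelli1//; last first.
    apply/measurable_EFinP; apply: measurableT_comp => //; exact: mincr.
  rewrite fubini_tonelli1//; last exact/measurable_EFinP.
  rewrite (_ : (\int[m]_x _)%E = (`|h n|%:E * \int[m]_x fubini_F leb (fun p => (w p)%:E) x)%E).
    by rewrite muleA -EFinM mulVf ?normr_eq0// mul1e.
  rewrite -ge0_integralZl_EFin//; last 2 first.
  - by move=> x _; apply: integral_ge0 => s _; rewrite lee_fin.
  - by apply: measurable_fun_fubini_tonelli_F => //; exact/measurable_EFinP.
  apply: eq_integral => x _; rewrite /fubini_F.
  by rewrite -(integral_prim_incr (iwx x)).
have mlim : measurable_fun setT (fun p => limn_einf (q ^~ p)).
  rewrite /limn_einf; apply: measurableT_comp => //.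
  by apply: measurable_fun_limn_esup => n; apply: measurableT_comp (mq n).
have lim0 p : (0 <= limn_einf (q ^~ p))%E.
  rewrite limn_einf_lim; apply: lime_ge; first exact: is_cvg_einfs.
  by apply: nearW => n; apply: le_ereal_inf_tmp => _ [k _ <-]; exact: q0.
(* The pointwise limit is identified along each line of fixed [x], where Lebesgue differentiation
   holds for a.e. [t]; Tonelli then needs no exceptional set in [x]. *)
have limE : (\int[M]_p limn_einf (q ^~ p) = \int[M]_p L p)%E.
  rewrite (fubini_tonelli1 _ mlim lim0) (fubini_tonelli1 _ mL L0).
  apply: eq_integral => x _; rewrite /fubini_F.
  apply: ge0_ae_eq_integral => //.
  - exact: measurableT_comp mlim (pair1_measurable x).
  - exact: measurableT_comp mL (pair1_measurable x).
  have := prim_diff_quotient (iwx x) h0 hc.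
  have := prim_diff_quotient (ivx x) h0 hc.
  apply: (@filterS2 _ _ (ae_filter_ringOfSetsType leb)) => t vt wt _.
  suff /cvg_limn_einf_sup[-> //] : q n (x, t) @[n --> \oo] --> L (x, t).
  rewrite /q /L.
  under eq_fun do rewrite -EFinD.
  rewrite -EFinD; apply/cvg_EFin; first by apply: nearW.
  rewrite /=; apply: cvgD.
    apply: cvgM; last exact: cvg_cst.
    apply: cvgD; last exact: cvg_cst.
    under eq_fun do rewrite mulrCA.
    apply: cvgM; first exact: cvg_cst.
    by under eq_fun do rewrite mulrC.
  by under eq_fun do rewrite mulrC.
have : ((B + C)%:E <= limn_einf (fun n => (Bn n + C)%:E))%E.
  rewrite -intL -limE; apply: (le_trans (fatou M measurableT mq q0)).
  rewrite !limn_einf_lim; apply: lee_lim; [exact: is_cvg_einfs|exact: is_cvg_einfs|].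
  apply: nearW => n; apply: le_ereal_inf_tmp => _ [k /= nk <-].
  apply: le_trans (intq k); apply: ereal_inf_lbound; exists k => //.
move=> /limn_einf_gt/(_ e0)[N HN]; exists N => n /HN.
rewrite lte_fin => BC; rewrite -/B -/(Bn n) -(ltrD2r C).
by apply: le_lt_trans BC; rewrite addrAC.
Qed.

End diff_quotient.

(** * Smooth bumps and weak derivatives *)

Section smooth_bump.
Context {R : realType}.
Implicit Types (P Q : {poly R}) (x y : R).

(* The derivatives of x |-> exp (- 1 / x) extended by 0 to x <= 0 are all of
   this form. *)
Definition flat P x : R := if 0 < x then P.[x^-1] * expR (- x^-1) else 0.

(** From y^(i+2) / (i+2)! <= e^y, term by term. At [y = h^-1] the bound reads [K * h ^+ 2], which
    makes the difference quotient of [flat] at 0 vanish. *)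
Let poly_expR_bound P : exists2 K, 0 <= K &
  forall y, 0 < y -> `|P.[y] * expR (- y)| <= K * y ^- 2.
Proof.
exists (\sum_(i < size P) `|P`_i| * (i.+2)`!%:R).
  by apply: sumr_ge0 => i _; rewrite mulr_ge0.
move=> y y0; rewrite horner_coef mulr_suml mulr_suml.
apply: le_trans (ler_norm_sum _ _ _) _; apply: ler_sum => i _.
rewrite !normrM (ger0_norm (expR_ge0 _)) -!mulrA; apply: ler_wpM2l => //.
rewrite ger0_norm ?exprn_ge0 ?(ltW y0)//.
have := expR_ge1Dxn i.+1 (ltW y0) => h.
rewrite expRN ler_pdivrMr ?expR_gt0// mulrAC ler_pdivlMr ?exprn_gt0//.
rewrite -exprD addn2 mulrC -ler_pdivrMr ?ltr0n ?fact_gt0//.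
by apply: le_trans h; rewrite lerDr.
Qed.

(** In the variable y = 1/x, the derivative of P(y) e^-y with respect to x is y^2 (P - P')(y) e^-y,
    so the family is closed under differentiation. *)
Lemma is_derive_flat P x : is_derive x 1 (flat P) (flat ('X^2 * (P - P^`())) x).
Proof.
have [x0|x0|->] := ltgtP x 0.
- apply: (@near_eq_is_derive _ _ _ (cst 0)).
  + near=> y; rewrite /flat ltNge ltW//.
    by near: y; exact: lt_nbhsl.
  + by rewrite /flat ltNge (ltW x0)/=; exact: is_derive_cst.
- apply: (@near_eq_is_derive _ _ _ (fun y => P.[y^-1] * expR (- y^-1))).
  + near=> y; rewrite /flat ifT//.
    by near: y; exact: lt_nbhsr.
  + have xn0 : x != 0 by rewrite gt_eqF.
    have dV := is_deriveV xn0 (is_derive_id x 1).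
    have dP : is_derive x 1 (horner P \o GRing.inv) (P^`().[x^-1] * (- x ^- 2 *: 1)).
      exact: is_derive1_comp.
    have dE : is_derive x 1 (expR \o (fun y => - y^-1))
        (expR (- x^-1) * - (- x ^- 2 *: 1)).
      by apply: is_derive1_comp; exact: is_deriveN.
    apply: (is_derive_eq (is_deriveM dP dE)).
    rewrite /flat x0 /GRing.scale/= !hornerE/=.
    rewrite exprVn; ring.
have [K K0 PK] := poly_expR_bound P.
rewrite [flat _ 0]/flat ltxx.
suff H : h^-1 *: ((flat P \o shift 0) (h *: (1 : R)) - flat P 0) @[h --> 0^'] --> (0 : R).
  split; first by apply/cvg_ex; exists 0.
  exact/cvg_lim.
apply/cvgrPdist_le => e e0.
near=> h.
rewrite sub0r normrN /= /flat ltxx subr0 addr0 /GRing.scale/= mulr1.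
case: ltP => h0; last by rewrite mulr0 normr0 ltW.
have := PK h^-1; rewrite invr_gt0 => /(_ h0) PKh.
rewrite normrM (gtr0_norm (x := h^-1)) ?invr_gt0//.
rewrite ler_pdivrMl//; apply: (le_trans PKh).
rewrite exprVn invrK expr2 mulrA mulrC ler_pM2l//.
have hK : `|h| <= e / (K + 1).
  by near: h; apply: dnbhs0_le; rewrite divr_gt0// ltr_wpDl.
rewrite gtr0_norm// in hK.
apply: (@le_trans _ _ (K * (e / (K + 1)))); first exact: ler_wpM2l.
rewrite mulrA ler_pdivrMr ?ltr_wpDl// mulrC ler_wpM2l ?ltW//.
by rewrite ltrDl.
Unshelve. all: by end_near. Qed.

(** Smoothness by a class stable under derivation, which dispenses with formulas for the iterated
    derivatives. *)
Lemma smooth_closed (S : set (R -> R)) :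
  (forall f, S f -> exists2 g, S g & forall t : R, is_derive t 1 f (g t)) ->
  forall f, S f -> forall k (t : R), derivable (derive1n k f) t 1.
Proof.
move=> SD f Sf k t; suff /SD[g _ /(_ t)] : S (derive1n k f) by [].
elim: k => // k /SD[g Sg dg]; rewrite /derive1n iterS -/(derive1n k f).
by rewrite (_ : derive1 _ = g)//; apply/funext => r; rewrite derive1E derive_val.
Qed.

Variables s t e : R.

Inductive bumps : (R -> R) -> Prop :=
  | bumps_flat P Q :
      bumps (fun x => flat P ((x - s) / e) * flat Q ((t - x) / e))
  | bumps_add f g : bumps f -> bumps g -> bumps (fun x => f x + g x)
  | bumps_scale c f : bumps f -> bumps (fun x => c * f x).

Let D P : {poly R} := 'X^2 * (P - P^`()).

Lemma is_derive_flat2 P Q x :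
  is_derive x 1 (fun x => flat P ((x - s) / e) * flat Q ((t - x) / e))
    (e^-1 * (flat (D P) ((x - s) / e) * flat Q ((t - x) / e)) +
     - e^-1 * (flat P ((x - s) / e) * flat (D Q) ((t - x) / e))).
Proof.
have dl : is_derive x 1 (fun x : R => (x - s) / e) e^-1.
  rewrite (_ : (fun _ => _) = e^-1 \*: (fun x => x - s)); last first.
    by apply/funext => y; rewrite mulrC.
  by apply: is_derive_eq; rewrite subr0 /GRing.scale/= mulr1.
have dr : is_derive x 1 (fun x : R => (t - x) / e) (- e^-1).
  rewrite (_ : (fun _ => _) = e^-1 \*: (fun x => t - x)); last first.
    by apply/funext => y; rewrite mulrC.
  by apply: is_derive_eq; rewrite /GRing.scale/=; ring.
have dP : is_derive x 1 (flat P \o (fun x : R => (x - s) / e))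
    (flat (D P) ((x - s) / e) * e^-1).
  by apply: is_derive1_comp; exact: is_derive_flat.
have dQ : is_derive x 1 (flat Q \o (fun x : R => (t - x) / e))
    (flat (D Q) ((t - x) / e) * - e^-1).
  by apply: is_derive1_comp; exact: is_derive_flat.
apply: (is_derive_eq (is_deriveM dP dQ)).
rewrite /GRing.scale/= -/(D P) -/(D Q); ring.
Qed.

Lemma bumps_smooth f : bumps f -> forall k (x : R), derivable (derive1n k f) x 1.
Proof.
apply: smooth_closed => {f} f; elim.
- move=> P Q; exists (fun x =>
    (e^-1 * (flat (D P) ((x - s) / e) * flat Q ((t - x) / e)) +
     - e^-1 * (flat P ((x - s) / e) * flat (D Q) ((t - x) / e)))).
    by apply: bumps_add; apply: bumps_scale; exact: bumps_flat.
  exact: is_derive_flat2.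
- move=> g1 g2 _ [h1 b1 d1] _ [h2 b2 d2]; exists (fun x => h1 x + h2 x).
    exact: bumps_add.
  by move=> x; exact: is_deriveD.
- move=> c g _ [h b d]; exists (fun x => c * h x); first exact: bumps_scale.
  by move=> x; exact: (is_deriveZ c (d x)).
Qed.

(** The parameter [e] scales the flat factors and not the support: by [bumpE], letting [e] decrease
    to 0 pushes the values up to 1 on a fixed interval. *)
Definition bump x := flat 1 ((x - s) / e) * flat 1 ((t - x) / e).

Definition bump' x := e^-1 * (flat 'X^2 ((x - s) / e) * flat 1 ((t - x) / e)) +
  - e^-1 * (flat 1 ((x - s) / e) * flat 'X^2 ((t - x) / e)).

Lemma is_derive_bump x : is_derive x 1 bump (bump' x).
Proof.
apply: (is_derive_eq (is_derive_flat2 1 1 x)); rewrite /bump' /D.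
by rewrite derivC subr0 mulr1.
Qed.

Lemma derive1_bump : derive1 bump = bump'.
Proof.
by apply/funext => x; rewrite derive1E; apply: derive_val; exact: is_derive_bump.
Qed.

Lemma bump_smooth k (x : R) : derivable (derive1n k bump) x 1.
Proof. by apply: bumps_smooth; exact: bumps_flat. Qed.

Lemma continuous_bump : continuous bump.
Proof.
move=> x; apply: differentiable_continuous; apply/derivable1_diffP.
by have [] := is_derive_bump x.
Qed.

Lemma continuous_bump' : continuous bump'.
Proof.
move=> x; apply: differentiable_continuous; apply/derivable1_diffP.
by have := @bump_smooth 1 x; rewrite derive1n1 derive1_bump.
Qed.

Hypothesis e0 : 0 < e.

Lemma bump_eq0 x : ~~ (s < x < t) -> bump x = 0.
Proof.
rewrite negb_and -!leNgt => /orP[h|h]; rewrite /bump /flat.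
  by rewrite ltNge pmulr_lle0 ?invr_gt0// subr_le0 h/= mul0r.
by rewrite [X in _ * (if X then _ else _)]ltNge pmulr_lle0 ?invr_gt0// subr_le0 h/= mulr0.
Qed.

Lemma bump'_eq0 x : ~~ (s < x < t) -> bump' x = 0.
Proof.
rewrite negb_and -!leNgt => /orP[h|h]; rewrite /bump' /flat.
  by rewrite [0 < (x - s) / e]ltNge pmulr_lle0 ?invr_gt0// subr_le0 h/= !mul0r !mulr0 addr0.
by rewrite [0 < (t - x) / e]ltNge pmulr_lle0 ?invr_gt0// subr_le0 h/= !mulr0 addr0.
Qed.

Lemma bumpE x : s < x < t -> bump x = expR (- (e * ((x - s)^-1 + (t - x)^-1))).
Proof.
move=> /andP[sx xt]; rewrite /bump /flat !divr_gt0 ?subr_gt0//= -polyC1 !hornerC !mul1r.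
by rewrite -expRD !invf_div; congr expR; ring.
Qed.

(** Shows the sign, positive on the left half of the interval and negative on the right half, and
    the factor [e], which makes the derivative small away from both ends. *)
Lemma bump'E x : s < x < t -> bump' x = e * ((x - s) ^- 2 - (t - x) ^- 2) * bump x.
Proof.
move=> /andP[sx xt]; rewrite /bump' /bump /flat !divr_gt0 ?subr_gt0//= -polyC1 !hornerC !hornerXn !mul1r.
rewrite !invf_div; set A := expR _; set B := expR _.
by field; rewrite !subr_eq0 !gt_eqF.
Qed.

Lemma bump_ge0 x : 0 <= bump x.
Proof.
have [/bumpE ->|/bump_eq0 ->//] := boolP (s < x < t).
exact: expR_ge0.
Qed.

Lemma bump_le1 x : bump x <= 1.
Proof.
have [h|/bump_eq0 ->//] := boolP (s < x < t).
rewrite bumpE// expR_le1 oppr_le0; move/andP: h => [? ?].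
by rewrite mulr_ge0 ?addr_ge0 ?invr_ge0 ?subr_ge0// ltW.
Qed.

Lemma bump_test_function T : 0 < s -> t < T -> test_function T bump.
Proof.
move=> s0 tT; split; first exact: bump_smooth.
exists s, t; split => // x; apply: contraNT => h; apply/eqP/bump_eq0.
by apply: contra h => /andP[/ltW -> /ltW ->].
Qed.

End smooth_bump.

Section integral_of_derivative.
Context {R : realType}.
Local Notation leb := (@lebesgue_measure R).
Implicit Types (F f g : R -> R) (a b c : R).

Lemma continuous_integrable_itv f a b (x y : bool) : continuous f ->
  leb.-integrable [set` Interval (BSide x a) (BSide y b)] (EFin \o f).
Proof.
move=> cf; apply: (@integrableS _ _ _ leb `[a, b]) => //.
  by move=> z /=; case: x; case: y; rewrite !in_itv/= => /andP[p q];
    rewrite ?(ltW p) ?(ltW q) ?p ?q.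
apply: continuous_compact_integrable; first exact: segment_compact.
exact: continuous_subspaceT.
Qed.

Lemma Rintegral_is_derive F f a b : a <= b ->
  (forall x : R, is_derive x 1 F (f x)) -> continuous f ->
  \int[leb]_(x in `]a, b]) f x = F b - F a.
Proof.
rewrite le_eqVlt => /predU1P[<-|ab] dF cf.
  by rewrite set_itvoc0 Rintegral_set0 subrr.
have cF : continuous F.
  move=> x; apply: differentiable_continuous; apply/derivable1_diffP.
  by have [] := dF x.
rewrite Rintegral_itv_obnd_cbnd; last exact: continuous_integrable_itv.
rewrite /Rintegral (@continuous_FTC2 _ f F)//.
- exact: continuous_subspaceT.
- split => [x _||]; first by have [] := dF x.
  + exact/cvg_at_right_filter/cF.
  + exact/cvg_at_left_filter/cF.
- by move=> x _; rewrite derive1E; apply: derive_val.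
Qed.

(** The nonnegative derivative [f] is regarded as a density of total mass [F b - F a], against which
    [g] is averaged. *)
Lemma Rintegral_derive_mean F f g a b c k : a <= b ->
  (forall x : R, is_derive x 1 F (f x)) -> continuous f -> continuous g ->
  (forall x, a < x <= b -> 0 <= f x) ->
  (forall x, a < x <= b -> `|g x - c| <= k) ->
  `|\int[leb]_(x in `]a, b]) (f x * g x) - c * (F b - F a)| <= k * (F b - F a).
Proof.
move=> ab dF cf cg f0 gk; rewrite -(Rintegral_is_derive ab dF cf).
have cfg h : continuous h -> continuous (fun x => f x * h x).
  by move=> ch x; apply: cvgM; [exact: cf|exact: ch].
have cgc : continuous (fun x => g x - c).
  by move=> x; apply: cvgB; [exact: cg|exact: cvg_cst].
have ccst : continuous (fun _ : R => c) by move=> x; exact: cvg_cst.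
have cg' : continuous (fun x => `|f x * (g x - c)|).
  by move=> x; apply: cvg_norm; exact: cfg.
rewrite -RintegralZl//; last exact: continuous_integrable_itv.
rewrite -RintegralB//; last 2 first.
- by apply: continuous_integrable_itv; exact: cfg.
- apply: continuous_integrable_itv => x; apply: cvgM; [exact: cvg_cst|exact: cf].
have -> : \int[leb]_(x in `]a, b]) (f x * g x - c * f x) =
    \int[leb]_(x in `]a, b]) (f x * (g x - c)).
  by apply: eq_Rintegral => x _; rewrite mulrBr (mulrC c).
apply: le_trans (le_normr_Rintegral _ _) _ => //.
  by apply: continuous_integrable_itv; exact: cfg.
rewrite -RintegralZl//; last exact: continuous_integrable_itv.
apply: le_Rintegral => //.
- exact: continuous_integrable_itv.
- by apply: continuous_integrable_itv => x; apply: cvgM; [exact: cvg_cst|exact: cf].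
- move=> x /=; rewrite in_itv/= => xab; rewrite normrM (ger0_norm (f0 _ xab)) mulrC.
  by apply: ler_wpM2r; [exact: f0|exact: gk].
Qed.

End integral_of_derivative.

Section weak_derivative.
Context {R : realType}.
Local Notation leb := (@lebesgue_measure R).
Variables (g G : R -> R) (T s t : R).
Hypotheses (cg : continuous g) (iG : leb.-integrable `]0, T[ (EFin \o G)).
Hypotheses (s0 : 0 < s) (st : s < t) (tT : t < T).
Hypothesis gG : forall e, 0 < e ->
  \int[leb]_(x in `]0, T[) (bump' s t e x * g x) =
  - \int[leb]_(x in `]0, T[) (bump s t e x * G x).

Let e_ n : R := n.+1%:R^-1.

Let e_gt0 n : 0 < e_ n. Proof. by rewrite invr_gt0 ltr0n. Qed.

Let e_cvg : e_ n @[n --> \oo] --> 0. Proof. exact: cvg_harmonic. Qed.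

Let bump_cvg x : s < x < t -> bump s t (e_ n) x @[n --> \oo] --> (1 : R).
Proof.
move=> sxt; under eq_fun do rewrite bumpE//.
have -> : (1 : R) = expR (- (0 * ((x - s)^-1 + (t - x)^-1))).
  by rewrite mul0r oppr0 expR0.
apply: continuous_cvg; first exact: continuous_expR.
by apply: cvgN; apply: cvgM => //; exact: cvg_cst.
Qed.

Let sub_st : `]s, t[ `<=` `]0, T[.
Proof.
by move=> x /=; rewrite !in_itv/= => /andP[sx xt]; rewrite (lt_trans s0 sx) (lt_trans xt tT).
Qed.

Let cvg_rhs : \int[leb]_(x in `]0, T[) (bump s t (e_ n) x * G x) @[n --> \oo] -->
  \int[leb]_(x in `]s, t[) G x.
Proof.
have mG : measurable_fun `]0, T[ G by case/integrableP : iG => /measurable_EFinP.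
have mbump n : measurable_fun (`]0, T[ : set R) (bump s t (e_ n)).
  apply: measurable_funTS; apply: continuous_measurable_fun.
  exact: continuous_bump.
have stE : `]0, T[%classic `&` `]s, t[ = `]s, t[%classic :> set R.
  exact/setIidPr.
have mf_ n : measurable_fun `]0, T[ (fun x => (bump s t (e_ n) x * G x)%:E).
  by apply/measurable_EFinP; exact: measurable_funM.
have mf : measurable_fun `]0, T[ ((EFin \o G) \_ `]s, t[).
  apply/measurable_restrict => //; rewrite stE.
  by apply/measurable_EFinP; apply: measurable_funS mG.
have f_f : {ae leb, forall x, `]0, T[%classic x ->
    (fun n => (bump s t (e_ n) x * G x)%:E) @ \oo --> ((EFin \o G) \_ `]s, t[) x}.
  apply: nearW => x _; rewrite patchE.
  case: ifPn => [|/negP]; rewrite inE/= in_itv/= => xst.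
    apply/cvg_EFin; first by apply: nearW.
    by rewrite -[X in _ --> X]mul1r; apply: cvgM; [exact: bump_cvg|exact: cvg_cst].
  apply: cvg_near_cst; apply: nearW => n.
  by rewrite bump_eq0 ?mul0r//; exact/negP.
have f_g : {ae leb, forall x n, `]0, T[%classic x ->
    (`|(bump s t (e_ n) x * G x)%:E| <= (abse \o (EFin \o G)) x)%E}.
  apply: nearW => x n _; rewrite /= lee_fin normrM ger0_norm ?bump_ge0//.
  by rewrite -[leRHS]mul1r ler_wpM2r// bump_le1.
have ig : leb.-integrable `]0, T[ (abse \o (EFin \o G)) by exact: integrable_abse.
have [] := dominated_convergence (mu := leb) (measurable_itv _) mf_ mf f_f ig f_g.
move=> _ _ H.
rewrite /Rintegral; apply: fine_cvg.
rewrite fineK; last first.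
  by apply: integrable_fin_num => //; exact: integrableS iG.
rewrite -integral_mkcondr stE in H.
exact: H.
Qed.

(** As [e_ n] tends to 0, [bump'] tends to a unit mass at [s] minus a unit mass at [t]. Each end
    contributes an error [k] from the oscillation of [g], whence the limit [2 * k]; all other errors
    vanish. *)
Let tail (k : R) : 0 < k -> exists2 x : nat -> R, x n @[n --> \oo] --> (2 * k : R) &
  forall n, `|\int[leb]_(x in `]0, T[) (bump' s t (e_ n) x * g x) - (g s - g t)| <= x n.
Proof.
move=> k0.
have near_g a : exists2 del, 0 < del & forall x, `|x - a| <= del -> `|g x - g a| <= k.
  have /cvgrPdist_le/(_ _ k0) := @cg a; move=> [r /= r0 rk].
  exists (r / 2); first by rewrite divr_gt0.
  move=> x xa; rewrite distrC; apply: rk => /=; rewrite distrC (le_lt_trans xa)//.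
  by rewrite ltr_pdivrMr// ltr_pMr// ltr1n.
have [d1 d10 g1] := near_g s; have [d2 d20 g2] := near_g t.
(* A third of the interval at most: the two end pieces stay disjoint, and [bump'] keeps one sign on
   each of them. *)
pose d := Num.min (Num.min d1 d2) ((t - s) / 3).
have d0 : 0 < d by rewrite !lt_min d10 d20/= divr_gt0// subr_gt0.
have dd1 : d <= d1 by rewrite !ge_min lexx.
have dd2 : d <= d2 by rewrite !ge_min lexx orbT.
have dst : d <= (t - s) / 3 by rewrite !ge_min lexx !orbT.
have sd : s <= s + d by lra.
have dd : s + d <= t - d by lra.
have dt : t - d <= t by lra.
have ssd : s <= t - d by lra.
have sdt : s < s + d < t by lra.
have std : s < t - d < t by lra.
have leftP x : s < x <= s + d ->
    [/\ s < x < t, 0 < x - s, x - s <= t - x & `|x - s| <= d1].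
  by move=> /andP[sx xsd]; split; rewrite ?ler_norml; lra.
have rightP x : t - d < x <= t ->
    [/\ s < x, 0 <= t - x, t - x <= x - s & `|x - t| <= d2].
  by move=> /andP[sx xsd]; split; rewrite ?ler_norml; lra.
have midP x : s + d < x <= t - d ->
    [/\ s < x < t, d <= x - s & d <= t - x].
  by move=> /andP[sx xsd]; split; lra.
(* In the middle piece both distances to the ends are at least [d], so [|bump'|] is at most
   [e_ n * d ^- 2] there. *)
pose C := d ^- 2 * \int[leb]_(x in `]s + d, t - d]) `|g x|.
exists (fun n => k + (k + (`|g s| * `|bump s t (e_ n) (s + d) - 1| +
   `|g t| * `|bump s t (e_ n) (t - d) - 1| + e_ n * C))).
  rewrite -[X in _ --> X]/(2 * k) (_ : 2 * k = k + (k + (`|g s| * `|1 - 1| + `|g t| * `|1 - 1| + 0 * C))); last first.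
    by rewrite subrr normr0; ring.
  do 2 (apply: cvgD; first exact: cvg_cst).
  apply: cvgD; last by apply: cvgM => //; exact: cvg_cst.
  apply: cvgD; apply: cvgM; (try exact: cvg_cst); apply: cvg_norm; apply: cvgB;
    (try exact: cvg_cst); exact: bump_cvg.
move=> n; set b := bump s t (e_ n); set b' := bump' s t (e_ n).
have cb' : continuous b' by exact: continuous_bump'.
have cb'g : continuous (fun x => b' x * g x).
  by move=> x; apply: cvgM; [exact: cb'|exact: cg].
have db (x : R) : is_derive x 1 b (b' x) by exact: is_derive_bump.
have b'st (x : R) : ~~ (s < x < t) -> b' x = 0 by exact: bump'_eq0.
have split3 : \int[leb]_(x in `]0, T[) (b' x * g x) =
    \int[leb]_(x in `]s, s + d]) (b' x * g x) +
    \int[leb]_(x in `]s + d, t - d]) (b' x * g x) +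
    \int[leb]_(x in `]t - d, t]) (b' x * g x).
  have ifg (a c : R) : leb.-integrable `]a, c] (EFin \o (fun x => b' x * g x)).
    exact: continuous_integrable_itv.
  have -> : \int[leb]_(x in `]0, T[) (b' x * g x) = \int[leb]_(x in `]s, t]) (b' x * g x).
    rewrite Rintegral_mkcond [RHS]Rintegral_mkcond.
    apply: eq_Rintegral => x _; rewrite !patchE.
    have [sxt|/b'st ->] := boolP (s < x < t); last by rewrite mul0r !if_same.
    move: sxt => /andP[sx xt]; rewrite !ifT//; rewrite inE/= in_itv/=.
      by rewrite sx ltW.
    by rewrite (lt_trans s0 sx) (lt_trans xt tT).
  have E1 := @Rintegral_itvB _ (fun x => b' x * g x) (BRight s) (BRight t) (t - d) (ifg _ _).
  have E2 := @Rintegral_itvB _ (fun x => b' x * g x) (BRight s) (BRight (t - d)) (s + d) (ifg _ _).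
  rewrite !bnd_simp in E1 E2.
  by rewrite -E1// -E2//; ring.
have bs : b s = 0 by apply: bump_eq0 => //; rewrite ltxx.
have bt : b t = 0 by apply: bump_eq0 => //; rewrite ltxx andbF.
have bl1 x : b x <= 1 by exact: bump_le1.
have b0 x : 0 <= b x by exact: bump_ge0.
have sqle (x y : R) : 0 < x -> x <= y -> y ^- 2 <= x ^- 2.
  move=> x0 xy; rewrite lef_pV2 ?posrE ?exprn_gt0//; last exact: lt_le_trans xy.
  by rewrite lerXn2r ?nnegrE ?(ltW x0)// (le_trans (ltW x0)).
have left : `|\int[leb]_(x in `]s, s + d]) (b' x * g x) - g s * b (s + d)| <= k.
  have := @Rintegral_derive_mean _ b b' g s (s + d) (g s) k.
  rewrite bs subr0 => H; apply: le_trans (H _ _ _ _ _ _) _ => //.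
  + move=> x /leftP[sxt xs0 xsx _]; rewrite /b' bump'E//.
    apply: mulr_ge0 => //; apply: mulr_ge0; first exact: ltW.
    by rewrite subr_ge0; exact: sqle.
  + by move=> x /leftP[_ _ _ /g1].
  + by rewrite -[leRHS]mulr1 ler_wpM2l// ltW.
have right : `|\int[leb]_(x in `]t - d, t]) (b' x * g x) - - (g t * b (t - d))| <= k.
  have := @Rintegral_derive_mean _ (fun x => - b x) (fun x => - b' x) g (t - d) t (g t) k.
  rewrite bt oppr0 add0r opprK => H.
  have -> : \int[leb]_(x in `]t - d, t]) (b' x * g x) =
      - \int[leb]_(x in `]t - d, t]) (- b' x * g x).
    rewrite -[RHS]mulN1r -RintegralZl//; last first.
      apply: continuous_integrable_itv => x; apply: cvgM; last exact: cg.
      by apply: cvgN; exact: cb'.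
    by apply: eq_Rintegral => x _; rewrite mulN1r mulNr opprK.
  rewrite -opprB normrN opprK addrC.
  rewrite -[X in _ <= X]mulr1; apply: le_trans (H _ _ _ _ _ _) _ => //.
  + by move=> x; apply: cvgN; exact: cb'.
  + move=> x txt; have [sx tx0 txx _] := rightP _ txt.
    have [xt|tx] := ltP x t; last by rewrite b'st ?oppr0// negb_and -!leNgt tx orbT.
    rewrite /b' bump'E ?sx// -mulNr; apply: mulr_ge0 => //; rewrite -mulrN opprB.
    apply: mulr_ge0; first exact: ltW.
    by rewrite subr_ge0; apply: sqle; rewrite ?subr_gt0.
  + by move=> x /rightP[_ _ _ /g2].
  + by rewrite ler_wpM2l// ltW.
have mid : `|\int[leb]_(x in `]s + d, t - d]) (b' x * g x)| <= e_ n * C.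
  have cng : continuous (fun x => `|g x|) by move=> x; apply: cvg_norm; exact: cg.
  apply: le_trans (le_normr_Rintegral _ _) _ => //.
    exact: continuous_integrable_itv.
  rewrite /C mulrA -RintegralZl//; last exact: continuous_integrable_itv.
  apply: le_Rintegral => //.
  - by apply: continuous_integrable_itv => x; apply: cvg_norm; exact: cb'g.
  - apply: continuous_integrable_itv => x; apply: cvgM; first exact: cvg_cst.
    exact: cng.
  move=> x /=; rewrite in_itv/= => /midP[sxt x1 x2]; rewrite normrM ler_wpM2r//.
  rewrite /b' bump'E//.
  rewrite normrM (ger0_norm (b0 _)) -[leRHS]mulr1.
  apply: ler_pM => //; rewrite normrM gtr0_norm// ler_wpM2l ?(ltW (e_gt0 n))//.
  have h1 : (x - s) ^- 2 <= d ^- 2 by exact: sqle.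
  have h2 : (t - x) ^- 2 <= d ^- 2 by exact: sqle.
  have h3 : 0 <= (x - s) ^- 2 by rewrite invr_ge0 sqr_ge0.
  have h4 : 0 <= (t - x) ^- 2 by rewrite invr_ge0 sqr_ge0.
  have distP (A B D : R) : 0 <= A -> 0 <= B -> A <= D -> B <= D -> `|A - B| <= D.
    by move=> A0 B0 AD BD; rewrite ler_norml; lra.
  exact: distP.
rewrite split3.
set I1 := Rintegral _ _ _ in left *; set I2 := Rintegral _ _ _ in mid *.
set I3 := Rintegral _ _ _ in right *.
have -> : I1 + I2 + I3 - (g s - g t) = (I1 - g s * b (s + d)) +
   ((I3 - - (g t * b (t - d))) + (g s * (b (s + d) - 1) + (- g t) * (b (t - d) - 1) + I2)).
  by ring.
apply: le_trans (ler_normD _ _) _; apply: lerD => //.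
apply: le_trans (ler_normD _ _) _; apply: lerD => //.
apply: le_trans (ler_normD _ _) _; apply: lerD => //.
by apply: le_trans (ler_normD _ _) _; rewrite !normrM normrN.
Qed.

Lemma weak_derivative_FTC : g t - g s = \int[leb]_(x in `]s, t[) G x.
Proof.
apply/eqP; rewrite -subr_eq0 -normr_le0.
apply/ler_addgt0Pl => k k0; rewrite addr0.
have k20 : 0 < k / 2 by rewrite divr_gt0.
have [x xk H] := tail k20; rewrite mulrC divfK// in xk.
pose I n := \int[leb]_(x in `]0, T[) (bump s t (e_ n) x * G x).
pose J := \int[leb]_(x in `]s, t[) G x.
have IJ : I n @[n --> \oo] --> J by exact: cvg_rhs.
have Hc : `|- I n - (g s - g t)| @[n --> \oo] --> `|- J - (g s - g t)|.
  by apply: cvg_norm; apply: cvgB; [exact: cvgN|exact: cvg_cst].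
rewrite (_ : g t - g s - _ = - J - (g s - g t)); last by rewrite /J; ring.
apply: (ler_cvg_to Hc xk); apply: nearW => n; rewrite /I -gG; last exact: e_gt0.
exact: H.
Qed.

End weak_derivative.

(** * Even convex functions and Musielak-Orlicz spaces *)

Section yfun.
Context {R : realType}.
Implicit Types (f : R -> R) (r s t : R).

(** Convexity is taken in the weak sense so that the zero function qualifies: it replaces [phi x] at
    the exceptional points in [regularize_phi]. *)
Record yfun f : Prop := Yfun {
  yfun_ge0 : forall r, 0 <= f r;
  yfun0 : f 0 = 0;
  yfunN : forall r, f (- r) = f r;
  yfun_convex : forall t r s, 0 <= t <= 1 ->
    f (t * r + (1 - t) * s) <= t * f r + (1 - t) * f s }.

Lemma yfun_cst0 : yfun (fun=> 0).
Proof. by split => // t r s _; rewrite !mulr0 addr0. Qed.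

Variables (f : R -> R) (nf : yfun f).

Lemma yfun_norm r : f `|r| = f r.
Proof.
have [r0|r0] := leP 0 r; first by rewrite ger0_norm.
by rewrite ltr0_norm ?(yfunN nf).
Qed.

Lemma yfun_scale t r : 0 <= t <= 1 -> f (t * r) <= t * f r.
Proof.
move=> t01; have := yfun_convex nf r 0 t01.
by rewrite mulr0 addr0 (yfun0 nf) mulr0 addr0.
Qed.

Lemma yfun_homo r s : `|r| <= `|s| -> f r <= f s.
Proof.
rewrite -(yfun_norm r) -(yfun_norm s) => rs.
have [s0|s0] := eqVneq `|s| 0.
  by move: rs; rewrite s0 normr_le0 => /eqP ->; rewrite normr0.
have s_gt0 : 0 < `|s| by rewrite lt_def s0/=.
have t01 : 0 <= `|r| / `|s| <= 1.
  by rewrite divr_ge0//= ler_pdivrMr// mul1r.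
have := yfun_scale `|s| t01; rewrite divfK// => /le_trans; apply.
by rewrite -[leRHS]mul1r ler_wpM2r ?(yfun_ge0 nf)//; case/andP : t01.
Qed.

Lemma yfun_right_approx r (e : R) : 0 < e -> exists2 del, 0 < del &
  forall q, r < q < r + del -> f q <= f r + e.
Proof.
move=> e0; exists (Num.min 1 (e / (f (r + 1) + 1))).
  by rewrite lt_min ltr01 divr_gt0// ltr_wpDl ?(yfun_ge0 nf).
move=> q /andP[rq]; rewrite -ltrBlDl lt_min => /andP[q1 qe].
have t01 : 0 <= q - r <= 1 by rewrite (ltW q1) subr_ge0 (ltW rq).
have := yfun_convex nf (r + 1) r t01.
rewrite (_ : (q - r) * (r + 1) + (1 - (q - r)) * r = q); last by ring.
move=> /le_trans; apply.
have fr0 := yfun_ge0 nf r; have fr1 := yfun_ge0 nf (r + 1).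
have : (q - r) * (f (r + 1) + 1) < e by rewrite -ltr_pdivlMr// ltr_wpDl.
move: t01 => /andP[? ?].
have : 0 <= (q - r) * f r by rewrite mulr_ge0.
have : 0 <= q - r by []. lra.
Qed.

Definition ratn (n : nat) : R := ratr (odflt 0 (unpickle n : option rat)).

Lemma ratn_dense r s : r < s -> exists n, r < ratn n < s.
Proof.
move=> /rat_in_itvoo[q]; rewrite in_itv/= => qrs.
by exists (pickle q); rewrite /ratn pickleK.
Qed.

Local Open Scope ereal_scope.

(** Monotonicity in [|r|] and continuity from the right: the values at rationals determine [f].
    Joint measurability in [(x, r)] thus reduces to countably many sections. *)
Lemma yfun_inf r : (f r)%:E = ereal_inf (range (fun n =>
  if (`|r| <= ratn n)%R then (f (ratn n))%:E else +oo)).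
Proof.
apply/eqP; rewrite eq_le; apply/andP; split.
  apply: le_ereal_inf_tmp => _ [n _ <-]; case: ifPn => [rn|_]; last by rewrite leey.
  by rewrite lee_fin yfun_homo// (le_trans rn)// ler_norm.
apply/lee_addgt0Pr => e e0.
have [del del0 H] := yfun_right_approx `|r| e0.
have [n rn] : exists n, (`|r| < ratn n < `|r| + del)%R by apply: ratn_dense; rewrite ltrDl.
apply: (@le_trans _ _ (f (ratn n))%:E).
  by apply: ereal_inf_lbound; exists n => //; rewrite ifT// ltW//; case/andP : rn.
by rewrite -EFinD lee_fin -(yfun_norm r); exact: H.
Qed.

Lemma young r s : (r * s)%:E <= (f r)%:E + conjugate f s.
Proof.
rewrite -leeBlDl//; apply: ereal_sup_ubound; exists r => //.
by rewrite mulrC.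
Qed.

Lemma conjugate_ge0 s : 0 <= conjugate f s.
Proof. by apply: ereal_sup_ubound; exists 0%R => //; rewrite mulr0 (yfun0 nf) subrr. Qed.

Lemma conjugate_ratn s : conjugate f s =
  ereal_sup (range (fun n => (ratn n * s - f (ratn n))%:E)).
Proof.
apply/eqP; rewrite eq_le; apply/andP; split; last first.
  by apply: ge_ereal_sup => _ [n _ <-]; apply: ereal_sup_ubound; exists (ratn n) => //;
    rewrite mulrC.
apply: ge_ereal_sup => _ [r _ <-]; apply/lee_addgt0Pr => e e0.
have e20 : (0 < e / 2)%R by rewrite divr_gt0.
have [del del0 H] := yfun_right_approx r e20.
(* Half of [e] pays for the change of [f], the other half for the change of the linear term, at most
   [d * (|s| + 1)]. *)
pose d : R := (Num.min del (e / 2 / (`|s| + 1)))%R.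
have d0 : (0 < d)%R by rewrite lt_min del0 divr_gt0// ltr_wpDl.
have [n rn] : exists n, (r < ratn n < r + d)%R by apply: ratn_dense; rewrite ltrDl.
apply: (@le_trans _ _ ((ratn n * s - f (ratn n))%:E + e%:E)).
  rewrite -EFinD lee_fin.
  have : (f (ratn n) <= f r + e / 2)%R.
    apply: H; case/andP : rn => -> /= /lt_le_trans; apply.
    by rewrite lerD2l ge_min lexx.
  suff : ((r - ratn n) * s <= e / 2)%R by lra.
  apply: le_trans (ler_norm _) _; rewrite normrM distrC.
  case/andP : rn => rn rd; rewrite (gtr0_norm (x := (ratn n - r)%R)) ?subr_gt0//.
  apply: (@le_trans _ _ (d * (`|s| + 1))%R).
    apply: ler_pM => //; rewrite ?subr_ge0 ?(ltW rn)// ?lerDl//.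
    by rewrite lerBlDl ltW.
  by rewrite -ler_pdivlMr ?ltr_wpDl// ge_min lexx orbT.
by rewrite leeD2r//; apply: ereal_sup_ubound; exists n.
Qed.

End yfun.

Section yfun_measurable.
Context d (X : measurableType d) {R : realType} (mR := measurableTypeR R).
Variables (P : X -> R -> R).
Hypothesis nP : forall x, yfun (P x).
Local Open Scope ereal_scope.

Lemma yfun_jointly_measurable :
  (forall n, measurable_fun setT (fun x => P x (ratn n))) ->
  measurable_fun setT (fun p : X * mR => P p.1 p.2).
Proof.
move=> mP.
pose h n (p : X * mR) : \bar R := if (`|p.2| <= @ratn R n)%R then (P p.1 (ratn n))%:E else +oo.
have mh n : measurable_fun setT (h n).
  apply: measurable_fun_ifT => //.
    apply: measurable_fun_ler => //.
    by apply: measurableT_comp => //; exact: measurable_snd.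
  by apply/measurable_EFinP; exact: (measurableT_comp (mP n)).
apply/measurable_EFinP.
rewrite (_ : _ \o _ = (fun p => einfs (h ^~ p) 0%N)).
  exact: measurable_fun_einfs.
apply/funext => -[x r]; rewrite /= (yfun_inf (nP x)) /einfs/=; congr ereal_inf.
by apply/seteqP; split => y [n _ <-]; exists n.
Qed.

Hypothesis mP : forall r, measurable_fun setT (fun x => P x r).

Lemma measurable_conjugate :
  measurable_fun setT (fun p : X * mR => conjugate (P p.1) p.2).
Proof.
pose h n (p : X * mR) : \bar R := (ratn n * p.2 - P p.1 (ratn n))%:E.
have mh n : measurable_fun setT (h n).
  apply/measurable_EFinP; apply: measurable_funB.
    by apply: measurable_funM => //; exact: measurable_snd.
  exact: (measurableT_comp (mP _)).
rewrite (_ : (fun _ => _) = (fun p => esups (h ^~ p) 0%N)).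
  exact: measurable_fun_esups.
apply/funext => -[x r]; rewrite /= (conjugate_ratn (nP x)) /esups/=; congr ereal_sup.
by apply/seteqP; split => y [n _ <-]; exists n.
Qed.

End yfun_measurable.

Section musielak_orlicz_theory.
Context d (T : measurableType d) {R : realType}.
Variables (mu : {measure set T -> \bar R}) (D : set T) (Phi : T -> R -> \bar R).
(** The spaces are defined by the given [Phi], while all measurability goes through [P], a jointly
    Borel function that agrees with it for a.e. [x] in [D]. *)
Variable P : T -> R -> R.
Hypothesis mD : measurable D.
Hypothesis nP : forall x, yfun (P x).
Hypothesis mP : measurable_fun setT (fun p : T * measurableTypeR R => P p.1 p.2).
Hypothesis PhiE : {ae mu, forall x, D x -> forall r, Phi x r = (P x r)%:E}.
Implicit Types (v : T -> R) (l c : R).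

Local Open Scope ereal_scope.

Lemma ae_measurableT v : ae_measurable mu D v ->
  exists2 g : T -> R, measurable_fun setT g & v = g %[ae mu in D].
Proof.
case=> g mg vg; exists (g \_ D); first exact/(measurable_restrictT _ mD).
by apply: filterS vg => x vg Dx; rewrite patchE mem_set// vg.
Qed.

Lemma measurable_comp_yfun v : measurable_fun setT v ->
  measurable_fun setT (fun x => P x (v x)).
Proof.
move=> mv; apply: (measurableT_comp mP (f := _) (g := fun x => (x, v x))).
exact: measurable_fun_pair.
Qed.

Lemma modularE v : modular mu D Phi v = \int[mu]_(x in D) (P x (v x))%:E.
Proof.
apply: ae_eq_integral_unmeasurable.
by apply: filterS PhiE => x E Dx; rewrite E// yfun_norm.
Qed.

Lemma eq_modular v v' : v = v' %[ae mu in D] ->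
  modular mu D Phi v = modular mu D Phi v'.
Proof.
move=> vv'; apply: ae_eq_integral_unmeasurable.
by apply: filterS vv' => x E Dx; rewrite E.
Qed.

Lemma Lphi_intro v l : ae_measurable mu D v -> (0 < l)%R ->
  \int[mu]_(x in D) (P x (l * v x))%:E < +oo -> Lphi mu D Phi v.
Proof. by move=> mv l0 h; split => //; exists l => //; rewrite modularE. Qed.

Lemma Lphi_elim v : Lphi mu D Phi v ->
  exists g l, [/\ measurable_fun setT g, v = g %[ae mu in D], (0 < l)%R &
    \int[mu]_(x in D) (P x (l * g x))%:E < +oo].
Proof.
move=> [/ae_measurableT[g mg vg] [l l0 lv]]; exists g, l; split => //.
rewrite -modularE (_ : modular _ _ _ _ = modular mu D Phi (fun x => l * v x)%R)//.
by apply: eq_modular; apply: filterS vg => x E Dx; rewrite E.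
Qed.

Lemma ae_measurable_of v g : measurable_fun setT g -> v = g %[ae mu in D] ->
  ae_measurable mu D v.
Proof. by move=> mg vg; exists g => //; exact: measurable_funTS. Qed.

Lemma eq_Lphi v v' : v = v' %[ae mu in D] -> Lphi mu D Phi v -> Lphi mu D Phi v'.
Proof.
move=> vv' /Lphi_elim[g [l [mg vg l0 h]]].
have v'g : v' = g %[ae mu in D].
  by apply: filterS2 vv' vg => x E1 E2 Dx; rewrite -E1// E2.
apply: (@Lphi_intro _ l) => //; first exact: ae_measurable_of v'g.
rewrite (@ae_eq_integral_unmeasurable _ _ _ _ _ _ (fun x => (P x (l * g x))%:E))//.
by apply: filterS v'g => x E Dx; rewrite E.
Qed.

Lemma le_integral_yfun v v' : (forall x, D x -> `|v x| <= `|v' x|)%R ->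
  \int[mu]_(x in D) (P x (v x))%:E <= \int[mu]_(x in D) (P x (v' x))%:E.
Proof.
move=> vv'; apply: ge0_le_integral_unmeasurable => x Dx; rewrite lee_fin.
  exact: yfun_ge0.
by apply: yfun_homo => //; exact: vv'.
Qed.

Lemma LphiZ c v : Lphi mu D Phi v -> Lphi mu D Phi (fun x => c * v x)%R.
Proof.
move=> /Lphi_elim[g [l [mg vg l0 h]]].
have vcg : (fun x => c * v x)%R = (fun x => c * g x)%R %[ae mu in D].
  by apply: filterS vg => x E Dx; rewrite E.
have c1 : (0 < `|c| + 1)%R by rewrite ltr_wpDl.
apply: eq_Lphi (_ : Lphi mu D Phi (fun x => c * g x)%R).
  by apply: filterS vcg => x E Dx; rewrite E.
apply: (@Lphi_intro _ (l / (`|c| + 1))%R).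
- by apply: (@ae_measurable_of _ (fun x => c * g x)%R); [exact: measurable_funM|exact: nearW].
- by rewrite divr_gt0.
apply: le_lt_trans h; apply: le_integral_yfun => x _.
rewrite mulrA normrM [leRHS]normrM ler_wpM2r// mulrAC -mulrA normrM.
by rewrite ler_piMr// normrM normfV (gtr0_norm c1) ler_pdivrMr// mul1r lerDl.
Qed.

Lemma LphiD v v' : Lphi mu D Phi v -> Lphi mu D Phi v' ->
  Lphi mu D Phi (fun x => v x + v' x)%R.
Proof.
move=> /Lphi_elim[g [l [mg vg l0 h]]] /Lphi_elim[g' [l' [mg' vg' l'0 h']]].
apply: eq_Lphi (_ : Lphi mu D Phi (fun x => g x + g' x)%R).
  by apply: filterS2 vg vg' => x E E' Dx; rewrite E// E'.
(* The factor 1/2 turns the sum into a midpoint, to which convexity applies; the minimum fits both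
   modulars. *)
apply: (@Lphi_intro _ (Num.min l l' / 2)%R).
- apply: (@ae_measurable_of _ (fun x => g x + g' x)%R); last exact: nearW.
  exact: measurable_funD.
- by rewrite divr_gt0// lt_min l0.
have m0 (a : R) (f : T -> R) : measurable_fun setT f ->
    measurable_fun D (fun x => (P x (a * f x))%:E).
  move=> mf; apply/measurable_EFinP; apply: measurable_funTS.
  by apply: (@measurable_comp_yfun (fun x => a * f x)%R); exact: measurable_funM.
apply: (@le_lt_trans _ _ (\int[mu]_(x in D)
    ((P x (l * g x))%:E + (P x (l' * g' x))%:E))); last first.
  rewrite ge0_integralD//; first exact: lte_add_pinfty.
  - by move=> x _; rewrite lee_fin yfun_ge0.
  - exact: m0.
  - by move=> x _; rewrite lee_fin yfun_ge0.
  - exact: m0.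
apply: ge0_le_integral_unmeasurable => x Dx; first by rewrite lee_fin yfun_ge0.
rewrite -EFinD lee_fin.
have t01 : (0 <= (2^-1 : R) <= 1)%R by rewrite invr_ge0 ler0n invf_le1// ler1n.
have -> : (Num.min l l' / 2 * (g x + g' x) =
   2^-1 * (Num.min l l' * g x) + (1 - 2^-1) * (Num.min l l' * g' x))%R by field.
apply: (le_trans (yfun_convex (nP x) _ _ t01)).
have minl0 : (0 < Num.min l l')%R by rewrite lt_min l0.
have h1 : (P x (Num.min l l' * g x) <= P x (l * g x))%R.
  apply: yfun_homo => //; rewrite !normrM ler_wpM2r//.
  by rewrite !gtr0_norm// ge_min lexx.
have h2 : (P x (Num.min l l' * g' x) <= P x (l' * g' x))%R.
  apply: yfun_homo => //; rewrite !normrM ler_wpM2r//.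
  by rewrite !gtr0_norm// ge_min lexx orbT.
have p1 := yfun_ge0 (nP x) (Num.min l l' * g x).
have p2 := yfun_ge0 (nP x) (Num.min l l' * g' x).
by lra.
Qed.

(** Ensures that the norm is a true infimum; over the empty set [inf] would return its default value
    0. *)
Lemma luxemburg_set_neq0 v : Lphi mu D Phi v ->
  exists2 l, (0 < l)%R & modular mu D Phi (fun x => v x / l)%R <= 1.
Proof.
move=> /Lphi_elim[g [l [mg vg l0 h]]].
pose I := \int[mu]_(x in D) (P x (l * g x))%:E.
have I0 : 0 <= I by apply: integral_ge0 => x _; rewrite lee_fin yfun_ge0.
have Ifin : I \is a fin_num by rewrite ge0_fin_numE.
(* Since [c >= 1], convexity lets the factor [c^-1] out of the modular, which leaves
   [I / c <= 1]. *)
pose c := (fine I + 1)%R.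
have c0 : (0 < c)%R by rewrite ltr_wpDl// fine_ge0.
exists (c / l)%R; first by rewrite divr_gt0.
rewrite (@eq_modular _ (fun x => g x / (c / l))%R); last first.
  by apply: filterS vg => x E Dx; rewrite E.
rewrite modularE.
apply: (@le_trans _ _ (\int[mu]_(x in D) ((c^-1)%:E * (P x (l * g x))%:E))).
  apply: ge0_le_integral_unmeasurable => x Dx; first by rewrite lee_fin yfun_ge0.
  rewrite -EFinM lee_fin.
  have -> : (g x / (c / l) = c^-1 * (l * g x))%R.
    by field; rewrite !gt_eqF.
  apply: yfun_scale => //; rewrite invr_ge0 (ltW c0)/= invf_le1//.
  by rewrite lerDr fine_ge0.
rewrite ge0_integralZl_EFin//.
- rewrite -/I -(fineK Ifin) -EFinM lee_fin ler_pdivrMl// mulr1.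
  by rewrite lerDl.
- by move=> x _; rewrite lee_fin yfun_ge0.
- apply/measurable_EFinP; apply: measurable_funTS.
  by apply: (@measurable_comp_yfun (fun x => l * g x)%R); exact: measurable_funM.
- by rewrite invr_ge0 ltW.
Qed.

(** The continuous embedding of the space into [L^1]: the bound on [g / l], of modular at most 1,
    reads [(1 + C) * l] once multiplied by [l], and the infimum over [l] is taken. *)
Lemma integral_le_luxemburg (C : R) v : (0 <= C)%R ->
  (forall g : T -> R, measurable_fun setT g ->
    \int[mu]_(x in D) `|g x|%:E <= \int[mu]_(x in D) (P x (g x))%:E + C%:E) ->
  Lphi mu D Phi v ->
  \int[mu]_(x in D) `|v x|%:E <= ((1 + C) * luxemburg mu D Phi v)%:E.
Proof.
move=> C0 HC Lv; have [g [_ [mg vg _ _]]] := Lphi_elim Lv.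
have C1 : (0 < 1 + C)%R by rewrite ltr_pwDl.
rewrite (@ae_eq_integral_unmeasurable _ _ _ _ _ _ (fun x => `|g x|%:E)); last first.
  by apply: filterS vg => x E Dx; rewrite E.
set I := \int[mu]_(x in D) _.
have I0 : 0 <= I by apply: integral_ge0 => x _; rewrite lee_fin.
have Il l : (0 < l)%R -> modular mu D Phi (fun x => v x / l)%R <= 1 ->
    I <= ((1 + C) * l)%:E.
  move=> l0; rewrite (@eq_modular _ (fun x => g x / l)%R); last first.
    by apply: filterS vg => x E Dx; rewrite E.
  rewrite modularE => vl1.
  have := HC (fun x => g x / l)%R.
  have mgl : measurable_fun setT (fun x => g x / l)%R by exact: measurable_funM.
  move=> /(_ mgl) H.
  have -> : I = l%:E * \int[mu]_(x in D) `|g x / l|%:E.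
    rewrite -ge0_integralZl_EFin//; last 2 first.
    - by apply/measurable_EFinP; apply: measurable_funTS; exact: measurableT_comp.
    - exact: ltW.
    apply: eq_integral => x _; rewrite -EFinM normrM normfV (gtr0_norm l0).
    by rewrite mulrC divfK// gt_eqF.
  rewrite mulrC EFinM lee_pmul2l ?lte_fin//.
  by apply: (le_trans H); rewrite EFinD leeD2r.
have [l0 l00 vl0] := luxemburg_set_neq0 Lv.
have Ifin : I \is a fin_num.
  by rewrite ge0_fin_numE// (le_lt_trans (Il _ l00 vl0))// ltry.
rewrite -(fineK Ifin) lee_fin -ler_pdivrMl//; apply: lb_le_inf.
  by exists l0.
move=> l [lp lv]; rewrite ler_pdivrMl//.
by rewrite -lee_fin fineK//; exact: Il.
Qed.

End musielak_orlicz_theory.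

Lemma luxemburg_ge0 d (T : measurableType d) {R : realType}
    (mu : {measure set T -> \bar R}) (D : set T) (Phi : T -> R -> \bar R) v :
  0 <= luxemburg mu D Phi v.
Proof.
rewrite /luxemburg; set S := [set _ | _].
have [->|S0] := eqVneq S set0; first by rewrite inf0.
by apply: lb_le_inf; [exact/set0P|move=> l [/ltW]].
Qed.

(** * Integration over a set as a functional, and Bochner integrals *)

Section bochner_pairing.
Context d (T : measurableType d) {R : realType}.
Variables (mu : {measure set T -> \bar R}) (D : set T) (Phi : T -> R -> \bar R).
Variable P : T -> R -> R.
Hypothesis mD : measurable D.
Hypothesis nP : forall x, yfun (P x).
Hypothesis mP : measurable_fun setT (fun p : T * measurableTypeR R => P p.1 p.2).
Hypothesis PhiE : {ae mu, forall x, D x -> forall r, Phi x r = (P x r)%:E}.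
Variable C : R.
Hypothesis C0 : 0 <= C.
Hypothesis HC : forall g : T -> R, measurable_fun setT g ->
  (\int[mu]_(x in D) `|g x|%:E <= \int[mu]_(x in D) (P x (g x))%:E + C%:E)%E.
Variable A : set T.
Hypotheses (mA : measurable A) (AD : A `<=` D).

Local Notation leb := (@lebesgue_measure R).
Local Notation V := (Lphi mu D Phi).
Local Notation normV := (luxemburg mu D Phi).
Implicit Types v : T -> R.

(** The pairing with the indicator of [A]. Such functionals are bounded on [V], and the values for
    all [A] determine a function a.e.: they stand in for the whole dual space. *)
Definition intA v : R := \int[mu]_(x in A) v x.

Lemma Lphi_integrable v : V v -> exists g : T -> R,
  [/\ measurable_fun setT g, v = g %[ae mu in D],
      mu.-integrable D (EFin \o g) & mu.-integrable A (EFin \o g)].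
Proof.
move=> Vv; have [g [_ [mg vg _ _]]] := Lphi_elim mD nP PhiE Vv.
have ig : mu.-integrable D (EFin \o g).
  apply/integrableP; split; first exact/measurable_EFinP/measurable_funTS.
  apply: (@le_lt_trans _ _ (\int[mu]_(x in D) `|v x|%:E)%E).
    rewrite (@ae_eq_integral_unmeasurable _ _ _ _ _ _ (fun x => `|v x|%:E)%E)//.
    by apply: filterS vg => x E Dx; rewrite E.
  by apply: le_lt_trans (integral_le_luxemburg mD nP mP PhiE C0 HC Vv) _; rewrite ltry.
by exists g; split => //; exact: integrableS ig.
Qed.

Lemma eq_intA v v' : v = v' %[ae mu in D] -> intA v = intA v'.
Proof.
move=> vv'; rewrite /intA /Rintegral; congr fine.
by apply: ae_eq_integral_unmeasurable; apply: filterS vv' => x E /AD Dx; rewrite E.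
Qed.

Lemma intAZD c v v' : V v -> V v' -> intA (c *: v + v') = c * intA v + intA v'.
Proof.
move=> /Lphi_integrable[g [mg vg _ ig]] /Lphi_integrable[g' [mg' vg' _ ig']].
rewrite (eq_intA vg) (eq_intA vg').
have -> : intA (c *: v + v') = intA (fun x => c * g x + g' x).
  apply: eq_intA; apply: filterS2 vg vg' => x E E' Dx.
  by rewrite -E// -E'.
rewrite /intA RintegralD//; first by rewrite RintegralZl.
exact: (integrableZl mA c ig).
Qed.

Lemma intA_le v : V v -> `|intA v| <= (1 + C) * normV v.
Proof.
move=> Vv; have [g [mg vg iD ig]] := Lphi_integrable Vv.
rewrite (eq_intA vg); apply: le_trans (le_normr_Rintegral _ ig) _ => //.
rewrite -lee_fin /Rintegral fineK; last first.
  by apply: integrable_fin_num => //; exact: integrable_norm.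
apply: le_trans (integral_le_luxemburg mD nP mP PhiE C0 HC Vv).
rewrite [leRHS](@ae_eq_integral_unmeasurable _ _ _ _ _ _ (fun x => `|g x|%:E)); last first.
  by apply: filterS vg => x E Dx; rewrite E.
apply: ge0_subset_integral => //.
by apply/measurable_EFinP; apply: measurable_funTS; exact: measurableT_comp.
Qed.

Lemma V0 : V 0.
Proof.
apply: (Lphi_intro nP PhiE (l := 1)) => //.
  by exists (cst 0) => //; exact: nearW.
under eq_integral do rewrite mulr0 (yfun0 (nP _)).
by rewrite integral0.
Qed.

Lemma V_ZD c v v' : V v -> V v' -> V (c *: v + v').
Proof.
by move=> Vv Vv'; apply: (LphiD mD nP mP PhiE) => //; exact: (LphiZ mD nP PhiE).
Qed.

Lemma intA0 : intA 0 = 0.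
Proof.
have := intAZD 1 V0 V0; rewrite scale1r addr0 mul1r.
by move/eqP; rewrite -subr_eq0 opprD addNKr oppr_eq0 => /eqP.
Qed.

Lemma intA_sum n (c : 'I_n -> R) (v : 'I_n -> T -> R) : (forall i, V (v i)) ->
  V (\sum_i c i *: v i) /\ intA (\sum_i c i *: v i) = \sum_i c i * intA (v i).
Proof.
elim: n c v => [|n IH] c v Vv; first by rewrite !big_ord0 intA0; split => //; exact: V0.
rewrite !big_ord_recl.
have [Vs Es] := IH (fun i => c (lift ord0 i)) (fun i => v (lift ord0 i)) (fun i => Vv _).
by split; [exact: V_ZD|rewrite intAZD// Es].
Qed.

(** A bounded functional commutes with the Bochner integral: exactly so on step functions, and the
    errors on both sides are bounded by norms that tend to 0. The function [a] is an integrable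
    stand-in for [intA (f t)]. *)
Lemma bochner_integral_intA (J : set (measurableTypeR R)) (f : R -> T -> R) (w : T -> R) (a : R -> R) :
  measurable J -> (leb J < +oo)%E -> bochner_integral V normV J f w ->
  leb.-integrable J (EFin \o a) -> {ae leb, forall t, J t -> a t = intA (f t)} ->
  intA w = \int[leb]_(t in J) a t.
Proof.
move=> mJ Joo [[fV _ _] Vw [s [ss sf sw]]] ia af.
have K0 : 0 < 1 + C by rewrite ltr_pwDl.
pose b k t := intA (step_eval (s k) t).
have stepV k t : V (step_eval (s k) t).
  by have [] := @intA_sum _ (fun i => \1_(stepset i) t) (fun i => @stepval _ _ (s k) i) (fun i => (ss k i).2).
have bE k t : b k t = \sum_i \1_(@stepset _ _ (s k) i) t * intA (stepval i).
  by have [] := @intA_sum _ (fun i => \1_(stepset i) t) (fun i => @stepval _ _ (s k) i) (fun i => (ss k i).2).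
have stepintV k : V (step_int J (s k)).
  by have [] := @intA_sum _ (fun i => fine (leb (J `&` stepset i))) (fun i => @stepval _ _ (s k) i) (fun i => (ss k i).2).
have stepintE k : intA (step_int J (s k)) =
    \sum_i fine (leb (J `&` @stepset _ _ (s k) i)) * intA (stepval i).
  by have [] := @intA_sum _ (fun i => fine (leb (J `&` stepset i))) (fun i => @stepval _ _ (s k) i) (fun i => (ss k i).2).
have iind k i : leb.-integrable J (fun t => (\1_(@stepset _ _ (s k) i) t)%:E).
  apply: integrableS (_ : leb.-integrable J _) => //.
  have mSi := (ss k i).1.
  apply/integrableP; split.
    by apply/measurable_EFinP; apply: measurable_funTS; exact: measurable_indic.
  under eq_integral do rewrite /= ger0_norm//.
  rewrite integral_indic//; apply: le_lt_trans Joo; apply: le_measure; rewrite ?inE//.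
  exact: measurableI.
have ib k : leb.-integrable J (EFin \o b k).
  rewrite (_ : EFin \o b k = (fun t => \sum_i (\1_(@stepset _ _ (s k) i) t * intA (stepval i))%:E)%E); last first.
    by apply/funext => t; rewrite /= bE sumEFin.
  apply: integrable_sum => // i _.
  rewrite (_ : (fun t => _) = (fun t => (intA (@stepval _ _ (s k) i))%:E * (\1_(@stepset _ _ (s k) i) t)%:E)%E).
    exact: integrableZl.
  by apply/funext => t; rewrite -EFinM mulrC.
have intb k : \int[leb]_(t in J) b k t = intA (step_int J (s k)).
  rewrite stepintE /Rintegral.
  rewrite (eq_integral (fun t : measurableTypeR R => \sum_i ((intA (@stepval _ _ (s k) i))%:E * (\1_(@stepset _ _ (s k) i) t)%:E))%E); last first.
    by move=> t _; rewrite bE -sumEFin; apply: eq_bigr => i _; rewrite -EFinM mulrC.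
  rewrite integral_sum//; last by move=> i; exact: integrableZl.
  rewrite -[RHS]/(fine (\sum_i _)%:E) -sumEFin; congr fine; apply: eq_bigr => i _.
  have mSi : measurable (@stepset _ _ (s k) i : set (measurableTypeR R)) := (ss k i).1.
  rewrite (integralZl mJ (iind k i)) (integral_indic _ mJ mSi) EFinM muleC; congr (_ * _)%E.
  rewrite setIC fineK// ge0_fin_numE//; apply: le_lt_trans Joo.
  by apply: le_measure; rewrite ?inE//; exact: measurableI.
have bound k : `|intA w - \int[leb]_(t in J) a t| <=
    (1 + C) * normV (step_int J (s k) - w) + \int[leb]_(t in J) `|b k t - a t|.
  have -> : intA w - \int[leb]_(t in J) a t =
      - (intA (step_int J (s k)) - intA w) + \int[leb]_(t in J) (b k t - a t).
    by rewrite RintegralB// intb; ring.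
  apply: le_trans (ler_normD _ _) _; rewrite normrN; apply: lerD.
    have -> : intA (step_int J (s k)) - intA w = intA (step_int J (s k) - w).
      have := intAZD (-1) Vw (stepintV k).
      by rewrite scaleN1r mulN1r addrC => E; rewrite E addrC.
    apply: intA_le; have := V_ZD (-1) Vw (stepintV k).
    by rewrite scaleN1r addrC.
  apply: le_normr_Rintegral => //.
  by have := integrableB mJ (ib k) ia.
apply/eqP; rewrite -subr_eq0 -normr_le0; apply/ler_addgt0Pl => e e0; rewrite addr0.
have e2 : 0 < e / 2 / (1 + C) by rewrite !divr_gt0.
have : \forall k \near \oo, normV (step_int J (s k) - w) <= e / 2 / (1 + C).
  move/cvgrPdist_le : sw => /(_ _ e2); apply: filterS => k.
  by rewrite sub0r normrN ger0_norm// luxemburg_ge0.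
have : \forall k \near \oo,
    (\int[leb]_(t in J) (normV (step_eval (s k) t - f t)%R)%:E < (e / 2 / (1 + C))%:E)%E.
  have := sf; move=> /(_ [set x | x < (e / 2 / (1 + C))%:E]%E); apply.
  by apply: open_nbhs_nbhs; split; [exact: open_ereal_lt_ereal|rewrite /= lte_fin].
move=> h1 h2; near \oo => k.
apply: le_trans (bound k) _; rewrite [leRHS](splitr e); apply: lerD.
  rewrite -ler_pdivlMl// mulrC.
  near: k; exact: h2.
have iba : leb.-integrable J (fun t => `|b k t - a t|%:E).
  by have := integrable_abse (integrableB mJ (ib k) ia).
have e2' : (\int[leb]_(t in J) ((1 + C)^-1 * `|b k t - a t|)%:E <= (e / 2 / (1 + C))%:E)%E.
  apply: (@le_trans _ _ (\int[leb]_(t in J) (normV (step_eval (s k) t - f t)%R)%:E)%E).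
    apply: ge0_ae_le_integral_unmeasurable => [t _|t _|].
    - by rewrite lee_fin mulr_ge0// invr_ge0 ltW.
    - by rewrite lee_fin luxemburg_ge0.
    apply: (@filterS2 _ _ (ae_filter_ringOfSetsType leb) _ _ _ _ af fV) => t ta tV Jt.
    rewrite lee_fin ler_pdivrMl// ta//.
    have Vd : V (step_eval (s k) t - f t).
      by have := V_ZD (-1) (tV Jt) (stepV k t); rewrite scaleN1r addrC.
    have -> : b k t - intA (f t) = intA (step_eval (s k) t - f t).
      have := intAZD (-1) (tV Jt) (stepV k t).
      by rewrite scaleN1r mulN1r addrC => E; rewrite E addrC.
    exact: intA_le.
  by apply: ltW; near: k; exact: h1.
have := e2'; rewrite (_ : (\int[leb]_(t in J) ((1 + C)^-1 * `|b k t - a t|)%:E =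
   ((1 + C)^-1 * \int[leb]_(t in J) `|b k t - a t|)%:E)%E); last first.
  rewrite -RintegralZl// /Rintegral fineK//; apply: integrable_fin_num => //.
  exact: (integrableZl mJ (1 + C)^-1 iba).
by rewrite lee_fin ler_pdivrMl// [leRHS]mulrC divfK ?gt_eqF.
Unshelve. all: by end_near. Qed.

End bochner_pairing.

(** The topology lives on row vectors and the sigma-algebra on tuples. They meet in the cubes with
    rational centre and radius: an open set is the countable union of those it contains. *)
Lemma open_tuple_measurable {R : realType} n (A : set (n.-tuple R)) :
  open_tuple A -> measurable A.
Proof.
move=> oA.
pose B (qe : n.-tuple rat * rat) : set (n.-tuple R) :=
  \bigcap_(i in [set: 'I_n])
    ((fun x : n.-tuple R => tnth x i) @^-1`
      `](ratr (tnth qe.1 i) - ratr qe.2)%R, (ratr (tnth qe.1 i) + ratr qe.2)%R[).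
have BP qe x : B qe x <-> forall i, `|tnth x i - ratr (tnth qe.1 i)| < ratr qe.2.
  split => [H i|H i _].
    have := H i I; rewrite /= in_itv/= => /andP[? ?].
    by rewrite ltr_distlC; apply/andP; split; lra.
  by rewrite /= in_itv/=; have := H i; rewrite ltr_norml => /andP[? ?]; lra.
pose F k := if unpickle k is Some qe then
  if `[< B qe `<=` A >] then B qe else set0 else set0.
have mB qe : measurable (B qe).
  apply: fin_bigcap_measurable => [|i _]; first exact: finite_finset.
   rewrite -[X in measurable X]setTI.
  exact: measurable_tnth.
suff -> : A = \bigcup_k F k.
  apply: bigcup_measurable => k _; rewrite /F; case: unpickle => // qe.
  by case: asboolP.
apply/seteqP; split => [x Ax|x [k _]]; last first.
  by rewrite /F; case: unpickle => // qe; case: asboolP => // /[apply].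
pose rx : 'rV[R]_n := \row_i tnth x i.
have tup (y : n.-tuple R) : [tuple (\row_i tnth y i : 'rV[R]_n) ord0 i | i < n] = y.
  by apply: eq_from_tnth => i; rewrite tnth_mktuple mxE.
have : nbhs rx [set v : 'rV[R]_n | A [tuple v ord0 i | i < n]].
  by apply: open_nbhs_nbhs; split => //=; rewrite tup.
move=> /nbhs_ballP[e /= e0 eA].
have [q2] : exists q : rat, (ratr q : R) \in `]0, (e / 2)[%R.
  by apply: rat_in_itvoo; rewrite divr_gt0.
rewrite in_itv/= => /andP[q20 q2e].
have /choice[q1 Hq1] : forall i : 'I_n, exists q : rat, `|tnth x i - ratr q| < ratr q2.
  move=> i; have : tnth x i - ratr q2 < tnth x i + ratr q2 by lra.
  move=> /rat_in_itvoo[q]; rewrite in_itv/= => /andP[? ?]; exists q.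
  by rewrite ltr_norml; apply/andP; split; lra.
pose qe : n.-tuple rat * rat := ([tuple q1 i | i < n], q2).
(* The centre is within [q2 < e / 2] of [x], so that the whole cube is within [e] of [x]. *)
have Bx : B qe x by apply/BP => i; rewrite tnth_mktuple; exact: Hq1.
exists (pickle qe) => //; rewrite /F pickleK; case: asboolP => // -[].
move=> y /BP By; rewrite -(tup y); apply: eA; split => // i j; rewrite !mxE /ball/=.
have := By j; rewrite tnth_mktuple => h1; have h2 := Hq1 j.
move: h1 h2; rewrite !ltr_norml => /andP[? ?] /andP[? ?]; apply/andP; split; lra.
Qed.

Section regularize.
Context {R : realType} (n : nat) (Omega : set (n.-tuple R)).
Local Notation RN := (n.-tuple R).
Local Notation lebN := (lebesgue_tuple R n).
Variables phi alpha : RN -> R -> R.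
Hypothesis mO : measurable Omega.
Hypothesis AA : assumptionA Omega phi alpha.

Lemma phi_yfun : {ae lebN, forall x, Omega x -> yfun (phi x)}.
Proof.
have [K K2 H] := A_delta2 AA.
apply: filterS2 (A_convex AA) H => x cvx D2 Ox.
have [sc _ ev sd] := cvx Ox.
have phi_ge0 := A_ge0 AA Ox.
have min0 r : phi x 0 <= phi x r.
  have : subdiff (phi x) 0 0 by rewrite sd.
  by move=> /(_ r); rewrite mul0r subr_ge0.
(* phi*(x, 0) = - phi(x, 0), so the Delta_2 condition for phi* at r = 0
   forces phi(x, 0) <= 0. *)
have conj0 : phistar phi x 0 = (- phi x 0)%:E.
  apply/eqP; rewrite eq_le; apply/andP; split.
    by apply: ge_ereal_sup => _ [s _ <-]; rewrite lee_fin mul0r sub0r lerN2.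
  by apply: ereal_sup_ubound; exists 0 => //; rewrite mul0r sub0r.
have phi0 : phi x 0 = 0.
  apply/eqP; rewrite eq_le phi_ge0 andbT.
  have [_] := D2 Ox 0 (lexx 0); rewrite mulr0 conj0 -EFinM lee_fin => h.
  have := phi_ge0 0; nra.
split => // t r s /andP[t0 t1].
have [->|rs] := eqVneq r s; first by rewrite -mulrDl -mulrDl addrC subrK !mul1r.
have [->|t00] := eqVneq t 0; first by rewrite subr0 !mul0r !mul1r !add0r.
have [->|t11] := eqVneq t 1; first by rewrite subrr !mul0r !mul1r !addr0.
by apply/ltW/sc => //; rewrite !lt_def t00 t0 eq_sym t11.
Qed.

(** The null sets for the values at rational points and for [phi_yfun] are merged into one. On it
    and off [Omega] the function is set to 0; measurability at the rationals then gives joint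
    measurability by [yfun_jointly_measurable]. *)
Lemma regularize_phi : exists P : RN -> R -> R,
  [/\ forall x, yfun (P x), forall r, measurable_fun setT (P ^~ r) &
      {ae lebN, forall x, Omega x -> P x = phi x}].
Proof.
have /choice[g gP] : forall k, exists g : RN -> R,
    measurable_fun setT g /\ phi^~ (ratn k) = g %[ae lebN in Omega].
  move=> k; have /(ae_measurableT mO)[g mg pg] := A_measurable AA (ratn k).
  by exists g.
have gE : {ae lebN, forall x, forall k, Omega x -> phi x (ratn k) = g k x}.
  by apply: ae_foralln => k; exact: (gP k).2.
have [N [mN N0 NP]] := filterI phi_yfun gE.
pose O' := Omega `\` N; have mO' : measurable O' by exact: measurableD.
have O'P x : O' x -> yfun (phi x) /\ forall k, phi x (ratn k) = g k x.
  move=> [Ox Nx]; have [p q] : (Omega x -> yfun (phi x)) /\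
      (forall k, Omega x -> phi x (ratn k) = g k x).
    by apply: contrapT => h; apply/Nx/NP.
  by split; [exact: p|move=> k; exact: q].
pose P x r := if x \in O' then phi x r else 0.
have nP x : yfun (P x).
  have [xO|xO] := boolP (x \in O').
    by rewrite (_ : P x = phi x); [move: xO; rewrite inE => /O'P[]|rewrite /P xO].
  by rewrite (_ : P x = fun=> 0); [exact: yfun_cst0|rewrite /P (negbTE xO)].
exists P; split => //.
  move=> r; have := @yfun_jointly_measurable _ RN _ P nP.
  have mPn k : measurable_fun setT (fun x => P x (ratn k)).
    rewrite (_ : (fun x => _) = g k \_ O').
      by apply/(measurable_restrictT _ mO'); apply: measurable_funTS; exact: (gP k).1.
    apply/funext => x; rewrite /P patchE; case: ifPn => //.
    by rewrite inE => /O'P[_ ->].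
  move=> /(_ mPn) mP; exact: (measurable_fun_pair1 (r : measurableTypeR R) mP).
exists N; split => // x /=; apply: contra_notP => Nx Ox.
by apply/funext => r; rewrite /P mem_set.
Qed.

End regularize.

(** * Differential inequalities for a lower semicontinuous function *)

Section prim_extra.
Context {R : realType}.
Local Notation leb := (@lebesgue_measure R).
Variables (f : R -> R) (intf : leb.-integrable setT (EFin \o f)).

Lemma prim_small (e : R) : 0 < e -> exists2 del, 0 < del &
  forall a b, a <= b -> b - a < del -> `|prim f b - prim f a| < e.
Proof.
move=> e0; have [del [del0 H]] := integral_normr_continuous intf e0.
exists del => // a b ab bad; rewrite prim_sub//.
have iab : leb.-integrable `]a, b] (EFin \o f) by apply: integrableS intf.
apply: le_lt_trans (le_normr_Rintegral _ iab) _ => //; apply: H => //.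
rewrite /= lebesgue_measure_itv/= lte_fin; case: ifP => _; first by rewrite -EFinB lte_fin.
by rewrite lte_fin.
Qed.

Lemma prim_sub_ge (a b c : R) : a <= b -> (forall t, 0 <= f t) ->
  {ae leb, forall t, a < t < b -> c <= f t} -> c * (b - a) <= prim f b - prim f a.
Proof.
move=> ab f0 cf; have [c0|c0] := leP c 0.
  apply: (@le_trans _ _ 0); last by rewrite subr_ge0; exact: prim_le.
  by rewrite mulr_le0_ge0// subr_ge0.
rewrite -lee_fin EFin_prim_sub//.
have mf : measurable_fun setT f by case/integrableP : intf => /measurable_EFinP.
rewrite (@integral_itv_bndoo _ a b _ false false); last first.
  by apply/measurable_EFinP; exact: measurable_funTS.
have -> : ((c * (b - a))%:E = \int[leb]_(x in `]a, b[) (cst c%:E) x)%E.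
  rewrite integral_cst//= lebesgue_measure_itv/= lte_fin; case: ltP => // ba.
  by have -> : b - a = 0 by lra.
apply: ae_ge0_le_integral => //.
- by move=> t _; rewrite /= lee_fin ltW.
- by move=> t _; rewrite lee_fin.
- by apply/measurable_EFinP; exact: measurable_funTS.
Qed.

End prim_extra.

Section scalar_chain_rule.
Context {R : realType}.
Local Notation leb := (@lebesgue_measure R).
Variables (T : R) (e : R -> \bar R) (f H Z : R -> R).
Hypothesis T0 : 0 < T.
Hypothesis e0 : forall t, 0 <= t <= T -> (0 <= e t)%E.
Hypothesis lsc : forall t (a : R), 0 <= t <= T -> (a%:E < e t)%E ->
  exists2 del, 0 < del &
    forall s, 0 <= s <= T -> `|s - t| < del -> (a%:E < e s)%E.
Hypothesis f0 : forall t, 0 <= f t.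
Hypothesis fe : {ae leb, forall t, 0 < t < T -> e t = (f t)%:E}.
Hypothesis intf : leb.-integrable setT (EFin \o f).
Hypothesis intH : leb.-integrable setT (EFin \o H).
Hypothesis intZ : leb.-integrable setT (EFin \o Z).
(** The constant competitor, with the space variable integrated out: the primitive of [Z] carries
    the error. [T2r] and [T2l] below are the translates to the right and to the left, after Fatou's
    lemma with a loss [k]. *)
Hypothesis T1 : forall t a b, (e t < +oo)%E -> 0 <= a -> a <= t -> t <= b -> b <= T ->
  prim f b - prim f a <= (b - a) * (fine (e t) + (prim Z b - prim Z a)).
Let h (n : nat) : R := n.+1%:R^-1.
Hypothesis T2r : forall a b k, 0 <= a -> a < b -> b < T -> 0 < k ->
  exists N, forall n, (N <= n)%N -> b + h n <= T ->
    h n * (prim H b - prim H a - k) <=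
    (prim f (b + h n) - prim f (a + h n)) - (prim f b - prim f a).
Hypothesis T2l : forall a b k, 0 < a -> a < b -> b <= T -> 0 < k ->
  exists N, forall n, (N <= n)%N -> 0 <= a - h n ->
    - h n * (prim H b - prim H a + k) <=
    (prim f (b - h n) - prim f (a - h n)) - (prim f b - prim f a).

Let h_gt0 n : 0 < h n. Proof. by rewrite invr_gt0 ltr0n. Qed.

Let h_small (del : R) N : 0 < del -> exists2 n, (N <= n)%N & h n < del.
Proof.
move=> del0; have : h n @[n --> \oo] --> 0 by exact: cvg_harmonic.
move=> /cvgrPdist_lt/(_ _ del0) [M _ HM]; exists (maxn N M); first exact: leq_maxl.
have /= := HM (maxn N M) (leq_maxr _ _).
by rewrite sub0r normrN ger0_norm// ltW.
Qed.

Let avg_ge t (a : R) : 0 <= t <= T -> (a%:E < e t)%E ->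
  exists2 del, 0 < del & forall c d, 0 <= c -> c <= d -> d <= T ->
    t - del < c -> d < t + del -> a * (d - c) <= prim f d - prim f c.
Proof.
move=> tT aet; have [del del0 Hdel] := lsc tT aet.
exists del => // c d c0 cd dT tc dt; apply: prim_sub_ge => //.
apply: (@filterS _ _ (ae_filter_ringOfSetsType leb) _ _ _ fe) => s es /andP[cs sd].
rewrite -lee_fin -es; last by lra.
by apply/ltW/Hdel; [lra|rewrite ltr_norml; lra].
Qed.

Let between (x : R) (y : \bar R) : (x%:E < y)%E -> exists2 a, x < a & (a%:E < y)%E.
Proof.
case: y => [y| |]//=; rewrite ?lte_fin => xy.
  by exists ((x + y) / 2); rewrite ?lte_fin; lra.
by exists (x + 1); [lra|rewrite ltry].
Qed.

(** The translate to the right compares the means of [f] just after [b] and just after [a]. The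
    first is at most [e b + o(1)] by [T1], the second is bounded below by lower semicontinuity at
    [a]. As [e a] may be infinite a priori, finiteness spreads backwards in time. *)
Lemma energy_le_right a b : 0 <= a -> a < b -> b < T -> (e b < +oo)%E ->
  (e a <= (fine (e b) - (prim H b - prim H a))%:E)%E.
Proof.
move=> a0 ab bT eb; rewrite leNgt; apply/negP => /between[a' a'1 a'2].
set rhs := _ - _ in a'1.
(* [T1] and [T2r] each lose [k], so half of the gap between [a'] and [rhs] is left for the
   contradiction. *)
pose k := (a' - rhs) / 4; have k0 : 0 < k by rewrite divr_gt0// subr_gt0.
have aT : 0 <= a <= T by lra.
have [del1 del10 H1] := avg_ge aT a'2.
have [del2 del20 H2] := prim_small intZ k0.
have [N HN] := T2r a0 ab bT k0.
have : 0 < Num.min del1 (Num.min del2 (T - b)) by rewrite !lt_min del10 del20/= subr_gt0.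
move=> /(h_small N)[n Nn]; rewrite !lt_min => /and3P[h1 h2 h3].
have hn := h_gt0 n.
have A1 : a' * h n <= prim f (a + h n) - prim f a.
  have := H1 a (a + h n); rewrite (_ : a + h n - a = h n); last by ring.
  by apply; lra.
have A2 : prim f (b + h n) - prim f b <= h n * (fine (e b) + k).
  have := @T1 b b (b + h n) eb; rewrite (_ : b + h n - b = h n); last by ring.
  move=> A2; apply: le_trans (A2 _ _ _ _) _; try lra.
  rewrite ler_wpM2l ?(ltW hn)// lerD2l.
  apply: le_trans (ler_norm _) _; apply/ltW/H2; lra.
have A3 := HN n Nn; have {A3} : b + h n <= T by lra.
move=> /(HN n Nn) A3.
have : h n * a' <= h n * (fine (e b) + k - (prim H b - prim H a - k)) by rewrite mulrBr; lra.
rewrite ler_pM2l// /k; rewrite /rhs in a'1 *; lra.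
Qed.

(** The mirror image of [energy_le_right], with means taken just before both times; finiteness now
    spreads forwards. *)
Lemma energy_le_left a b : 0 < a -> a < b -> b <= T -> (e a < +oo)%E ->
  (e b <= (fine (e a) + (prim H b - prim H a))%:E)%E.
Proof.
move=> a0 ab bT ea; rewrite leNgt; apply/negP => /between[a' a'1 a'2].
set rhs := _ + _ in a'1.
pose k := (a' - rhs) / 4; have k0 : 0 < k by rewrite divr_gt0// subr_gt0.
have aT : 0 <= b <= T by lra.
have [del1 del10 H1] := avg_ge aT a'2.
have [del2 del20 H2] := prim_small intZ k0.
have [N HN] := T2l a0 ab bT k0.
have : 0 < Num.min del1 (Num.min del2 a) by rewrite !lt_min del10 del20/=.
move=> /(h_small N)[n Nn]; rewrite !lt_min => /and3P[h1 h2 h3].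
have hn := h_gt0 n.
have A1 : a' * h n <= prim f b - prim f (b - h n).
  have := H1 (b - h n) b; rewrite (_ : b - (b - h n) = h n); last by ring.
  by apply; lra.
have A2 : prim f a - prim f (a - h n) <= h n * (fine (e a) + k).
  have := @T1 a (a - h n) a ea; rewrite (_ : a - (a - h n) = h n); last by ring.
  move=> A2; apply: le_trans (A2 _ _ _ _) _; try lra.
  rewrite ler_wpM2l ?(ltW hn)// lerD2l.
  apply: le_trans (ler_norm _) _; apply/ltW/H2; lra.
have : 0 <= a - h n by lra.
move=> /(HN n Nn) A3.
have : h n * a' <= h n * (fine (e a) + k + (prim H b - prim H a + k)) by rewrite mulrDr; lra.
rewrite ler_pM2l// /k; rewrite /rhs in a'1 *; lra.
Qed.

Let energy_fin_some : exists2 t, 0 < t < T & (e t < +oo)%E.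
Proof.
apply: contrapT => nex.
have : {ae leb, forall t, ~ (0 < t < T)}.
  by apply: (@filterS _ _ (ae_filter_ringOfSetsType leb) _ _ _ fe) => t et tT; apply: nex; exists t => //; rewrite et// ltry.
move=> [N [mN N0 NP]]; have : (leb (`]0%R, T[%classic : set (measurableTypeR R)) <= leb N)%E.
  apply: le_measure; rewrite ?inE// => t; rewrite /= in_itv/= => tT.
  by apply: NP => /(_ tT).
by rewrite N0 lebesgue_measure_itv/= lte_fin T0 sube0 lee_fin leNgt T0.
Qed.

(** From one finite value in the open interval, [energy_le_right] reaches all earlier times
    including 0, and [energy_le_left] all later ones including [T]. *)
Lemma energy_fin t : 0 <= t <= T -> (e t < +oo)%E.
Proof.
move=> /andP[t0 tT]; have [s /andP[s0 sT] es] := energy_fin_some.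
have [ts|st|->//] := ltgtP t s.
  by apply: le_lt_trans (energy_le_right t0 ts sT es) _; rewrite ltry.
by apply: le_lt_trans (energy_le_left s0 st tT es) _; rewrite ltry.
Qed.

Let eE t : 0 <= t <= T -> e t = (fine (e t))%:E.
Proof. by move=> tT; rewrite fineK// ge0_fin_numE ?e0// energy_fin. Qed.

Let energy_interior a b : 0 < a -> a < b -> b < T ->
  fine (e b) = fine (e a) + (prim H b - prim H a).
Proof.
move=> a0 ab bT; have aT : 0 <= a <= T by lra. have bT' : 0 <= b <= T by lra.
have := energy_le_right (ltW a0) ab bT (energy_fin bT').
have := energy_le_left a0 ab (ltW bT) (energy_fin aT).
rewrite (eE aT) (eE bT') !lee_fin => h1 h2.
by apply/eqP; rewrite eq_le h1/=; lra.
Qed.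

Let energy_ge_avg t a b c : 0 <= a -> a <= t -> t <= b -> b <= T -> a < b ->
  (forall s, a < s < b -> c <= fine (e s)) ->
  c <= fine (e t) + (prim Z b - prim Z a).
Proof.
move=> a0 at_ tb bT ab ce.
have tT : 0 <= t <= T by lra.
have h1 := T1 (energy_fin tT) a0 at_ tb bT.
have : c * (b - a) <= prim f b - prim f a.
  apply: prim_sub_ge => //; first exact: ltW.
  apply: (@filterS _ _ (ae_filter_ringOfSetsType leb) _ _ _ fe) => s es sab; have sT : 0 < s < T by lra.
  by have := ce s sab; rewrite es.
move=> /le_trans/(_ h1); rewrite mulrC ler_pM2l//; lra.
Qed.

(** The inequality that the translate to the left cannot give at 0. Close to 0 the interior identity
    keeps [e] near the left side, and [T1] at time 0 bounds its mean by [e 0 + o(1)]. *)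
Let energy_left_end b : 0 < b -> b < T ->
  fine (e b) - (prim H b - prim H 0) <= fine (e 0).
Proof.
move=> b0 bT; apply/ler_addgt0Pl => k k0.
have k20 : 0 < k / 2 by rewrite divr_gt0.
have [d1 d10 HZ] := prim_small intZ k20; have [d2 d20 HH] := prim_small intH k20.
pose r := Num.min (Num.min d1 d2) b / 2.
have r0 : 0 < r by rewrite divr_gt0// !lt_min d10 d20.
have rr : r < Num.min (Num.min d1 d2) b.
  by rewrite /r ltr_pdivrMr// ltr_pMr ?ltr1n// !lt_min d10 d20.
move: rr; rewrite !lt_min => /andP[/andP[rd1 rd2] rb].
have : fine (e b) - (prim H b - prim H 0) - k / 2 <= fine (e 0) + (prim Z r - prim Z 0).
  apply: energy_ge_avg => //; try lra.
  move=> s /andP[s0 sr]; rewrite (@energy_interior s b)//; last by lra.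
  have : `|prim H s - prim H 0| < k / 2 by apply: HH; lra.
  rewrite ltr_norml; lra.
have : `|prim Z r - prim Z 0| < k / 2 by apply: HZ; lra.
rewrite ltr_norml; lra.
Qed.

Let energy_right_end a : 0 < a -> a < T ->
  fine (e a) + (prim H T - prim H a) <= fine (e T).
Proof.
move=> a0 aT; apply/ler_addgt0Pl => k k0.
have k20 : 0 < k / 2 by rewrite divr_gt0.
have [d1 d10 HZ] := prim_small intZ k20; have [d2 d20 HH] := prim_small intH k20.
pose r := Num.min (Num.min d1 d2) (T - a) / 2.
have r0 : 0 < r by rewrite divr_gt0// !lt_min d10 d20/= subr_gt0.
have rr : r < Num.min (Num.min d1 d2) (T - a).
  by rewrite /r ltr_pdivrMr// ltr_pMr ?ltr1n// !lt_min d10 d20/= subr_gt0.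
move: rr; rewrite !lt_min => /andP[/andP[rd1 rd2] rb].
have : fine (e a) + (prim H T - prim H a) - k / 2 <= fine (e T) + (prim Z T - prim Z (T - r)).
  apply: energy_ge_avg => //; try lra.
  move=> s /andP[s0 sr]; rewrite (@energy_interior a s)//; last by lra.
  have : `|prim H T - prim H s| < k / 2 by apply: HH; lra.
  rewrite ltr_norml; lra.
have : `|prim Z T - prim Z (T - r)| < k / 2 by apply: HZ; lra.
rewrite ltr_norml; lra.
Qed.

Lemma scalar_chain_rule s t : 0 <= s -> s <= t -> t <= T ->
  fine (e t) - fine (e s) = prim H t - prim H s.
Proof.
have step a b : 0 <= a -> a < b -> b <= T -> ~~ ((a == 0) && (b == T)) ->
    fine (e b) - fine (e a) = prim H b - prim H a.
  move=> a0 ab bT ends.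
  have aT' : 0 <= a <= T by lra. have bT' : 0 <= b <= T by lra.
  move: a0; rewrite le_eqVlt => /predU1P[a0|a0].
    have bT2 : b < T by rewrite lt_def bT andbT eq_sym; move: ends; rewrite -a0 eqxx.
    rewrite -a0 in ab aT' *.
    have := energy_left_end ab bT2.
    have := energy_le_right (lexx 0) ab bT2 (energy_fin bT').
    rewrite (eE aT') lee_fin; lra.
  move: bT; rewrite le_eqVlt => /predU1P[bT|bT].
    rewrite bT in ab bT' *.
    have := energy_right_end a0 ab.
    have := energy_le_left a0 ab (lexx T) (energy_fin aT').
    rewrite (eE bT') lee_fin; lra.
  by have := energy_interior a0 ab bT; lra.
move=> s0; rewrite le_eqVlt => /predU1P[<-|st] tT; first by rewrite !subrr.
have [/andP[/eqP s0' /eqP tT']|ends] := boolP ((s == 0) && (t == T)); last exact: step.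
(* For the pair 0, [T] neither end is interior, whereas the inequalities at each end ask for an
   interior partner; the midpoint provides it. *)
rewrite s0' tT'; have E1 : fine (e (T / 2)) - fine (e 0) = prim H (T / 2) - prim H 0.
  by apply: step; rewrite ?eqxx/=; try lra; rewrite lt_eqF//; lra.
have E2 : fine (e T) - fine (e (T / 2)) = prim H T - prim H (T / 2).
  by apply: step; try lra; rewrite gt_eqF//; lra.
lra.
Qed.

End scalar_chain_rule.

(** * Borel representatives *)

Section ae_product.
Context d (X : measurableType d) {R : realType} (mR := measurableTypeR R).
Variable m : {sigma_finite_measure set X -> \bar R}.
Local Notation leb := (@lebesgue_measure R).
Local Notation M := (m \x leb)%E.

Lemma ae_fst (D : set X) (J : set mR) (Q : X -> Prop) :
  {ae m, forall x, D x -> Q x} ->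
  {ae M, forall p : X * mR, (D `*` J) p -> Q p.1}.
Proof.
move=> [N [mN N0 NP]]; exists (N `*` setT); split.
- exact: measurableX.
- by rewrite product_measure1E//; transitivity (m N * leb setT)%E => //; rewrite N0 mul0e.
- move=> [x t] /= /not_implyP[[Dx _] nQ]; split => //; apply: NP => /=.
  by apply/not_implyP.
Qed.

Let integral_section (S : set (X * mR)) : measurable S ->
  M S = (\int[leb]_t \int[m]_x (\1_S (x, t))%:E)%E /\
  measurable_fun setT (fun t : mR => \int[m]_x (\1_S (x, t))%:E)%E.
Proof.
move=> mS; have m1S : measurable_fun setT (fun p : X * mR => (\1_S p : R)%:E).
  by apply/measurable_EFinP; exact: measurable_indic.
split; last first.
  by apply: (measurable_fun_fubini_tonelli_G (m1 := m) _ m1S) => p; rewrite lee_fin.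
have := integral_indic M measurableT mS; rewrite setIT => <-.
by rewrite fubini_tonelli2// => p; rewrite lee_fin.
Qed.

Lemma ae_slices (Q : X * mR -> Prop) : {ae M, forall p, Q p} ->
  {ae leb, forall t, {ae m, forall x, Q (x, t)}}.
Proof.
move=> [N [mN N0 NP]]; have [E mE] := integral_section mN.
have : ae_eq leb setT (fun t : mR => \int[m]_x (\1_N (x, t))%:E)%E (cst 0%E).
  apply/ae_eq_integral_abs => //; rewrite -[RHS]N0 E.
  by apply: eq_integral => t _; rewrite gee0_abs// integral_ge0// => x _; rewrite lee_fin.
apply: (@filterS _ _ (ae_filter_ringOfSetsType leb)) => t /(_ I) Nt.
have mNt : measurable [set x | N (x, t)].
  by have := measurable_ysection t mN; rewrite /ysection; congr measurable;
    apply/seteqP; split => x /=; rewrite inE.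
exists [set x | N (x, t)]; split.
- exact: mNt.
- have := integral_indic m measurableT mNt; rewrite setIT => <-.
  exact: Nt.
- by move=> x nQ; apply: NP.
Qed.

Lemma integrable_fubini2 (f : X * mR -> \bar R) : M.-integrable setT f ->
  leb.-integrable setT (fubini_G m f).
Proof.
move=> intf; have mf := measurable_int _ intf.
have mG := measurable_fubini_G intf.
apply/integrableP; split => //.
apply: le_lt_trans ((integrable21ltyP m leb mf).1 intf).
apply: ge0_le_integral_unmeasurable => // t _; apply: le_abse_integral => //.
exact: measurable_fun_pair1.
Qed.

(** The converse of [ae_slices] by Tonelli, where measurability of [S] is essential: it is what
    turns an equality at a.e. time into an equality a.e. on the cylinder. *)
Lemma null_slices (S : set (X * mR)) : measurable S ->
  {ae leb, forall t, {ae m, forall x, ~ S (x, t)}} -> M S = 0%E.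
Proof.
move=> mS aeS; have [-> mE] := integral_section mS.
rewrite (@ae_eq_integral_unmeasurable _ _ _ _ _ _ (cst 0%E)) ?integral0//.
apply: (@filterS _ _ (ae_filter_ringOfSetsType leb) _ _ _ aeS) => t aex _.
rewrite (@ae_eq_integral_unmeasurable _ _ _ _ _ _ (cst 0%E)) ?integral0//.
by apply: filterS aex => x nS _; rewrite indicE memNset.
Qed.

End ae_product.

Section representatives.
Context d (X : measurableType d) {R : realType} (mR := measurableTypeR R).
Variable m : {sigma_finite_measure set X -> \bar R}.
Local Notation leb := (@lebesgue_measure R).
Local Notation M := (m \x leb)%E.

Let rect (Omega : set X) (I : set mR) (f : X * mR -> \bar R) :
  measurable Omega -> measurable I -> measurable_fun setT f ->
  measurable_fun setT (f \_ (Omega `*` I)).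
Proof.
move=> mO mI mf; apply/(measurable_restrictT _ (measurableX mO mI)).
exact: measurable_funTS.
Qed.

Lemma ge0_integral_rect1 (f : X * mR -> \bar R) (Omega : set X) (I : set mR) :
  measurable Omega -> measurable I -> measurable_fun setT f ->
  (forall p, 0 <= f p)%E ->
  (\int[M]_(p in Omega `*` I) f p = \int[m]_(x in Omega) \int[leb]_(t in I) f (x, t))%E.
Proof.
move=> mO mI mf f0; rewrite integral_mkcond fubini_tonelli1; last 2 first.
- exact: rect.
- by move=> p; rewrite patchE; case: ifP.
rewrite [RHS]integral_mkcond; apply: eq_integral => x _; rewrite /fubini_F patchE.
case: ifPn => xO.
  rewrite [RHS]integral_mkcond; apply: eq_integral => t _; rewrite !patchE.
  rewrite inE in xO; congr (if _ then _ else _).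
  by apply/idP/idP; rewrite !inE/=; [case|split].
rewrite integral0_eq// => t _; rewrite patchE memNset// => -[/= Ox _].
by move/negP: xO; apply; rewrite inE.
Qed.

Lemma ge0_integral_rect2 (f : X * mR -> \bar R) (Omega : set X) (I : set mR) :
  measurable Omega -> measurable I -> measurable_fun setT f ->
  (forall p, 0 <= f p)%E ->
  (\int[M]_(p in Omega `*` I) f p = \int[leb]_(t in I) \int[m]_(x in Omega) f (x, t))%E.
Proof.
move=> mO mI mf f0; rewrite integral_mkcond fubini_tonelli2; last 2 first.
- exact: rect.
- by move=> p; rewrite patchE; case: ifP.
rewrite [RHS]integral_mkcond; apply: eq_integral => t _; rewrite /fubini_G patchE.
case: ifPn => tI.
  rewrite [RHS]integral_mkcond; apply: eq_integral => x _; rewrite !patchE.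
  rewrite inE in tI; congr (if _ then _ else _).
  by apply/idP/idP; rewrite !inE/=; [case|split].
rewrite integral0_eq// => x _; rewrite patchE memNset// => -[/= _ It].
by move/negP: tI; apply; rewrite inE.
Qed.

Variables (Omega : set X) (T : R) (P : X -> R -> R).
Hypotheses (mO : measurable Omega).
Hypothesis nP : forall x, yfun (P x).
Hypothesis mP : measurable_fun setT (fun p : X * mR => P p.1 p.2).
Hypothesis mPr : forall r, measurable_fun setT (P ^~ r).
Hypothesis conj1 : (\int[m]_(x in Omega) conjugate (P x) 1 < +oo)%E.

Let cyl : set (X * mR) := Omega `*` `]0, T[.

Let mcyl : measurable cyl. Proof. exact: measurableX. Qed.

Lemma abs_le_yfun (x : X) (r : R) : (`|r|%:E <= (P x r)%:E + conjugate (P x) 1)%E.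
Proof.
by rewrite -[in leRHS](yfun_norm (nP x)); have := young (P x) `|r| 1; rewrite mulr1.
Qed.

Let mc1 : measurable_fun setT (fun x => conjugate (P x) 1).
Proof.
have := measurable_conjugate nP mPr => mc.
exact: (measurable_fun_pair1 (1 : mR) mc).
Qed.

(** Young's inequality against the constant function 1; [C] is the integral of the conjugate at
    1. *)
Lemma yfun_L1_bound : exists2 C : R, 0 <= C & forall g : X -> R, measurable_fun setT g ->
  (\int[m]_(x in Omega) `|g x|%:E <= \int[m]_(x in Omega) (P x (g x))%:E + C%:E)%E.
Proof.
have c0 : (0 <= \int[m]_(x in Omega) conjugate (P x) 1)%E.
  by apply: integral_ge0 => x _; exact: conjugate_ge0.
exists (fine (\int[m]_(x in Omega) conjugate (P x) 1)); first exact: fine_ge0.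
move=> g mg; rewrite fineK ?ge0_fin_numE//.
rewrite -ge0_integralD//; last 4 first.
- by move=> x _; rewrite lee_fin yfun_ge0.
- by apply/measurable_EFinP; apply: measurable_funTS; exact: measurable_comp_yfun.
- by move=> x _; exact: conjugate_ge0.
- exact: measurable_funTS.
apply: ge0_le_integral_unmeasurable => x _; first by rewrite lee_fin.
exact: abs_le_yfun.
Qed.

(* In gp_young the two times differ: this dominates the product of eta and a
   time increment of the primitive of v. *)
Record good_pair (v eta z w : X * mR -> R) : Prop := GoodPair {
  gp_mv : measurable_fun setT v;
  gp_meta : measurable_fun setT eta;
  gp_iv : M.-integrable setT (EFin \o v);
  gp_iz : M.-integrable setT (EFin \o z);
  gp_iw : M.-integrable setT (EFin \o w);
  gp_z0 : forall p, 0 <= z p;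
  gp_w0 : forall p, 0 <= w p;
  gp_ivx : forall x, leb.-integrable setT (fun s => (v (x, s))%:E);
  gp_iwx : forall x, leb.-integrable setT (fun s => (w (x, s))%:E);
  gp_young : forall x t s, `|eta (x, t) * v (x, s)| <= z (x, t) + w (x, s);
  gp_eta0 : forall p, ~ cyl p -> eta p = 0 }.

Variables (v1 eta1 : X * mR -> R) (l lam : R).
Hypotheses (mv1 : measurable_fun setT v1) (meta1 : measurable_fun setT eta1).
Hypotheses (l0 : 0 < l) (lam0 : 0 < lam).
Hypothesis v1P : (\int[M]_(p in cyl) (P p.1 (l * v1 p))%:E < +oo)%E.
Hypothesis eta1P : (\int[M]_(p in cyl) conjugate (P p.1) (lam * `|eta1 p|) < +oo)%E.

Lemma exists_good_pair : exists v eta z w,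
  [/\ good_pair v eta z w, v = v1 %[ae M in cyl] & eta = eta1 %[ae M in cyl]].
Proof.
(* Young's inequality bounds [l * lam * |eta1 * v1|]; division by [c] gives the shape of [z] and [w]
   below. *)
pose c := l * lam; have c0 : 0 < c by exact: mulr_gt0.
have mPQ : measurable_fun setT (fun q : (X * mR) * mR => P q.1.1 q.2).
  apply: (measurableT_comp mP (f := _) (g := fun q : (X * mR) * mR => (q.1.1, q.2))).
  apply: measurable_fun_pair => //.
  by apply: (measurableT_comp measurable_fst); exact: measurable_fst.
pose z1 p := conjugate (P p.1) (lam * `|eta1 p|).
have z10 p : (0 <= z1 p)%E by exact: conjugate_ge0.
have mz1 : measurable_fun setT z1.
  apply: (measurableT_comp (measurable_conjugate nP mPr) (f := _)
    (g := fun p : X * mR => (p.1, lam * `|eta1 p|))).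
  apply: measurable_fun_pair => //; apply: measurable_funM => //.
  exact: measurableT_comp.
have iz1 : M.-integrable cyl z1.
  apply/integrableP; split; first exact: measurable_funTS.
  by under eq_integral do rewrite gee0_abs//.
(* Young's inequality is void where the conjugate is infinite, so [eta] is set to 0 there; inside
   the cylinder this affects a null set, as [z1] is integrable. *)
pose S := cyl `&` [set p | z1 p \is a fin_num].
have mS : measurable S.
  exact: (emeasurable_fin_num mcyl (measurable_funTS mz1)).
pose w1 p := c^-1 * P p.1 (l * v1 p).
have mw1 : measurable_fun setT w1.
  apply: measurable_funM => //.
  apply: (@measurable_comp_yfun _ _ _ (fun p : X * mR => P p.1) mPQ (fun p => l * v1 p)).
  exact: measurable_funM.
have w10 p : 0 <= w1 p by rewrite mulr_ge0 ?invr_ge0 ?(ltW c0)//; exact: yfun_ge0.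
have iw1 : M.-integrable cyl (EFin \o w1).
  apply: (@integrableZl _ _ _ _ _ mcyl c^-1 (fun p => (P p.1 (l * v1 p))%:E)).
  apply/integrableP; split.
    apply/measurable_EFinP; apply: measurable_funTS.
    apply: (@measurable_comp_yfun _ _ _ (fun p : X * mR => P p.1) mPQ (fun p => l * v1 p)).
    exact: measurable_funM.
  by under eq_integral do rewrite gee0_abs ?lee_fin ?yfun_ge0//.
have iv1 : M.-integrable cyl (EFin \o v1).
  apply/integrableP; split; first exact/measurable_EFinP/measurable_funTS.
  apply: (@le_lt_trans _ _ (\int[M]_(p in cyl) ((l^-1)%:E *
      ((P p.1 (l * v1 p))%:E + conjugate (P p.1) 1)))%E).
    apply: ge0_le_integral_unmeasurable => [p _|p _]; first by rewrite abse_ge0.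
    rewrite /= -(@lee_pmul2l _ l%:E)// muleA -!EFinM mulfV ?gt_eqF// mul1e.
    by apply: le_trans (abs_le_yfun p.1 (l * v1 p)); rewrite normrM gtr0_norm.
  have mconj : measurable_fun cyl (fun p : X * mR => conjugate (P p.1) 1).
    by apply: measurable_funTS; exact: (measurableT_comp mc1).
  have mPl : measurable_fun cyl (fun p : X * mR => (P p.1 (l * v1 p))%:E).
    apply/measurable_EFinP; apply: measurable_funTS.
    apply: (@measurable_comp_yfun _ _ _ (fun p : X * mR => P p.1) mPQ (fun p => l * v1 p)).
    exact: measurable_funM.
  rewrite ge0_integralZl//; last 3 first.
  - exact: emeasurable_funD.
  - by move=> p _; rewrite adde_ge0// ?lee_fin ?yfun_ge0// conjugate_ge0.
  - by rewrite lee_fin invr_ge0 ltW.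
  rewrite ge0_integralD//; last 2 first.
  - by move=> p _; rewrite lee_fin yfun_ge0.
  - by move=> p _; exact: conjugate_ge0.
  rewrite lte_mul_pinfty ?lee_fin ?invr_ge0 ?(ltW l0)//.
  apply: lte_add_pinfty => //.
  rewrite (@ge0_integral_rect1 (fun p => conjugate (P p.1) 1))//; last 2 first.
  - exact: (measurableT_comp mc1).
  - by move=> p; exact: conjugate_ge0.
  rewrite (eq_integral (fun x => leb (`]0%R, T[%classic : set mR) * conjugate (P x) 1)%E); last first.
    by move=> x _; rewrite muleC -(integral_cst leb (measurable_itv `]0, T[)).
  rewrite ge0_integralZl//; last 2 first.
  - exact: measurable_funTS.
  - by move=> x _; exact: conjugate_ge0.
  rewrite lte_mul_pinfty// lebesgue_measure_itv/=; case: ifP => _//.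
have iR (f : X * mR -> R) : M.-integrable cyl (EFin \o f) ->
    M.-integrable setT (EFin \o (f \_ cyl)).
  by move=> fi; rewrite -restrict_EFin; apply/(integrable_mkcond _ mcyl).
(* The points [x] whose time line is not integrable form a null set. The functions are set to 0
   above it, so that the properties along lines hold for every [x]. *)
have [N [mN N0 NP]] := filterI (ae_integrable1 (iR _ iv1)) (ae_integrable1 (iR _ iw1)).
have NP' x : ~ N x -> leb.-integrable setT (fun s => ((v1 \_ cyl) (x, s))%:E) /\
    leb.-integrable setT (fun s => ((w1 \_ cyl) (x, s))%:E).
  by move=> Nx; apply: contrapT => h; apply: Nx; apply: NP.
pose G : set (X * mR) := (~` N) `*` setT.
have mG : measurable G by apply: measurableX => //; exact: measurableC.
have iG (f : X * mR -> R) : M.-integrable cyl (EFin \o f) ->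
    M.-integrable setT (EFin \o ((f \_ cyl) \_ G)).
  move=> /iR fi; rewrite -restrict_EFin; apply/(integrable_mkcond _ mG).
  exact: integrableS fi.
have xG (f : X * mR -> R) x : (~ N x -> leb.-integrable setT (fun s => ((f \_ cyl) (x, s))%:E)) ->
    leb.-integrable setT (fun s => (((f \_ cyl) \_ G) (x, s))%:E).
  move=> H; have [xN|xN] := pselect (N x).
    rewrite (_ : (fun s => _) = cst 0%E); first exact: integrable0.
    by apply/funext => s; rewrite patchE memNset// => -[].
  rewrite (_ : (fun s => _) = (fun s => ((f \_ cyl) (x, s))%:E)); first exact: H.
  by apply/funext => s; rewrite [in LHS]patchE mem_set.
pose z p := ((fun p => c^-1 * fine (z1 p)) \_ S) p.
exists ((v1 \_ cyl) \_ G), (eta1 \_ S), z, ((w1 \_ cyl) \_ G); split.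
- have mr (f : X * mR -> R) (A : set (X * mR)) : measurable A -> measurable_fun setT f ->
      measurable_fun setT (f \_ A).
    by move=> mA mf; apply/(measurable_restrictT _ mA); exact: measurable_funTS.
  split.
  + by apply: (mr _ G mG); exact: (mr _ cyl mcyl).
  + exact: mr.
  + exact: iG.
  + rewrite /z -restrict_EFin; apply/(integrable_mkcond _ mS).
    apply: (@integrableZl _ _ _ _ _ mS c^-1 (fun p => (fine (z1 p))%:E)).
    have : M.-integrable S z1 by apply: integrableS iz1 => //; exact: subIsetl.
    by apply: eq_integrable => // p; rewrite inE => -[_ /fineK].
  + exact: iG.
  + move=> p; rewrite /z patchE; case: ifP => // _.
    by rewrite mulr_ge0 ?invr_ge0 ?(ltW c0)// fine_ge0.
  + by move=> p; rewrite !patchE; case: ifP => // _; case: ifP.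
  + by move=> x; apply: xG => /NP'[].
  + by move=> x; apply: xG => /NP'[].
  + move=> x t s; have zp p : 0 <= z p.
      rewrite /z patchE; case: ifP => // _.
      by rewrite mulr_ge0 ?invr_ge0 ?(ltW c0)// fine_ge0.
    have wp p : 0 <= ((w1 \_ cyl) \_ G) p.
      by rewrite !patchE; case: ifP => // _; case: ifP.
    have trivial0 r : r = 0 -> `|r| <= z (x, t) + ((w1 \_ cyl) \_ G) (x, s).
      by move=> ->; rewrite normr0 addr_ge0.
    have [xtS|xtS] := boolP ((x, t) \in S); last first.
      by apply: trivial0; rewrite patchE (negbTE xtS) mul0r.
    have [xsG|xsG] := boolP ((x, s) \in G); last first.
      by apply: trivial0; rewrite [X in _ * X]patchE (negbTE xsG) mulr0.
    have [xsC|xsC] := boolP ((x, s) \in cyl); last first.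
      by apply: trivial0; rewrite !patchE xsG (negbTE xsC) mulr0.
    rewrite /z !patchE xtS xsG xsC /w1/=.
    have xtfin : z1 (x, t) \is a fin_num by move: xtS; rewrite inE => -[].
    have := young (P x) `|l * v1 (x, s)| (lam * `|eta1 (x, t)|).
    rewrite (yfun_norm (nP x)) (_ : conjugate (P x) _ = z1 (x, t))// -(fineK xtfin) -EFinD lee_fin => yg.
    rewrite -mulrDr -(@ler_pM2l _ c)// mulrA mulfV ?gt_eqF// mul1r addrC.
    apply: le_trans yg; rewrite /c !normrM (gtr0_norm l0).
    by rewrite le_eqVlt; apply/orP; left; apply/eqP; ring.
  + by move=> p np; rewrite patchE memNset// => -[].
- exists (N `*` setT); split.
  + exact: measurableX.
  + rewrite product_measure1E//; transitivity (m N * leb setT)%E => //.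
    by rewrite N0 mul0e.
  + move=> [x t] /= /not_implyP[Cx]; apply: contra_notP => nN.
    by rewrite !patchE mem_set; [rewrite mem_set|split => //=; apply: contra_not nN].
- have := integrable_ae mcyl iz1; apply: filterS => p fp Cp.
  by rewrite patchE mem_set//; split => //; exact: fp.
Qed.

End representatives.

(** * Time increments of the continuous representative *)

Section time_increments.
Context d (X : measurableType d) {R : realType} (mR := measurableTypeR R).
Variable m : {sigma_finite_measure set X -> \bar R}.
Local Notation leb := (@lebesgue_measure R).
Local Notation M := (m \x leb)%E.
Variables (Omega : set X) (T : R) (Phi : X -> R -> \bar R) (P : X -> R -> R).
Hypothesis mO : measurable Omega.
Hypothesis T0 : 0 < T.
Hypothesis nP : forall x, yfun (P x).
Hypothesis mP : measurable_fun setT (fun p : X * mR => P p.1 p.2).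
Hypothesis PhiE : {ae m, forall x, Omega x -> forall r, Phi x r = (P x r)%:E}.
Variable C : R.
Hypothesis C0' : 0 <= C.
Hypothesis HC : forall g : X -> R, measurable_fun setT g ->
  (\int[m]_(x in Omega) `|g x|%:E <= \int[m]_(x in Omega) (P x (g x))%:E + C%:E)%E.
Local Notation V := (Lphi m Omega Phi).
Local Notation N := (luxemburg m Omega Phi).
Variables (uf gf ubar : R -> X -> R) (v : X * mR -> R).
Hypothesis uW11 : W11 V N T uf gf.
Hypothesis uC0 : C0 V N T ubar.
Hypothesis ubarE : {ae leb, forall t, 0 < t < T -> ubar t = uf t %[ae m in Omega]}.
Hypothesis gfE : {ae leb, forall t, 0 < t < T ->
  gf t = (fun x => v (x, t)) %[ae m in Omega]}.
Hypothesis mv : measurable_fun setT v.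
Hypothesis iv : M.-integrable setT (EFin \o v).
Hypothesis ivx : forall x, leb.-integrable setT (fun s => (v (x, s))%:E).

Section fixed_set.
Variable A : set X.
Hypotheses (mA : measurable A) (AO : A `<=` Omega).

Let ivA : M.-integrable setT (EFin \o (v \_ (A `*` setT))).
Proof.
have mAT : measurable (A `*` setT : set (X * mR)) by exact: measurableX.
rewrite -restrict_EFin; apply/(integrable_mkcond _ mAT).
exact: integrableS iv.
Qed.

Let GA (t : R) : R := \int[m]_(x in A) v (x, t).

Let GAE t : GA t = fine (fubini_G m (EFin \o (v \_ (A `*` setT))) t).
Proof.
rewrite /GA /Rintegral /fubini_G integral_mkcond; congr fine.
apply: eq_integral => x _; rewrite /= !patchE.
have -> : (x \in A) = ((x, t) \in (A `*` setT : set (X * mR))).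
  by apply/idP/idP; rewrite !inE/= => // -[].
by case: ifP.
Qed.

Let iGA : leb.-integrable setT (EFin \o GA).
Proof.
have iF := integrable_fubini2 ivA.
rewrite (_ : EFin \o GA = fun t => (fine (fubini_G m (EFin \o (v \_ (A `*` setT))) t))%:E); last first.
  by apply/funext => t; rewrite /= GAE.
have mF := measurable_int _ iF.
apply: le_integrable iF => //.
  by apply/measurable_EFinP; exact: measurableT_comp.
by move=> t _; case: (fubini_G _ _ t) => [r| |] //=; rewrite normr0 leey.
Qed.

Let prim_GA s t : s <= t ->
  prim GA t - prim GA s =
  \int[m]_(x in A) (primX v (x, t) - primX v (x, s)).
Proof.
move=> st; rewrite prim_sub//.
pose f := (EFin \o v) \_ (A `*` (`]s, t]%classic : set mR)).
have mAI : measurable (A `*` (`]s, t]%classic : set mR)) by exact: measurableX.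
have if_ : M.-integrable setT f.
  by apply/(integrable_mkcond _ mAI); exact: integrableS iv.
have := Fubini if_; rewrite /Rintegral.
have -> : (\int[m]_x \int[leb]_y f (x, y) =
    \int[m]_(x in A) (primX v (x, t) - primX v (x, s))%:E)%E.
  rewrite [RHS]integral_mkcond; apply: eq_integral => x _; rewrite patchE.
  case: ifPn => xA.
    rewrite /primX EFin_prim_sub//; last exact: ivx.
    rewrite [RHS]integral_mkcond; apply: eq_integral => y _; rewrite /f !patchE.
    rewrite inE in xA; congr (if _ then _ else _).
    by apply/idP/idP; rewrite !inE/=; [case|split].
  rewrite integral0_eq// => y _; rewrite /f patchE memNset// => -[/= Ax _].
  by move/negP: xA; apply; rewrite inE.
move=> ->; congr fine; rewrite integral_mkcond.
have : ae_eq leb setT (fun r => ((EFin \o GA) \_ `]s, t]) r)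
     (fun y => \int[m]_x f (x, y))%E.
  have := integrable_ae measurableT (integrable_fubini2 ivA).
  apply: (@filterS _ _ (ae_filter_ringOfSetsType leb)) => y /(_ I) yfin _.
  rewrite patchE; case: ifPn => yI.
    rewrite /= GAE fineK// /fubini_G; apply: eq_integral => x _.
    rewrite /f/= !patchE; rewrite inE in yI.
    have -> : ((x, y) \in (A `*` setT : set (X * mR))) =
        ((x, y) \in A `*` (`]s, t]%classic : set mR)).
      by apply/idP/idP; rewrite !inE/= => -[Ax _]; split.
    by case: ifP.
  rewrite integral0_eq// => x _; rewrite /f patchE memNset// => -[/= _ Iy].
  by move/negP: yI; apply; rewrite inE.
by move=> E; apply: ae_eq_integral_unmeasurable; apply: filterS E => y E; exact: E.
Qed.

(** Freezes time outside [[0, T]]: [weak_derivative_FTC] asks for a function continuous on the whole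
    line, while [ubar] is controlled on [[0, T]] only. *)
Let clamp (t : R) : R := Num.min (Num.max t 0) T.

Let clamp_id t : 0 <= t <= T -> clamp t = t.
Proof. by move=> /andP[t0 tT]; rewrite /clamp max_l// min_l. Qed.

Let clamp_itv t : 0 <= clamp t <= T.
Proof. by rewrite /clamp le_min ge_min lexx orbT le_max lexx orbT (ltW T0). Qed.

Let clamp_lip s t : `|clamp s - clamp t| <= `|s - t|.
Proof.
rewrite /clamp /Num.max /Num.min; do 4 case: ifPn;
  rewrite -?leNgt => *; rewrite ler_norml;
  have := ler_norm (s - t); have := ler_norm (t - s); rewrite (distrC t); lra.
Qed.

Let gA (t : R) : R := intA m A (ubar (clamp t)).

Let VB w w' : V w -> V w' -> V (w - w').
Proof.
move=> Vw Vw'; have := V_ZD mO nP mP PhiE (-1) Vw' Vw.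
by rewrite scaleN1r addrC.
Qed.

Let intAB w w' : V w -> V w' -> intA m A (w - w') = intA m A w - intA m A w'.
Proof.
move=> Vw Vw'; have := intAZD mO nP mP PhiE C0' HC mA AO (-1) Vw' Vw.
by rewrite scaleN1r mulN1r addrC => ->; rewrite addrC.
Qed.

Let continuous_gA : continuous gA.
Proof.
move=> t; apply/cvgrPdist_lt => e e0.
have K0 : 0 < 1 + C by rewrite ltr_pwDl.
have [uV uc] := uC0.
have [del del0 Hdel] := uc _ (clamp_itv t) (e / (1 + C)) (divr_gt0 e0 K0).
exists del => // s /= ts; rewrite distrC /gA -intAB; [|exact/uV/clamp_itv..].
apply: le_lt_trans (intA_le mO nP mP PhiE C0' HC mA AO _) _.
  by apply: VB; exact/uV/clamp_itv.
rewrite -ltr_pdivlMl// mulrC; apply: Hdel; first exact: clamp_itv.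
by apply: le_lt_trans (clamp_lip _ _) _; rewrite distrC.
Qed.

(** The weak derivative supplies [w] and [- w] as Bochner integrals; applying [intA] to both leaves
    an identity between real integrals. *)
Let weak_eq s t e : 0 < s -> s < t -> t < T -> 0 < e ->
  \int[leb]_(x in `]0, T[) (bump' s t e x * gA x) =
  - \int[leb]_(x in `]0, T[) (bump s t e x * GA x).
Proof.
move=> s0 st tT e0; have [[ufV _ _] [gfV _ _] wd] := uW11.
have [w bw1 bw2] := wd _ (bump_test_function e0 s0 tT).
have JT : (leb (`]0%R, T[%classic : set mR) < +oo)%E.
  by rewrite lebesgue_measure_itv/=; case: ifP => // _; rewrite -EFinB ltry.
have inT t' : (`]0, T[%classic : set mR) t' -> 0 < t' < T by rewrite /= in_itv.
have i1 : leb.-integrable (`]0, T[ : set mR) (EFin \o (fun x => bump' s t e x * gA x)).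
  apply: continuous_integrable_itv => x; apply: cvgM; first exact: continuous_bump'.
  exact: continuous_gA.
have i2 : leb.-integrable (`]0, T[ : set mR) (EFin \o (fun x => bump s t e x * GA x)).
  have iGT : leb.-integrable (`]0, T[ : set mR) (EFin \o GA) by apply: integrableS iGA.
  apply: le_integrable iGT => //.
    apply/measurable_EFinP; apply: measurable_funM; apply: measurable_funTS.
      by apply: continuous_measurable_fun; exact: continuous_bump.
    by case/integrableP : iGA => /measurable_EFinP.
  move=> x _ /=; rewrite lee_fin normrM ger0_norm ?bump_ge0//.
  by rewrite -[leRHS]mul1r ler_wpM2r// bump_le1.
have E1 : intA m A w = \int[leb]_(x in `]0, T[) (bump' s t e x * gA x).
  apply: (bochner_integral_intA mO nP mP PhiE C0' HC mA AO _ JT bw1 i1) => //.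
  apply: (@filterS2 _ _ (ae_filter_ringOfSetsType leb) _ _ _ _ ufV ubarE) => t' V1 E Jt.
  have := E (inT _ Jt) => Et.
  rewrite derive1_bump; have := intAZD mO nP mP PhiE C0' HC mA AO (bump' s t e t')
    (V1 Jt) (V0 nP PhiE).
  rewrite !addr0 (intA0 mO nP mP PhiE C0' HC mA AO) addr0 => ->.
  rewrite /gA clamp_id; last by have /andP[/ltW -> /ltW ->] := inT _ Jt.
  by rewrite (eq_intA AO Et).
have E2 : intA m A (- w) = \int[leb]_(x in `]0, T[) (bump s t e x * GA x).
  apply: (bochner_integral_intA mO nP mP PhiE C0' HC mA AO _ JT bw2 i2) => //.
  apply: (@filterS2 _ _ (ae_filter_ringOfSetsType leb) _ _ _ _ gfV gfE) => t' V1 E Jt.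
  have := E (inT _ Jt) => Et.
  have := intAZD mO nP mP PhiE C0' HC mA AO (bump s t e t') (V1 Jt) (V0 nP PhiE).
  rewrite !addr0 (intA0 mO nP mP PhiE C0' HC mA AO) addr0 => ->.
  by rewrite (eq_intA AO Et).
have [_ Vw _] := bw1.
have := intAZD mO nP mP PhiE C0' HC mA AO (-1) Vw (V0 nP PhiE).
rewrite scaleN1r !addr0 (intA0 mO nP mP PhiE C0' HC mA AO) addr0 mulN1r E1 E2.
by move=> ->; rewrite opprK.
Qed.

Let gA_interior s t : 0 < s -> s < t -> t < T -> gA t - gA s = prim GA t - prim GA s.
Proof.
move=> s0 st tT.
have iG : leb.-integrable (`]0, T[ : set mR) (EFin \o GA) by apply: integrableS iGA.
rewrite (weak_derivative_FTC continuous_gA iG s0 st tT); last first.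
  by move=> e e0; exact: weak_eq.
rewrite prim_sub ?(ltW st)// /Rintegral (@integral_itv_bndoo _ s t _ false false)//.
by case/integrableP : iGA => mG _; exact: measurable_funTS.
Qed.

Let D t := gA t - prim GA t.

Let D_close t e : 0 < e -> exists2 del, 0 < del &
  forall s, `|s - t| < del -> `|D s - D t| < e.
Proof.
move=> e0; have e20 : 0 < e / 2 by rewrite divr_gt0.
have /cvgrPdist_lt/(_ _ e20)[d1 /= d10 H1] := @continuous_gA t.
have [d2 d20 H2] := prim_small iGA e20.
exists (Num.min d1 d2); first by rewrite lt_min d10.
move=> s; rewrite lt_min => /andP[st1 st2].
have h1 : `|gA s - gA t| < e / 2 by rewrite distrC; apply: H1; rewrite /= distrC.
have h2 : `|prim GA s - prim GA t| < e / 2.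
  have [st'|st'] := leP t s.
    by apply: H2 => //; apply: le_lt_trans st2; rewrite ler_norm.
  rewrite distrC; apply: H2; first exact: ltW.
  by apply: le_lt_trans st2; rewrite distrC ler_norm.
rewrite /D (_ : _ - _ = (gA s - gA t) - (prim GA s - prim GA t)); last by ring.
by apply: le_lt_trans (ler_normB _ _) _; rewrite [ltRHS]splitr; exact: ltrD.
Qed.

(** Bumps supported inside []0, T[] only reach interior times; continuity of [D] carries the
    constancy to the two ends. *)
Let D_cst t : 0 <= t <= T -> D t = D (T / 2).
Proof.
move=> /andP[t0 tT].
have int_ s : 0 < s < T -> D s = D (T / 2).
  move=> /andP[s0 sT]; have [st|st|->//] := ltgtP s (T / 2).
    by have := gA_interior s0 st; rewrite /D; lra.
  by have := @gA_interior (T / 2) s; rewrite /D; lra.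
apply/eqP; rewrite -subr_eq0 -normr_le0; apply/ler_addgt0Pl => e e0; rewrite addr0.
have [del del0 Hd] := D_close t e0.
have [s sT st] : exists2 s, 0 < s < T & `|s - t| < del.
  pose r := Num.min del T / 2.
  have r0 : 0 < Num.min del T by rewrite lt_min del0.
  have /andP[rd rT] : (r < del) && (r < T).
    by rewrite -lt_min /r ltr_pdivrMr// ltr_pMr// ltr1n.
  have r0' : 0 < r by rewrite divr_gt0.
  have [tr|tr] := ltP t (T - r).
    by exists (t + r); [lra|rewrite addrAC subrr add0r gtr0_norm].
  have [tr'|tr'] := ltP 0 (t - r).
    by exists (t - r); [lra|rewrite addrAC subrr add0r normrN gtr0_norm].
  by exists (T / 2); [lra|rewrite ltr_norml; clearbody r; lra].
by rewrite -(int_ _ sT) distrC ltW// Hd.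
Qed.

Lemma intA_increment s t : 0 <= s -> s <= t -> t <= T ->
  intA m A (ubar t) - intA m A (ubar s) =
  \int[m]_(x in A) (primX v (x, t) - primX v (x, s)).
Proof.
move=> s0 st tT; have s01 : 0 <= s <= T by lra. have t01 : 0 <= t <= T by lra.
rewrite -prim_GA//; have := D_cst s01; have := D_cst t01.
by rewrite /D /gA !clamp_id//; lra.
Qed.

End fixed_set.

(** By [intA_increment] both increments have the same integral over every measurable subset of
    [Omega], hence agree a.e. The null set depends on [s] and [t], but no time of [[0, T]] is
    excluded. *)
Lemma ubar_increment s t : 0 <= s -> s <= t -> t <= T ->
  {ae m, forall x, Omega x ->
    ubar t x - ubar s x = primX v (x, t) - primX v (x, s)}.
Proof.
move=> s0 st tT; have s01 : 0 <= s <= T by lra. have t01 : 0 <= t <= T by lra.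
have [uV _] := uC0.
have [g [mg ug ig _]] := Lphi_integrable mO nP mP PhiE C0' HC mO (@subset_refl _ _) (uV _ t01).
have [g' [mg' ug' ig' _]] := Lphi_integrable mO nP mP PhiE C0' HC mO (@subset_refl _ _) (uV _ s01).
pose f x : \bar R := (g x - g' x)%:E.
pose F x : \bar R := (primX v (x, t) - primX v (x, s))%:E.
have if_ : m.-integrable Omega f by have := integrableB mO ig ig'.
have mF : measurable_fun Omega F.
  apply/measurable_EFinP; apply: measurable_funTS; apply: measurable_funB.
    exact: (measurable_fun_pair1 (t : mR) (measurable_primX mv)).
  exact: (measurable_fun_pair1 (s : mR) (measurable_primX mv)).
have iF : m.-integrable Omega F.
  apply/integrableP; split => //.
  apply: (@le_lt_trans _ _ (\int[m]_x \int[leb]_y `|(EFin \o v) (x, y)|)%E); last first.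
    exact: ((integrable12ltyP m leb (measurable_int _ iv)).1 iv).
  have mavx : measurable_fun setT (fun x => \int[leb]_y `|(EFin \o v) (x, y)|)%E.
    apply: (measurable_fun_fubini_tonelli_F (m2 := leb) (fun p => `|(EFin \o v) p|)%E) => //.
    by apply: measurableT_comp => //; exact/measurable_EFinP.
  apply: (@le_trans _ _ (\int[m]_(x in Omega) \int[leb]_y `|(EFin \o v) (x, y)|)%E); last first.
    apply: ge0_subset_integral => //.
    by move=> x _; apply: integral_ge0.
  apply: ge0_le_integral_unmeasurable => // x _.
  rewrite /F /= /primX prim_sub//; last exact: ivx.
  have ivI : leb.-integrable `]s, t] (EFin \o (fun r => v (x, r))).
    exact: integrableS (ivx x).
  have mvx : measurable_fun setT (fun r : mR => v (x, r)) by exact: measurable_fun_pair2.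
  apply: (@le_trans _ _ (\int[leb]_(r in `]s, t]) `|(v (x, r))%:E|)%E).
    rewrite EFin_normr_Rintegral//; apply: le_abse_integral => //.
    by apply/measurable_EFinP; exact: measurable_funTS.
  apply: ge0_subset_integral => //.
  by apply: measurableT_comp => //; exact/measurable_EFinP.
have fF : ae_eq m Omega f F.
  apply: integral_ae_eq => // A AO mA.
  have iA := intA_increment mA AO s0 st tT.
  have igA : m.-integrable A (EFin \o g) by apply: integrableS ig.
  have igA' : m.-integrable A (EFin \o g') by apply: integrableS ig'.
  rewrite (eq_intA AO ug) (eq_intA AO ug') in iA.
  rewrite /intA -RintegralB// in iA.
  rewrite -[LHS]fineK; last by apply: integrable_fin_num => //; exact: integrableS if_.
  rewrite -[RHS]fineK; last by apply: integrable_fin_num => //; exact: integrableS iF.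
  by congr EFin.
apply: filterS3 fF ug ug' => x E1 E2 E3 Ox.
by have := E1 Ox; rewrite /f /F -E2// -E3// => -[].
Qed.

End time_increments.

(** * The subdifferential inequality *)

Section energy.
Context {R : realType} (n : nat) (mR := measurableTypeR R).
Local Notation RN := (n.-tuple R).
Local Notation lebN := (lebesgue_tuple R n).
Local Notation leb := (@lebesgue_measure R).
Local Notation M := (lebQ n : {measure set (RN * mR) -> \bar R}).
Variables (Omega : set RN) (T : R) (phi P : RN -> R -> R) (E : (RN -> R) -> \bar R).
Hypothesis mO : measurable Omega.
Hypothesis T0 : 0 < T.
Hypothesis nP : forall x, yfun (P x).
Hypothesis mP : measurable_fun setT (fun p : RN * mR => P p.1 p.2).
Hypothesis mPr : forall r, measurable_fun setT (P ^~ r).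
Hypothesis PE : {ae lebN, forall x, Omega x -> P x = phi x}.
Hypothesis AB : assumptionB Omega phi E.
Variables (u eta eta0 v : RN * mR -> R) (ubar : R -> RN -> R) (lam : R).
Hypothesis uC0 : C0_representative Omega phi T u ubar.
Hypothesis uV : calV Omega phi T u.
Hypothesis ueta : opB Omega phi E T u eta.
Hypothesis meta0 : measurable_fun setT eta0.
Hypothesis mv : measurable_fun setT v.
Local Notation cyl := (cylinder Omega T : set (RN * mR)).
Hypothesis etaE : eta = eta0 %[ae M in cyl].
Hypothesis lam0 : 0 < lam.
Hypothesis eta0P :
  (\int[M]_(p in cyl) conjugate (P p.1) (lam * `|eta0 p|) < +oo)%E.
Hypothesis incrE : forall s t, 0 <= s -> s <= t -> t <= T ->
  {ae lebN, forall x, Omega x ->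
    ubar t x - ubar s x = primX v (x, t) - primX v (x, s)}.

Local Notation V := (spaceV Omega phi).

Let mcyl : measurable cyl. Proof. exact: measurableX. Qed.

Lemma EphiE : {ae lebN, forall x, Omega x -> forall r, Ephi phi x r = (P x r)%:E}.
Proof. by apply: filterS PE => x h Ox r; rewrite /Ephi h. Qed.

Lemma PhiQE : {ae M, forall p, cyl p -> forall r, PhiQ phi p r = (P p.1 r)%:E}.
Proof. exact: (ae_fst (m := lebN) (`]0, T[%classic : set mR) EphiE). Qed.

Let mPQ : measurable_fun setT (fun q : (RN * mR) * mR => P q.1.1 q.2).
Proof.
apply: (measurableT_comp mP (f := _) (g := fun q : (RN * mR) * mR => (q.1.1, q.2))).
apply: measurable_fun_pair => //.
by apply: (measurableT_comp measurable_fst); exact: measurable_fst.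
Qed.

Let nPQ (p : RN * mR) : yfun (P p.1). Proof. exact: nP. Qed.

Let VT0 : 0 <= (0 : R) <= T. Proof. by rewrite lexx ltW. Qed.

Let ubarV t : 0 <= t <= T -> V (ubar t).
Proof. exact: uC0.1.1. Qed.

Lemma exists_joint_representative : exists c : RN -> R, measurable_fun setT c /\
  c = ubar 0 %[ae lebN in Omega].
Proof.
have [c [_ [mc ec _ _]]] := Lphi_elim mO nP EphiE (ubarV VT0).
by exists c; split => //; apply: filterS ec => x h Ox; rewrite h.
Qed.

Variable c : RN -> R.
Hypothesis mc : measurable_fun setT c.
Hypothesis cE : c = ubar 0 %[ae lebN in Omega].

Definition u0 (p : RN * mR) : R := c p.1 + (primX v p - primX v (p.1, 0)).

Lemma u0_sub x s t : u0 (x, t) - u0 (x, s) = primX v (x, t) - primX v (x, s).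
Proof. by rewrite /u0/=; ring. Qed.

Lemma measurable_u0 : measurable_fun setT u0.
Proof.
apply: measurable_funD; first exact: (measurableT_comp mc).
apply: measurable_funB; first exact: measurable_primX.
have m0 : measurable_fun setT (fun p : RN * mR => (p.1, 0) : RN * mR).
  exact: measurable_fun_pair.
exact: (measurableT_comp (measurable_primX mv) m0).
Qed.

Lemma u0_ubar t : 0 <= t <= T -> slice u0 t = ubar t %[ae lebN in Omega].
Proof.
move=> /andP[t0 tT]; apply: filterS2 cE (incrE (lexx 0) t0 tT) => x h1 h2 Ox.
by rewrite /slice /u0/= h1// -h2//; ring.
Qed.

Lemma u0V t : 0 <= t <= T -> V (slice u0 t).
Proof.
move=> tT; apply: (eq_Lphi mO nP EphiE) (ubarV tT).
by apply: filterS (u0_ubar tT) => x h Ox; rewrite h.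
Qed.

Lemma u_u0_slices : {ae leb, forall t, 0 < t < T -> slice u t = slice u0 t %[ae lebN in Omega]}.
Proof.
apply: (@filterS _ _ (ae_filter_ringOfSetsType leb) _ _ _ uC0.2) => t h tT.
have tT' : 0 <= t <= T by case/andP : tT => /ltW -> /ltW ->.
by apply: filterS2 (h tT) (u0_ubar tT') => x h1 h2 Ox; rewrite h2// h1.
Qed.

(** The slices agree for a.e. time. To conclude on the product, [u] is replaced by a Borel version
    [u1], so that the set where it differs from [u0] is measurable and [null_slices] applies. *)
Lemma u_u0 : u = u0 %[ae M in cyl].
Proof.
have [u1 [_ [mu1 uu1 _ _]]] := Lphi_elim mcyl nPQ PhiQE uV.
pose S := cyl `&` (fun p => u1 p - u0 p) @^-1` (~` [set 0]).
have mS : measurable S.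
  have mB : measurable_fun cyl (fun p => u1 p - u0 p).
    by apply: measurable_funTS; apply: measurable_funB => //; exact: measurable_u0.
  by apply: (mB mcyl); apply: measurableC; exact: measurable_set1.
have S0 : M S = 0%E.
  apply: (null_slices (m := lebN) mS).
  have := ae_slices (m := lebN) uu1; have := u_u0_slices.
  apply: (@filterS2 _ _ (ae_filter_ringOfSetsType leb)) => t h1 h2.
  have [tT|tT] := boolP (0 < t < T); last first.
    apply: nearW => x [[_ /=]]; rewrite in_itv/= => tT'.
    by move: tT; rewrite tT'.
  apply: filterS2 (h1 tT) h2 => x k1 k2 [Cx /=]; apply.
  by have := k1 Cx.1; rewrite /slice k2// => ->; rewrite subrr.
have S0' : {ae M, forall p, ~ S p} by exists S; split => // p /contrapT.
apply: filterS2 uu1 S0' => p h1 h2 Cp; rewrite h1//.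
apply: contrapT => h3; apply: h2; split => //= h4; apply: h3.
by apply/eqP; rewrite -subr_eq0 h4.
Qed.

Lemma u0_modular : exists2 l, 0 < l & (\int[M]_(p in cyl) (P p.1 (l * u0 p))%:E < +oo)%E.
Proof.
have [u1 [l [mu1 uu1 l0 h]]] := Lphi_elim mcyl nPQ PhiQE uV; exists l => //.
rewrite (@ae_eq_integral_unmeasurable _ _ _ _ _ _ (fun p => (P p.1 (l * u1 p))%:E))//.
by apply: filterS2 uu1 u_u0 => p h1 h2 Cp; rewrite -h2// h1.
Qed.

Let e t := E (ubar t).

Lemma E_u0 t : 0 <= t <= T -> E (slice u0 t) = e t.
Proof.
by move=> tT; apply: (B_ae AB) => //; [exact: u0V|exact: ubarV|exact: u0_ubar].
Qed.

Lemma energy_ge0 t : 0 <= t <= T -> (0 <= e t)%E.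
Proof. by move=> tT; apply: (B_ge0 AB); exact: ubarV. Qed.

Lemma energy_lsc t (a : R) : 0 <= t <= T -> (a%:E < e t)%E ->
  exists2 del, 0 < del &
    forall s, 0 <= s <= T -> `|s - t| < del -> (a%:E < e s)%E.
Proof.
move=> tT /(B_lsc AB (ubarV tT))[r r0 H].
have [del del0 Hd] := uC0.1.2 _ tT _ r0.
by exists del => // s sT st; apply: H; [exact: ubarV|exact: Hd].
Qed.

(** The value 0 outside the open interval preserves lower semicontinuity, because the energy is
    nonnegative there; hence a Borel function on the whole line. *)
Definition energy (t : R) : \bar R := if 0 < t < T then e t else 0%E.

Lemma energyT_ge0 t : (0 <= energy t)%E.
Proof.
rewrite /energy; case: ifPn => // /andP[/ltW t0 /ltW tT].
by apply: energy_ge0; rewrite t0.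
Qed.

Lemma measurable_energy : measurable_fun setT energy.
Proof.
apply: lower_semicontinuous_measurable => t a; rewrite {1}/energy.
case: ifPn => [/andP[t0 tT] ae|_ a0]; last first.
  by exists setT; [exact: filterT|move=> s _; apply: lt_le_trans (energyT_ge0 s)].
have tT' : 0 <= t <= T by rewrite !ltW.
have [del del0 Hd] := energy_lsc tT' ae.
exists (ball t (Num.min del (Num.min t (T - t)))).
  by apply: nbhsx_ballx; rewrite !lt_min del0 t0 subr_gt0.
move=> s; rewrite /ball/= !lt_min distrC => /and3P[h1 h2 h3].
have sT : 0 < s < T by move: h2 h3; rewrite !ltr_norml => /andP[? ?] /andP[? ?]; lra.
by rewrite /energy sT; apply: Hd => //; case/andP : sT => /ltW -> /ltW ->.
Qed.

Lemma E_u : {ae leb, forall t, (`]0, T[%classic : set mR) t -> E (slice u t) = energy t}.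
Proof.
apply: (@filterS _ _ (ae_filter_ringOfSetsType leb) _ _ _ uC0.2) => t h.
rewrite /= in_itv/= => tT; rewrite /energy tT /e.
have tT' : 0 <= t <= T by case/andP : tT => /ltW -> /ltW ->.
have hh := h tT.
apply/esym; apply: (B_ae AB) => //; first exact: ubarV.
by apply: (eq_Lphi mO nP EphiE) (ubarV tT').
Qed.

Lemma pairing_integrable (f : RN * mR -> R) (l : R) : measurable_fun setT f -> 0 < l ->
  (\int[M]_(p in cyl) (P p.1 (l * f p))%:E < +oo)%E ->
  M.-integrable cyl (fun p => (eta0 p * f p)%:E).
Proof.
move=> mf l0 fP; pose k := lam * l; have k0 : 0 < k by exact: mulr_gt0.
have mPf : measurable_fun setT (fun p : RN * mR => P p.1 (l * f p)).
  apply: (@measurable_comp_yfun _ _ _ (fun p : RN * mR => P p.1) mPQ (fun p => l * f p)).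
  exact: measurable_funM.
have mconj : measurable_fun setT (fun p : RN * mR => conjugate (P p.1) (lam * `|eta0 p|)).
  apply: (measurableT_comp (measurable_conjugate nP mPr) (f := _)
    (g := fun p : RN * mR => (p.1, lam * `|eta0 p|))).
  apply: measurable_fun_pair => //; apply: measurable_funM => //.
  exact: measurableT_comp.
apply/integrableP; split.
  by apply/measurable_EFinP; apply: measurable_funTS; exact: measurable_funM.
apply: (@le_lt_trans _ _ (\int[M]_(p in cyl) ((k^-1)%:E *
    ((P p.1 (l * f p))%:E + conjugate (P p.1) (lam * `|eta0 p|))))%E).
  apply: ge0_le_integral_unmeasurable => [p _|p _]; first by rewrite abse_ge0.
  rewrite /= -(@lee_pmul2l _ k%:E)// muleA -!EFinM mulfV ?gt_eqF// mul1e.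
  have := young (P p.1) `|l * f p| (lam * `|eta0 p|).
  rewrite (yfun_norm (nP p.1)); apply: le_trans; rewrite lee_fin /k !normrM (gtr0_norm l0).
  by rewrite le_eqVlt; apply/orP; left; apply/eqP; ring.
rewrite ge0_integralZl//; last 3 first.
- by apply: measurable_funTS; apply: emeasurable_funD => //; exact/measurable_EFinP.
- by move=> p _; rewrite adde_ge0// ?lee_fin ?yfun_ge0// conjugate_ge0.
- by rewrite lee_fin invr_ge0 ltW.
rewrite ge0_integralD//; last 4 first.
- by move=> p _; rewrite lee_fin yfun_ge0.
- exact/measurable_EFinP/measurable_funTS.
- by move=> p _; exact: conjugate_ge0.
- exact: measurable_funTS.
by rewrite lte_mul_pinfty ?lee_fin ?invr_ge0 ?(ltW k0)// lte_add_pinfty.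
Qed.

Lemma pairingQE (f : RN * mR -> R) :
  pairingQ Omega T eta (f - u) = (\int[M]_(p in cyl) (eta0 p * (f p - u0 p))%:E)%E.
Proof.
apply: ae_eq_integral_unmeasurable.
by apply: filterS2 etaE u_u0 => p h1 h2 Cp; rewrite h1//= -h2.
Qed.

Lemma calV_of (f : RN * mR -> R) l : measurable_fun setT f -> 0 < l ->
  (\int[M]_(p in cyl) (P p.1 (l * f p))%:E < +oo)%E -> calV Omega phi T f.
Proof.
move=> mf l0; apply: (Lphi_intro nPQ PhiQE) => //.
by exists f; [exact: measurable_funTS|exact: nearW].
Qed.

Let leT : (leb (`]0%R, T[%classic : set mR) < +oo)%E.
Proof. by rewrite lebesgue_measure_itv/=; case: ifP => // _; rewrite -EFinB ltry. Qed.

(** Obtained from the subdifferential inequality tested with an element of [domE] that is constant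
    in time: its energy and the pairing are finite, which excludes [calE E T u = +oo]. *)
Lemma integral_energy_fin : (\int[leb]_(t in `]0%R, T[) energy t < +oo)%E.
Proof.
have [v0 [v0V Ev0]] := B_proper AB.
have [v1 [l [mv1 v01 l0 v1P]]] := Lphi_elim mO nP EphiE v0V.
have V1 : V v1 by apply: (eq_Lphi mO nP EphiE) v0V.
have Ev1 : (E v1 < +oo)%E.
  by rewrite (B_ae AB V1 v0V)//; apply: filterS v01 => x h Ox; rewrite h.
have E0 : (0 <= E v1)%E by exact: (B_ge0 AB).
pose f (p : RN * mR) := v1 p.1.
have mf : measurable_fun setT f by exact: (measurableT_comp mv1).
have fP : (\int[M]_(p in cyl) (P p.1 (l * f p))%:E < +oo)%E.
  rewrite (@ge0_integral_rect2 _ _ _ lebN (fun p => (P p.1 (l * f p))%:E) Omega)//.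
  - have := integral_cst leb (measurable_itv `]0, T[)
      (\int[lebN]_(x in Omega) (P x (l * v1 x))%:E)%E.
    rewrite /cst /f/= => ->; rewrite muleC lte_mul_pinfty//.
    + by rewrite ge0_fin_numE.
  - apply/measurable_EFinP.
    apply: (@measurable_comp_yfun _ _ _ (fun p : RN * mR => P p.1) mPQ (fun p => l * f p)).
    exact: measurable_funM.
  - by move=> p; rewrite lee_fin yfun_ge0.
have := ueta.2 _ (calV_of mf l0 fP).
have -> : calE E T f = (E v1 * leb (`]0%R, T[%classic : set mR))%E.
  rewrite /calE; case: asboolP => [_|[]].
    exact: (integral_cst leb (measurable_itv `]0, T[) (E v1)).
  split.
    exists (cst (E v1)); first exact: measurable_cst.
    exact: nearW.
  rewrite (_ : (\int[_]_(_ in _) _)%E = (`|E v1| * leb (`]0%R, T[%classic : set mR))%E); last first.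
    exact: (integral_cst leb (measurable_itv `]0, T[) `|E v1|%E).
  rewrite gee0_abs// muleC lte_mul_pinfty// ge0_fin_numE//.
rewrite pairingQE.
have [l' l'0 u0P] := u0_modular.
have i1 := pairing_integrable mf l0 fP.
have i2 := pairing_integrable measurable_u0 l'0 u0P.
have fin : (\int[M]_(p in cyl) (eta0 p * (f p - u0 p))%:E)%E \is a fin_num.
  apply: integrable_fin_num => //.
  rewrite (_ : (fun p => _) = (fun p => (eta0 p * f p)%:E - (eta0 p * u0 p)%:E)%E).
    exact: integrableB.
  by apply/funext => p; rewrite mulrBr.
rewrite -leeBrDr// /calE; case: asboolP => [[_ +] _|_]; last first.
  rewrite leye_eq => /eqP; rewrite -(fineK fin) => h.
  have : (E v1 * leb (`]0%R, T[%classic : set mR) < +oo)%E.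
    by rewrite muleC lte_mul_pinfty// ge0_fin_numE.
  by move: h; case: (E v1 * _)%E.
apply: le_lt_trans; rewrite le_eqVlt; apply/orP; left; apply/eqP.
apply: ae_eq_integral_unmeasurable.
apply: (@filterS _ _ (ae_filter_ringOfSetsType leb) _ _ _ E_u) => t h Jt.
by rewrite h// gee0_abs// energyT_ge0.
Qed.

(** Localization in time: the competitor is [f] on [I] and [u0] elsewhere, and the contributions of
    the times outside [I] cancel. *)
Lemma energy_test (I : set mR) (f : RN * mR -> R) (l : R) (e' : R -> \bar R) :
  measurable I -> I `<=` `]0, T[ -> measurable_fun setT f -> 0 < l ->
  (\int[M]_(p in Omega `*` I) (P p.1 (l * f p))%:E < +oo)%E ->
  measurable_fun setT e' -> (forall t, 0 <= e' t)%E ->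
  (forall t, I t -> E (slice f t) = e' t) ->
  (\int[leb]_(t in I) e' t < +oo)%E ->
  (\int[leb]_(t in I) energy t +
   \int[M]_(p in Omega `*` I) (eta0 p * (f p - u0 p))%:E <=
   \int[leb]_(t in I) e' t)%E.
Proof.
move=> mI IT mf l0 fP me' e'0 fe' e'I.
pose A : set (RN * mR) := setT `*` I.
have mA : measurable A by exact: measurableX.
have mCA : measurable (~` A) by exact: measurableC.
have cylA : cyl `&` A = Omega `*` I.
  apply/seteqP; split => [[x t] [[Ox _] [_ It]]|[x t] [Ox It]]; first by split.
  by do 2 split => //; exact: IT.
have TI : (`]0, T[%classic : set mR) `&` I = I by exact/setIidPr.
pose vt p : R := (f \_ A) p + (u0 \_ (~` A)) p.
have vtI x t : I t -> vt (x, t) = f (x, t).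
  move=> It; rewrite /vt patchE mem_set// patchE memNset ?addr0//.
  by move=> /(_ (conj Logic.I It)).
have vtC x t : ~ I t -> vt (x, t) = u0 (x, t).
  move=> It; rewrite /vt patchE memNset; last by case.
  by rewrite patchE mem_set ?add0r// => -[].
have mu0 := measurable_u0.
have mvt : measurable_fun setT vt.
  apply: measurable_funD.
    by apply/(measurable_restrictT _ mA); exact: measurable_funTS.
  by apply/(measurable_restrictT _ mCA); exact: measurable_funTS.
have [lu lu0 u0P] := u0_modular.
have mPf (g : RN * mR -> R) k : measurable_fun setT g ->
    measurable_fun setT (fun p : RN * mR => (P p.1 (k * g p))%:E).
  move=> mg; apply/measurable_EFinP.
  apply: (@measurable_comp_yfun _ _ _ (fun p : RN * mR => P p.1) mPQ (fun p => k * g p)).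
  exact: measurable_funM.
have vtV : calV Omega phi T vt.
  (* One scale has to serve both pieces of [vt]; the modulars are monotone in the scale. *)
  apply: (@calV_of _ (Num.min l lu)) => //; first by rewrite lt_min l0.
  apply: (@le_lt_trans _ _ (\int[M]_(p in cyl)
    (((fun p => (P p.1 (l * f p))%:E) \_ A) p + (P p.1 (lu * u0 p))%:E))%E).
    apply: ge0_le_integral_unmeasurable => [p _|[x t] _]; first by rewrite lee_fin yfun_ge0.
    have m0 : 0 < Num.min l lu by rewrite lt_min l0.
    have [It|It] := pselect (I t).
      rewrite vtI// patchE mem_set// -EFinD lee_fin.
      apply: (@le_trans _ _ (P x (l * f (x, t)))); last by rewrite lerDl yfun_ge0.
      apply: yfun_homo => //; rewrite !normrM ler_wpM2r// !gtr0_norm//.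
      by rewrite ge_min lexx.
    rewrite vtC// patchE memNset; last by case.
    rewrite add0e lee_fin; apply: yfun_homo => //.
    rewrite !normrM ler_wpM2r// !gtr0_norm//.
    by rewrite ge_min lexx orbT.
  have mPA : measurable_fun setT ((fun p => (P p.1 (l * f p))%:E) \_ A).
    by apply/(measurable_restrictT _ mA); apply: measurable_funTS; exact: mPf.
  rewrite ge0_integralD//; last 4 first.
  - by move=> p _; rewrite patchE; case: ifP => // _; rewrite lee_fin yfun_ge0.
  - exact: measurable_funTS.
  - by move=> p _; rewrite lee_fin yfun_ge0.
  - by apply: measurable_funTS; exact: mPf.
  by rewrite lte_add_pinfty// -integral_mkcondr cylA.
have split_int (g1 g2 : R -> \bar R) : measurable_fun setT g1 -> measurable_fun setT g2 ->
    (forall t, 0 <= g1 t)%E -> (forall t, 0 <= g2 t)%E ->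
    (\int[leb]_(t in `]0%R, T[) ((g1 \_ I) t + (g2 \_ (~` I)) t) =
     \int[leb]_(t in I) g1 t +
     \int[leb]_(t in (`]0%R, T[%classic : set mR) `&` ~` I) g2 t)%E.
  move=> mg1 mg2 g10 g20; have mCI : measurable (~` I) by exact: measurableC.
  rewrite ge0_integralD//; last 4 first.
  - by move=> t _; rewrite patchE; case: ifP.
  - by apply: measurable_funTS; apply/(measurable_restrictT _ mI); exact: measurable_funTS.
  - by move=> t _; rewrite patchE; case: ifP.
  - by apply: measurable_funTS; apply/(measurable_restrictT _ mCI); exact: measurable_funTS.
  by rewrite -!integral_mkcondr TI.
have en0 := energyT_ge0; have men := measurable_energy.
(* This part appears on both sides of the final inequality; its finiteness is what permits the
   cancellation. *)
have restE : (\int[leb]_(t in (`]0%R, T[%classic : set mR) `&` ~` I) energy t)%E \is a fin_num.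
  rewrite ge0_fin_numE; last by apply: integral_ge0 => t _.
  apply: le_lt_trans integral_energy_fin; apply: ge0_subset_integral => //.
  - by apply: measurableI => //; exact: measurableC.
  - exact: measurable_funTS.
pose hh t := ((e' \_ I) t + (energy \_ (~` I)) t)%E.
have hE t : (`]0%R, T[%classic : set mR) t -> E (slice vt t) = hh t.
  move=> Jt; have tT : 0 < t < T by move: Jt; rewrite /= in_itv.
  have tT' : 0 <= t <= T by case/andP : tT => /ltW -> /ltW ->.
  rewrite /hh; have [It|It] := pselect (I t).
    rewrite patchE mem_set// patchE memNset ?adde0; last by [].
    by rewrite -fe'//; congr E; apply/funext => x; exact: vtI.
  rewrite patchE memNset// patchE mem_set// add0e /energy tT -E_u0//.
  by congr E; apply/funext => x; exact: vtC.
have hh0 t : (0 <= hh t)%E by rewrite adde_ge0// patchE; case: ifP.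
have mhh : measurable_fun setT hh.
  apply: emeasurable_funD.
    by apply/(measurable_restrictT _ mI); exact: measurable_funTS.
  by apply/(measurable_restrictT _ (measurableC mI)); exact: measurable_funTS.
have calEvt : calE E T vt = (\int[leb]_(t in I) e' t +
     \int[leb]_(t in (`]0%R, T[%classic : set mR) `&` ~` I) energy t)%E.
  rewrite -split_int// /calE; case: asboolP => [_|[]].
    by apply: eq_integral => t; rewrite inE => /hE.
  split.
    exists hh; first exact: measurable_funTS.
    by apply: nearW => t /hE.
  rewrite (eq_integral hh) => [|t]; last first.
    by rewrite inE => /hE ->; rewrite gee0_abs.
  rewrite split_int// lte_add_pinfty//.
  by rewrite -ge0_fin_numE// integral_ge0.
have calEu : calE E T u = (\int[leb]_(t in I) energy t +
     \int[leb]_(t in (`]0%R, T[%classic : set mR) `&` ~` I) energy t)%E.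
  have E_u' := E_u.
  rewrite -split_int// /calE; case: asboolP => [_|[]].
    apply: ae_eq_integral_unmeasurable.
    apply: (@filterS _ _ (ae_filter_ringOfSetsType leb) _ _ _ E_u') => t h Jt.
    rewrite h//; have [It|It] := pselect (I t).
      by rewrite patchE mem_set// patchE memNset ?adde0.
    by rewrite patchE memNset// patchE mem_set// add0e.
  split; first by exists energy => //; exact: measurable_funTS.
  apply: le_lt_trans integral_energy_fin; rewrite le_eqVlt; apply/orP; left; apply/eqP.
  apply: ae_eq_integral_unmeasurable.
  apply: (@filterS _ _ (ae_filter_ringOfSetsType leb) _ _ _ E_u') => t h Jt.
  by rewrite h// gee0_abs.
have := ueta.2 _ vtV; rewrite calEvt calEu pairingQE.
have -> : (\int[M]_(p in cyl) (eta0 p * (vt p - u0 p))%:E =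
    \int[M]_(p in Omega `*` I) (eta0 p * (f p - u0 p))%:E)%E.
  rewrite -cylA [RHS]integral_mkcondr; apply: eq_integral => -[x t] _.
  rewrite patchE; have [It|It] := pselect (I t).
    by rewrite mem_set// vtI.
  by rewrite memNset ?vtC ?subrr ?mulr0//; case.
by rewrite addeAC leeD2rE.
Qed.

Lemma energy_test_const t a b : 0 <= a -> a < b -> b <= T -> 0 <= t <= T ->
  (e t < +oo)%E ->
  (\int[leb]_(s in `]a, b[) energy s +
   \int[M]_(p in Omega `*` `]a, b[) (eta0 p * (primX v (p.1, t) - primX v p))%:E <=
   e t * (b - a)%:E)%E.
Proof.
move=> a0 ab bT tT et.
have muab : leb (`]a, b[%classic : set mR) = (b - a)%:E.
  by rewrite lebesgue_measure_itv/= lte_fin ab.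
have [_ [l l0 ml]] := u0V tT.
have := modularE nP EphiE (fun x => l * slice u0 t x) => modE.
rewrite modE in ml.
have mut : measurable_fun setT (fun x : RN => u0 (x, t)).
  exact: (measurable_fun_pair1 (t : mR) measurable_u0).
pose f (p : RN * mR) := u0 (p.1, t).
have mf : measurable_fun setT f by exact: (measurableT_comp mut).
have IT : (`]a, b[%classic : set mR) `<=` `]0, T[.
  by move=> s /=; rewrite !in_itv/= => /andP[sa sb]; rewrite (le_lt_trans a0 sa) (lt_le_trans sb bT).
have fP : (\int[M]_(p in Omega `*` `]a, b[) (P p.1 (l * f p))%:E < +oo)%E.
  rewrite (@ge0_integral_rect2 _ _ _ lebN (fun p => (P p.1 (l * f p))%:E) Omega)//.
  - have := integral_cst leb (measurable_itv `]a, b[)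
      (\int[lebN]_(x in Omega) (P x (l * u0 (x, t)))%:E)%E.
    rewrite /cst /f/= => ->; rewrite muab muleC lte_mul_pinfty//.
    by rewrite lee_fin subr_ge0 ltW.
  - apply/measurable_EFinP.
    apply: (@measurable_comp_yfun _ _ _ (fun p : RN * mR => P p.1) mPQ (fun p => l * f p)).
    exact: measurable_funM.
  - by move=> p; rewrite lee_fin yfun_ge0.
have icst : (\int[leb]_(s in `]a, b[) cst (e t) s = e t * (b - a)%:E)%E.
  by rewrite -muab; exact: (integral_cst leb (measurable_itv `]a, b[) (e t)).
have := @energy_test _ f l (cst (e t)) (measurable_itv `]a, b[) IT mf l0 fP.
rewrite icst.
under [X in _ -> _ -> _ -> _ -> (_ + X <= _)%E]eq_integral => p _.
  rewrite (_ : f p - u0 p = primX v (p.1, t) - primX v p); last first.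
    by case: p => x s; exact: u0_sub.
  over.
apply.
- exact: measurable_cst.
- by move=> s; exact: energy_ge0.
- by move=> s _; rewrite /= -E_u0.
- rewrite muleC lte_mul_pinfty// ?lee_fin ?subr_ge0 ?(ltW ab)//.
Qed.

Lemma energy_test_shift h a b : 0 <= a -> a < b -> b <= T -> 0 <= a + h -> b + h <= T ->
  (\int[leb]_(s in `]a, b[) energy s +
   \int[M]_(p in Omega `*` `]a, b[) (eta0 p * incr v h p)%:E <=
   \int[leb]_(s in `](a + h)%R, (b + h)%R[) energy s)%E.
Proof.
move=> a0 ab bT ah bh.
have [l l0 ml] := u0_modular.
have mu0 := measurable_u0.
pose f (p : RN * mR) := u0 (p.1, p.2 + h).
have mf : measurable_fun setT f.
  exact: (measurableT_comp mu0 (measurable_translate h)).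
have IT : (`]a, b[%classic : set mR) `<=` `]0, T[.
  by move=> s /=; rewrite !in_itv/= => /andP[sa sb]; rewrite (le_lt_trans a0 sa) (lt_le_trans sb bT).
have IhT : (`](a + h)%R, (b + h)%R[%classic : set mR) `<=` `]0, T[.
  by move=> s /=; rewrite !in_itv/= => /andP[sa sb]; rewrite (le_lt_trans ah sa) (lt_le_trans sb bh).
have preI : (fun t : mR => t + h) @^-1` `](a + h)%R, (b + h)%R[ = `]a, b[%classic.
  by apply/seteqP; split => s /=; rewrite !in_itv/= !ltrD2r.
have mPf (g : RN * mR -> R) k : measurable_fun setT g ->
    measurable_fun setT (fun p : RN * mR => (P p.1 (k * g p))%:E).
  move=> mg; apply/measurable_EFinP.
  apply: (@measurable_comp_yfun _ _ _ (fun p : RN * mR => P p.1) mPQ (fun p => k * g p)).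
  exact: measurable_funM.
have P0 (g : RN * mR -> R) k p : (0 <= (P p.1 (k * g p))%:E)%E by rewrite lee_fin yfun_ge0.
pose J (t : mR) := (\int[lebN]_(x in Omega) (P x (l * u0 (x, t)))%:E)%E.
have J0 t : (0 <= J t)%E by apply: integral_ge0 => x _; rewrite lee_fin yfun_ge0.
have mJ : measurable_fun setT J.
  pose g p := ((fun p : RN * mR => (P p.1 (l * u0 p))%:E) \_ (Omega `*` setT)) p.
  have mOT : measurable (Omega `*` setT : set (RN * mR)) by exact: measurableX.
  have mg : measurable_fun setT g.
    by apply/(measurable_restrictT _ mOT); apply: measurable_funTS; exact: mPf.
  have := @measurable_fun_fubini_tonelli_G _ _ _ _ _ lebN g mg.
  have g0 p : (0 <= g p)%E by rewrite /g patchE; case: ifP.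
  move=> /(_ g0); congr measurable_fun; apply/funext => t.
  rewrite /fubini_G /J [RHS]integral_mkcond; apply: eq_integral => x _.
  rewrite /g !patchE; congr (if _ then _ else _).
  by apply/idP/idP; rewrite !inE/= => // -[].
have fP : (\int[M]_(p in Omega `*` `]a, b[) (P p.1 (l * f p))%:E < +oo)%E.
  rewrite (@ge0_integral_rect2 _ _ _ lebN (fun p => (P p.1 (l * f p))%:E) Omega)//; last exact: mPf.
  have := @ge0_integral_addr _ h (`](a + h)%R, (b + h)%R[%classic : set mR) J
    (measurable_itv _) (measurable_funTS mJ) (fun t _ => J0 t).
  rewrite preI => ->; apply: le_lt_trans ml.
  rewrite (@ge0_integral_rect2 _ _ _ lebN (fun p => (P p.1 (l * u0 p))%:E) Omega)//; last exact: mPf.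
  by apply: ge0_subset_integral => //; exact: measurable_funTS.
have en0 := energyT_ge0; have men := measurable_energy.
have mtr : measurable_fun setT (fun t : mR => energy (t + h)).
  by apply: (measurableT_comp men); exact: measurable_funD.
have := @energy_test _ f l (fun t => energy (t + h)) (measurable_itv `]a, b[) IT mf l0 fP mtr.
have -> : (\int[leb]_(t in `]a, b[) energy (t + h) =
    \int[leb]_(s in `](a + h)%R, (b + h)%R[) energy s)%E.
  have := @ge0_integral_addr _ h (`](a + h)%R, (b + h)%R[%classic : set mR) energy
    (measurable_itv _) (measurable_funTS men) (fun t _ => en0 t).
  by rewrite preI.
under [X in _ -> _ -> _ -> (_ + X <= _)%E]eq_integral => p _.
  rewrite (_ : f p - u0 p = incr v h p); last by case: p => x s; exact: u0_sub.
  over.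
apply => //.
- move=> t; rewrite /= in_itv/= => /andP[at_ tb].
  have thT : 0 < t + h < T by apply/andP; split; lra.
  rewrite /energy thT -E_u0//.
  by case/andP : thT => /ltW -> /ltW ->.
- apply: le_lt_trans integral_energy_fin; apply: ge0_subset_integral => //.
  exact: measurable_funTS.
Qed.

End energy.

(** * Scalar inequalities in time *)

Section slice_integral.
Context d (X : measurableType d) {R : realType} (mR := measurableTypeR R).
Variable m : {sigma_finite_measure set X -> \bar R}.
Local Notation leb := (@lebesgue_measure R).
Local Notation M := (m \x leb)%E.

Lemma integrable_EFin_fine (F : R -> \bar R) : leb.-integrable setT F ->
  leb.-integrable setT (EFin \o (fine \o F)).
Proof.
move=> iF; have mF := measurable_int _ iF.
apply: le_integrable iF => //.
  by apply/measurable_EFinP; exact: measurableT_comp.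
by move=> t _ /=; case: (F t) => [r|//|//]; rewrite /= ?normr0 ?leey.
Qed.

Lemma ae_EFin_fine (F : R -> \bar R) : leb.-integrable setT F ->
  {ae leb, forall t, F t = (fine (F t))%:E}.
Proof.
move=> iF; have := integrable_ae measurableT iF.
by apply: (@filterS _ _ (ae_filter_ringOfSetsType leb)) => t h; rewrite fineK// h.
Qed.

(** At times where the integral is infinite the value is the default 0; by [ae_slice_integral] these
    times are negligible. *)
Definition slice_integral (g : X * mR -> R) (t : R) : R := \int[m]_x g (x, t).

Variable g : X * mR -> R.
Hypothesis ig : M.-integrable setT (EFin \o g).

Lemma integrable_slice_integral : leb.-integrable setT (EFin \o slice_integral g).
Proof. exact: (integrable_EFin_fine (integrable_fubini2 ig)). Qed.

Lemma ae_slice_integral :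
  {ae leb, forall t, (\int[m]_x (g (x, t))%:E)%E = (slice_integral g t)%:E}.
Proof. exact: (ae_EFin_fine (integrable_fubini2 ig)). Qed.

Lemma prim_slice_integral a b : a <= b ->
  prim (slice_integral g) b - prim (slice_integral g) a =
  \int[M]_(p in setT `*` `]a, b[) g p.
Proof.
move=> ab; rewrite (prim_sub integrable_slice_integral)// /Rintegral; congr fine.
have mI : measurable (`]a, b[%classic : set mR) by exact: measurable_itv.
rewrite (@integral_itv_bndoo _ a b _ false false); last first.
  by apply: measurable_funTS; exact: measurable_int integrable_slice_integral.
rewrite [RHS]integral_mkcond.
have mXI : measurable (setT `*` `]a, b[ : set (X * mR)) by exact: measurableX.
have igI : M.-integrable setT ((EFin \o g) \_ (setT `*` `]a, b[)).
  by apply/(integrable_mkcond _ mXI); exact: integrableS ig.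
rewrite -(integral21_prod_meas1 igI) [LHS]integral_mkcond.
apply: ae_eq_integral_unmeasurable.
apply: (@filterS _ _ (ae_filter_ringOfSetsType leb) _ _ _ ae_slice_integral) => t h _.
rewrite patchE /=; case: ifPn => tI.
  rewrite -h; apply: eq_integral => x _; rewrite patchE mem_set//.
  by split => //; rewrite inE in tI.
rewrite /fubini_G integral0_eq// => x _; rewrite patchE memNset// => -[/= _ It].
by move/negP: tI; apply; rewrite inE.
Qed.

End slice_integral.

Section difference_inequalities.
Context d (X : measurableType d) {R : realType} (mR := measurableTypeR R).
Variable m : {sigma_finite_measure set X -> \bar R}.
Local Notation leb := (@lebesgue_measure R).
Local Notation M := (m \x leb)%E.
Variables (Omega : set X) (T : R) (v eta z w : X * mR -> R).
Hypothesis mO : measurable Omega.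
Hypothesis gp : good_pair m Omega T v eta z w.
Variables e energy : R -> \bar R.
Hypothesis e0 : forall t, 0 <= t <= T -> (0 <= e t)%E.
Hypothesis energy0 : forall t, (0 <= energy t)%E.
Hypothesis m_energy : measurable_fun setT energy.
Hypothesis energyT : forall t, ~~ (0 < t < T) -> energy t = 0%E.
Hypothesis i_energy : (\int[leb]_(t in `]0%R, T[) energy t < +oo)%E.
Hypothesis test_const : forall t a b, 0 <= a -> a < b -> b <= T -> 0 <= t <= T ->
  (e t < +oo)%E ->
  (\int[leb]_(s in `]a, b[) energy s +
   \int[M]_(p in Omega `*` `]a, b[) (eta p * (primX v (p.1, t) - primX v p))%:E <=
   e t * (b - a)%:E)%E.
Hypothesis test_shift : forall h a b, 0 <= a -> a < b -> b <= T ->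
  0 <= a + h -> b + h <= T ->
  (\int[leb]_(s in `]a, b[) energy s +
   \int[M]_(p in Omega `*` `]a, b[) (eta p * incr v h p)%:E <=
   \int[leb]_(s in `](a + h)%R, (b + h)%R[) energy s)%E.

Let f : R -> R := fine \o energy.
Let H := slice_integral m (fun p => eta p * v p).
Let Z := slice_integral m (fun p => z p + w p).

Lemma energy_integrable : leb.-integrable setT energy.
Proof.
apply/integrableP; split => //.
rewrite (_ : (\int[_]_(_ in _) _ = \int[leb]_(t in `]0%R, T[) energy t)%E)//.
rewrite [RHS]integral_mkcond; apply: eq_integral => t _.
rewrite gee0_abs// patchE; case: ifPn => // tT; apply: energyT.
by apply: contra tT => tT; rewrite inE/= in_itv/=.
Qed.

Lemma fine_energy_ge0 t : 0 <= f t. Proof. exact: fine_ge0. Qed.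

Lemma fine_energy_integrable : leb.-integrable setT (EFin \o f).
Proof. exact: integrable_EFin_fine energy_integrable. Qed.

Lemma energy_prim a b : a <= b ->
  (\int[leb]_(t in `]a, b[) energy t = (prim f b - prim f a)%:E)%E.
Proof.
move=> ab; rewrite (EFin_prim_sub fine_energy_integrable)//.
rewrite (@integral_itv_bndoo _ a b _ false false); last first.
  by apply: measurable_funTS; exact: measurable_int fine_energy_integrable.
apply: ae_eq_integral_unmeasurable.
apply: (@filterS _ _ (ae_filter_ringOfSetsType leb) _ _ _ (ae_EFin_fine energy_integrable)).
by move=> t.
Qed.

(** [eta] vanishes off the cylinder, so the test inequalities over [Omega] combine with the bounds
    on primitives, which concern the whole space. *)
Let strip (k : X * mR -> R) (a b : R) :
  (\int[M]_(p in Omega `*` `]a, b[) (eta p * k p)%:E =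
   \int[M]_(p in setT `*` `]a, b[) (eta p * k p)%:E)%E.
Proof.
rewrite [LHS]integral_mkcond [RHS]integral_mkcond; apply: eq_integral => p _.
rewrite !patchE; have [pO|pO] := pselect (Omega p.1).
  by congr (if _ then _ else _); apply/idP/idP; rewrite !inE => -[].
rewrite (gp_eta0 gp) ?mul0r; last by case.
by case: ifP; case: ifP.
Qed.

Let iX (a b : R) : measurable (setT `*` `]a, b[ : set (X * mR)).
Proof. exact: measurableX. Qed.

Let iH : M.-integrable setT (EFin \o (fun p => eta p * v p)).
Proof.
exact: (integrable_pairing (gp_mv gp) (gp_meta gp) (gp_iz gp) (gp_iw gp) (gp_young gp)).
Qed.

Let iZ : M.-integrable setT (EFin \o (fun p => z p + w p)).
Proof. exact: (integrableD measurableT (gp_iz gp) (gp_iw gp)). Qed.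

Lemma energy_const_bound t a b : (e t < +oo)%E ->
  0 <= a -> a <= t -> t <= b -> b <= T ->
  prim f b - prim f a <= (b - a) * (fine (e t) + (prim Z b - prim Z a)).
Proof.
move=> et a0 at_ tb bT; have ab := le_trans at_ tb.
have [ab'|ab'] := eqVneq a b; first by rewrite ab' !subrr mul0r.
have {}ab' : a < b by rewrite lt_neqAle ab'.
have tT : 0 <= t <= T by rewrite (le_trans a0) ?(le_trans tb).
have := test_const a0 ab' bT tT et.
rewrite strip energy_prim//.
have efin : e t \is a fin_num by rewrite ge0_fin_numE// e0.
rewrite -{1}(fineK efin) -EFinM.
have tab : a <= t <= b by rewrite at_.
have := integral_primX_bound (gp_iz gp) (gp_iw gp) (gp_z0 gp)
  (gp_w0 gp) (gp_ivx gp) (gp_iwx gp) (gp_young gp) (erefl _) tab.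
have -> : (\int[M]_(p in setT `*` `]a, b[) (z p + w p)%:E = (prim Z b - prim Z a)%:E)%E.
  rewrite (prim_slice_integral iZ)// /Rintegral fineK//.
  by apply: integrable_fin_num => //; exact: integrableS iZ.
rewrite -EFinM.
set D := (\int[M]_(p in _) (eta p * _)%:E)%E => Dbound.
have : (`|D| <= ((b - a) * (prim Z b - prim Z a))%:E)%E.
  apply: le_trans Dbound; apply: le_abse_integral => //.
  apply/measurable_EFinP; apply: measurable_funTS.
  have mX := measurable_primX (gp_mv gp).
  apply: measurable_funM (gp_meta gp) _ ; apply: measurable_funB => //.
  have mt : measurable_fun setT (fun p : X * mR => (p.1, t) : X * mR).
    exact: measurable_fun_pair.
  exact: (measurableT_comp mX mt).
(* The bound on the absolute value of [D] excludes both infinite values. *)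
case: D {Dbound} => [r| |]//=; rewrite -EFinD !lee_fin ler_norml => /andP[h _] h2.
by rewrite mulrDr; lra.
Qed.

Let shift_bound h a b : 0 <= a -> a < b -> b <= T -> 0 <= a + h -> b + h <= T ->
  \int[M]_(p in setT `*` `]a, b[) (eta p * incr v h p) <=
  (prim f (b + h) - prim f (a + h)) - (prim f b - prim f a).
Proof.
move=> a0 ab bT ah bh.
have := test_shift a0 ab bT ah bh; rewrite strip !energy_prim ?lerD2r//; try exact: ltW.
have iI := integrable_pairing_incr (gp_mv gp) (gp_meta gp) (gp_iz gp) (gp_iw gp) (gp_w0 gp)
  (gp_ivx gp) (gp_iwx gp) (gp_young gp) h.
have fin : (\int[M]_(p in setT `*` `]a, b[) (eta p * incr v h p)%:E)%E \is a fin_num.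
  by apply: integrable_fin_num => //; exact: integrableS iI.
by rewrite -(fineK fin) -EFinD lee_fin /Rintegral; lra.
Qed.

Let h (k : nat) : R := k.+1%:R^-1.

Let h_gt0 k : 0 < h k. Proof. by rewrite invr_gt0 ltr0n. Qed.

Let cvg_h : h k @[k --> \oo] --> 0. Proof. exact: cvg_harmonic. Qed.

Lemma energy_shift_right a b k : 0 <= a -> a < b -> b < T -> 0 < k ->
  exists N, forall n, (N <= n)%N -> b + h n <= T ->
    h n * (prim H b - prim H a - k) <=
    (prim f (b + h n) - prim f (a + h n)) - (prim f b - prim f a).
Proof.
move=> a0 ab bT k0.
have hn0 n : h n != 0 by rewrite gt_eqF.
have [N HN] := liminf_pairing_incr (gp_mv gp) (gp_meta gp) (gp_iz gp) (gp_iw gp) (gp_w0 gp)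
  (gp_ivx gp) (gp_iwx gp) (gp_young gp) (measurable_itv `]a, b[) hn0 cvg_h k0.
exists N => n Nn bh.
have ah : 0 <= a + h n by rewrite addr_ge0// ltW.
apply: le_trans (shift_bound a0 ab (ltW bT) ah bh).
have := HN _ Nn; rewrite -(prim_slice_integral iH) ?(ltW ab)// => /ltW.
by rewrite -(ler_pM2l (h_gt0 n)) mulVKf.
Qed.

Lemma energy_shift_left a b k : 0 < a -> a < b -> b <= T -> 0 < k ->
  exists N, forall n, (N <= n)%N -> 0 <= a - h n ->
    - h n * (prim H b - prim H a + k) <=
    (prim f (b - h n) - prim f (a - h n)) - (prim f b - prim f a).
Proof.
move=> a0 ab bT k0.
have hn0 n : - h n != 0 by rewrite oppr_eq0 gt_eqF.
have cvgh : - h n @[n --> \oo] --> 0 by rewrite -oppr0; exact: cvgN.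
(* Dividing by the negative step [- h n] would reverse the inequality; changing the sign of [eta] as
   well restores the lower bound. *)
have metaN : measurable_fun setT (- eta) by exact: measurable_funN (gp_meta gp).
have youngN x t s : `|(- eta) (x, t) * v (x, s)| <= z (x, t) + w (x, s).
  by rewrite mulNr normrN; exact: gp_young gp _ _ _.
have [N HN] := liminf_pairing_incr (gp_mv gp) metaN (gp_iz gp) (gp_iw gp) (gp_w0 gp)
  (gp_ivx gp) (gp_iwx gp) youngN (measurable_itv `]a, b[) hn0 cvgh k0.
exists N => n Nn ah.
have bh : b + - h n <= T by rewrite (le_trans _ bT)// gerDl oppr_le0 ltW.
apply: le_trans (shift_bound (ltW a0) ab bT ah bh).
have iI := integrable_pairing_incr (gp_mv gp) (gp_meta gp) (gp_iz gp) (gp_iw gp) (gp_w0 gp)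
  (gp_ivx gp) (gp_iwx gp) (gp_young gp) (- h n).
have RN (k' : X * mR -> R) : M.-integrable setT (EFin \o (fun p => eta p * k' p)) ->
    \int[M]_(p in setT `*` `]a, b[) ((- eta) p * k' p) =
    - \int[M]_(p in setT `*` `]a, b[) (eta p * k' p).
  move=> ik; have iS : M.-integrable (setT `*` `]a, b[) (EFin \o (fun p => eta p * k' p)).
    exact: integrableS ik.
  have := RintegralZl (-1) (iX a b) iS.
  rewrite mulN1r => <-; apply: eq_Rintegral => p _.
  by rewrite mulN1r mulNr.
have := HN _ Nn; rewrite !RN// -(prim_slice_integral iH) ?(ltW ab)// => /ltW.
rewrite invrN mulrNN -(ler_pM2l (h_gt0 n)) mulVKf ?gt_eqF//.
by apply: le_trans; rewrite mulNr -mulrN; apply: ler_wpM2l; [exact: ltW|rewrite opprD].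
Qed.

End difference_inequalities.

(** * Absolute continuity and the chain rule *)

Lemma absolutely_continuous_prim {R : realType} (H g : R -> R) (a b : R) :
  lebesgue_measure.-integrable setT (EFin \o H) ->
  (forall s t, a <= s -> s <= t -> t <= b -> g t - g s = prim H t - prim H s) ->
  absolutely_continuous a b g.
Proof.
move=> iH gH e e0; have [del [del0 Hd]] := integral_normr_continuous iH e0.
exists del => // k l r lr disj small.
(* Half-open intervals, so that two of them sharing an endpoint are still disjoint. *)
pose F i : set (measurableTypeR R) := `]l i, r i]%classic.
have tF (D : set 'I_k) : trivIset D F.
  apply/trivIsetP => i j _ _ ij; apply/seteqP; split => // x [].
  rewrite /F/= !in_itv/= => /andP[h1 h2] /andP[h3 h4].
  by case: (disj i j ij) => h; lra.
have mF i : measurable (F i) by exact: measurable_itv.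
have muF i : lebesgue_measure (F i) = (r i - l i)%:E.
  rewrite lebesgue_measure_itv/= lte_fin; case: ltP => // rl.
  by have [_ h _] := lr i; rewrite (_ : r i = l i) ?subrr//; lra.
have mU : measurable (\big[setU/set0]_(i < k) F i) by exact: bigsetU_measurable.
have muU : (lebesgue_measure (\big[setU/set0]_(i < k) F i) < del%:E)%E.
  rewrite measure_semi_additive_ord//.
  rewrite (eq_bigr (fun i => (r i - l i)%:E)) => [|i _]; last exact: muF.
  by rewrite sumEFin lte_fin.
apply: le_lt_trans (Hd _ mU muU).
have mH : measurable_fun setT (fun x : measurableTypeR R => `|H x|%:E).
  apply/measurable_EFinP; apply: measurableT_comp => //.
  by apply/measurable_EFinP; exact: measurable_int iH.
have iS i : lebesgue_measure.-integrable (F i) (EFin \o H) by apply: integrableS iH.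
have fin i : (\int[lebesgue_measure]_(x in F i) `|H x|%:E)%E \is a fin_num.
  have iA := integrable_abse (iS i).
  by have := integrable_fin_num (mF i) iA.
rewrite /Rintegral (@ge0_integral_bigsetU _ _ _ _ _ F)//; last first.
- exact: measurable_funTS.
- exact: index_enum_uniq.
rewrite -sum_fine//; apply: ler_sum => i _; have [al lri rb] := lr i.
by rewrite gH// prim_sub//; exact: (le_normr_Rintegral (mF i) (iS i)).
Qed.

Theorem theorem7p1 (R : realType) (N : nat) (Omega : set (N.-tuple R)) (T : R)
    (phi alpha : N.-tuple R -> R -> R) (E : (N.-tuple R -> R) -> \bar R)
    (u u_t eta : N.-tuple R * R -> R) (ubar : R -> N.-tuple R -> R) :
  (0 < N)%N -> open_tuple Omega -> (lebesgue_tuple R N Omega < +oo)%E ->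
  0 < T ->
  assumptionA Omega phi alpha ->
  assumptionB Omega phi E ->
  calV1 Omega phi T u u_t ->
  C0_representative Omega phi T u ubar ->
  calVstar Omega phi T eta ->
  domB Omega phi E T u ->
  opB Omega phi E T u eta ->
  [/\ forall t, 0 <= t <= T -> E (ubar t) \is a fin_num,
      absolutely_continuous 0 T (fun t => fine (E (ubar t)))
    & forall s t, 0 <= s -> s <= t -> t <= T ->
        (\int[lebesgue_measure]_(tau in `[s, t]%classic)
           pairing Omega (slice eta tau) (slice u_t tau)
         = E (ubar t) - E (ubar s))%E].
Proof.
move=> _ oO _ T0 AA AB [uW11 utV] uC0 etaVs [uV _] etaB.
pose mR := measurableTypeR R; pose RN := N.-tuple R.
pose lebN := lebesgue_tuple R N; pose leb := @lebesgue_measure R.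
pose M : {measure set (RN * mR) -> \bar R} := lebQ N.
pose cyl : set (RN * mR) := cylinder Omega T.
have mO := open_tuple_measurable oO.
have mcyl : measurable cyl by exact: measurableX.
have [P [nP mPr PE]] := regularize_phi mO AA.
have mP : measurable_fun setT (fun p : RN * mR => P p.1 p.2).
  exact: (yfun_jointly_measurable nP (fun n => mPr _)).
have phiE := EphiE PE.
have starE : {ae lebN, forall x, Omega x -> forall r, phistar phi x r = conjugate (P x) r}.
  by apply: filterS PE => x h Ox r; rewrite /phistar h.
have conj1 : (\int[lebN]_(x in Omega) conjugate (P x) 1 < +oo)%E.
  apply: le_lt_trans (A_integrable AA).2.2; rewrite le_eqVlt; apply/orP; left; apply/eqP.
  apply: ae_eq_integral_unmeasurable; apply: filterS starE => x h Ox.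
  by rewrite h// gee0_abs// conjugate_ge0.
have [v1 [l [mv1 utv1 l0 v1P]]] :=
  @Lphi_elim _ _ _ M cyl _ (fun p : RN * mR => P p.1) mcyl (fun p => nP p.1) (PhiQE T PE) _ utV.
have [/(ae_measurableT mcyl)[eta1 meta1 etaE1] [lam lam0 lamP]] := etaVs.
have starQE : {ae M, forall p, cyl p -> forall r, PhistarQ phi p r = conjugate (P p.1) r}.
  exact: (ae_fst (m := lebN) (`]0, T[%classic : set mR) starE).
have conjP (k : RN * mR -> R) : eta = k %[ae M in cyl] ->
    (\int[M]_(p in cyl) conjugate (P p.1) (lam * `|k p|) < +oo)%E.
  move=> etak; apply: le_lt_trans lamP; rewrite le_eqVlt; apply/orP; left; apply/eqP.
  apply: ae_eq_integral_unmeasurable; apply: filterS2 etak starQE => p h1 h2 Cp.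
  by rewrite h2// h1// normrM gtr0_norm.
have [v [eta0 [z [w [gp vv1 eta01]]]]] :=
  exists_good_pair mO nP mP mPr conj1 mv1 meta1 l0 lam0 v1P (conjP _ etaE1).
have utE : u_t = v %[ae M in cyl].
  by apply: filterS2 utv1 vv1 => p h1 h2 Cp; rewrite h1// -h2.
have etaE : eta = eta0 %[ae M in cyl].
  by apply: filterS2 etaE1 eta01 => p h1 h2 Cp; rewrite h1// -h2.
have slicesE (k k' : RN * mR -> R) : k = k' %[ae M in cyl] ->
    {ae leb, forall t, 0 < t < T -> slice k t = slice k' t %[ae lebN in Omega]}.
  move=> kk'; have := ae_slices (m := lebN) kk'.
  apply: (@filterS _ _ (ae_filter_ringOfSetsType leb)) => t h tT.
  by apply: filterS h => x h Ox; apply: h; split => //=; rewrite in_itv.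
have [C C0 HC] := yfun_L1_bound mO nP mP mPr conj1.
have incrE := ubar_increment mO T0 nP mP phiE C0 HC uW11 uC0.1 uC0.2 (slicesE _ _ utE)
  (gp_mv gp) (gp_iv gp) (gp_ivx gp).
have [c [mc cE]] := exists_joint_representative mO T0 nP PE uC0.
have eta0P := conjP _ etaE.
pose en := energy T E ubar.
have en0 := energyT_ge0 AB uC0.
have men := measurable_energy AB uC0.
have enT t : ~~ (0 < t < T) -> en t = 0%E by move=> /negbTE h; rewrite /en /energy h.
have ien := integral_energy_fin mO nP mP mPr PE AB uC0 uV etaB (gp_meta gp) (gp_mv gp)
  etaE lam0 eta0P incrE mc cE.
have tc := energy_test_const mO nP mP mPr PE AB uC0 uV etaB (gp_meta gp) (gp_mv gp)
  etaE lam0 eta0P incrE mc cE.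
have ts := energy_test_shift mO nP mP mPr PE AB uC0 uV etaB (gp_meta gp) (gp_mv gp)
  etaE lam0 eta0P incrE mc cE.
pose f : R -> R := fine \o en.
pose H := slice_integral lebN (fun p => eta0 p * v p).
pose Z := slice_integral lebN (fun p => z p + w p).
have ip := integrable_pairing (gp_mv gp) (gp_meta gp) (gp_iz gp) (gp_iw gp) (gp_young gp).
have iH : leb.-integrable setT (EFin \o H) by exact: integrable_slice_integral ip.
have iZ : leb.-integrable setT (EFin \o Z).
  exact: integrable_slice_integral (integrableD measurableT (gp_iz gp) (gp_iw gp)).
have ife := fine_energy_integrable en0 men enT ien.
have e0 := energy_ge0 AB uC0.
have fe : {ae leb, forall t, 0 < t < T -> E (ubar t) = (f t)%:E}.
  have := ae_EFin_fine (energy_integrable en0 men enT ien).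
  apply: (@filterS _ _ (ae_filter_ringOfSetsType leb)) => t h tT.
  by rewrite /f/= -h /en /energy tT.
have T1 := energy_const_bound gp e0 en0 men enT ien tc.
have T2r := energy_shift_right gp en0 men enT ien ts.
have T2l := energy_shift_left gp en0 men enT ien ts.
have fin t : 0 <= t <= T -> E (ubar t) \is a fin_num.
  move=> tT; rewrite ge0_fin_numE ?e0//.
  exact: (energy_fin T0 (energy_lsc AB uC0) (fine_energy_ge0 en0) fe ife iZ T1 T2r T2l tT).
have chain s t : 0 <= s -> s <= t -> t <= T ->
    fine (E (ubar t)) - fine (E (ubar s)) = prim H t - prim H s.
  exact: (scalar_chain_rule T0 e0 (energy_lsc AB uC0) (fine_energy_ge0 en0) fe ife iH iZ
    T1 T2r T2l).
split => //; first exact: absolutely_continuous_prim iH chain.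
move=> s t s0 st tT.
have sT : 0 <= s <= T by rewrite s0 (le_trans st).
have tT' : 0 <= t <= T by rewrite (le_trans s0).
rewrite -(fineK (fin _ sT)) -(fineK (fin _ tT')) -EFinB chain// (EFin_prim_sub iH)//.
have mH D : measurable_fun D (EFin \o H).
  by apply: measurable_funTS; exact: measurable_int iH.
rewrite (@integral_itv_bndoo _ s t _ false false)// -(@integral_itv_bndoo _ s t _ true false)//.
apply: ae_eq_integral_unmeasurable.
(* The slices are controlled only at times of the open interval, while [[s, t]] may contain 0 or
   [T]; these two times are discarded as null. *)
have ne (a : R) : {ae leb, forall tau : R, tau <> a}.
  exists [set a]; split; [exact: measurable_set1|exact: lebesgue_measure_set1|].
  by move=> tau /= /contrapT.
have h12 := @filterI _ _ (ae_filter_ringOfSetsType leb) _ _ (slicesE _ _ etaE) (slicesE _ _ utE).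
have h34 := @filterI _ _ (ae_filter_ringOfSetsType leb) _ _ (ne 0) (ne T).
have h5 := ae_slice_integral ip.
have h345 := @filterI _ _ (ae_filter_ringOfSetsType leb) _ _ h34 h5.
apply: (@filterS2 _ _ (ae_filter_ringOfSetsType leb) _ _ _ _ h12 h345).
move=> tau [h1 h2] [[ne0 neT] {}h5]; rewrite /= in_itv/= => /andP[st1 st2].
have tauT : 0 < tau < T.
  have := le_trans s0 st1; rewrite le_eqVlt => /predU1P[/esym//|->].
  by have := le_trans st2 tT; rewrite le_eqVlt => /predU1P[//|->].
(* [H] integrates over the whole space and [pairing] over [Omega]; they agree since [eta0] vanishes
   off the cylinder. *)
rewrite -[RHS]h5 /pairing integral_mkcond [RHS]integral_mkcond.
apply: ae_eq_integral_unmeasurable.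
apply: filterS2 (h1 tauT) (h2 tauT) => x k1 k2 _.
rewrite !patchE; have [Ox|Ox] := pselect (Omega x).
  rewrite mem_set// mem_set//.
  by have := k1 Ox; have := k2 Ox; rewrite /slice => -> ->.
rewrite memNset// mem_set// (gp_eta0 gp) ?mul0r//.
by move=> -[].
Qed.
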